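(* There exist positive real constants $C, c_1, c_2$ such that for every function $p = p(q) \in [0,1]$ of the prime power $q$, with probability tending to $1$ as $q \to \infty$: (a) if $p = \omega(q^{-3})$ and $p = o(q^{-8/3})$, then $c_1\, p q^3 \le \alpha(\mathbb{F}_q^3,p) \le c_2\, p q^3$; (b) if $C q^{-2/3}\log^2 q \le p \le 1$, then $c_1\, pq \le \alpha(\mathbb{F}_q^3,p) \le c_2\, pq$; (c) if $q^{-8/3}/\log q \le p < C q^{-2/3}\log^2 q$, then $c_1\, q^{1/3}/\log q \le \alpha(\mathbb{F}_q^3,p) \le c_2\, q^{1/3}\log^2 q$.
   Context: $\mathbb{F}_q$ is the finite field with $q$ elements and $\mathbb{F}_q^3$ is the $3$-dimensional affine space over it. A set $S \subseteq \mathbb{F}_q^3$ is in general position if no $4$ points of $S$ are contained in a common affine plane ($2$-dimensional affine subspace). A $p$-random subset of $\mathbb{F}_q^3$ is obtained by including each point independently with probability $p$. $\alpha(\mathbb{F}_q^3,p)$ is the (random) maximum possible size of a point set in general position contained in a $p$-random subset of $\mathbb{F}_q^3$. The conditions on $p$ in (a), (b), (c) are conditions on the function $q \mapsto p(q)$: $p=\omega(f)$ means $p(q)/f(q)\to\infty$ and $p=o(f)$ means $p(q)/f(q)\to 0$ as $q\to\infty$ over prime powers, and the inequalities in (b) and (c) are required for all sufficiently large prime powers $q$. In each case the asserted two-sided bound holds with probability tending to $1$ as $q\to\infty$. *)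

(* Defs.v *)
From HB Require Import structures.
From mathcomp Require Import all_boot all_order all_algebra all_field.
From mathcomp Require Import all_classical all_reals all_analysis.

Set Implicit Arguments.
Unset Strict Implicit.
Unset Printing Implicit Defensive.

Import Order.TTheory GRing.Theory Num.Theory.
Import numFieldNormedType.Exports.

Local Open Scope ring_scope.

Definition prime_power (q : nat) : Prop :=
  exists r k : nat, [/\ prime r, (0 < k)%N & q = (r ^ k)%N].

(* The filter "q tends to infinity over the prime powers". *)
Definition prime_powers_oo : set_system nat :=
  within [set q | prime_power q]%classic \oo%classic.

Definition affine_plane (F : finFieldType) (P : {set 'rV[F]_3}) : Prop :=
  exists (v : 'rV[F]_3) (W : {vspace 'rV[F]_3}),
    \dim W = 2%N /\ P = [set x | x - v \in W].

Definition general_position (F : finFieldType) (S : {set 'rV[F]_3}) : Prop :=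
  forall T P : {set 'rV[F]_3},
    T \subset S -> #|T| = 4%N -> affine_plane P -> ~~ (T \subset P).

Definition alpha (F : finFieldType) (A : {set 'rV[F]_3}) : nat :=
  \max_(S : {set 'rV[F]_3} | (S \subset A) && `[< general_position S >]) #|S|.

(* Each A : {set T} has weight p ^+ #|A| * (1 - p) ^+ #|~: A|, the law of a
   set containing each point independently with probability p. *)
Definition prob_random_subset (R : realType) (T : finType) (p : R)
    (E : pred {set T}) : R :=
  \sum_(A : {set T} | E A) (\prod_(x in A) p) * (\prod_(x in ~: A) (1 - p)).

Definition prob_alpha_between (R : realType) (F : finFieldType)
    (p lo hi : R) : R :=
  prob_random_subset p
    [pred A : {set 'rV[F]_3} | lo <= (alpha A)%:R <= hi].

(* Main.v *)
(* Independent sets are counted by a container algorithm run on hard-core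
   partition functions, in the spirit of Campos and Samotij.  Branching on a
   vertex [v] whose occupation probability in the hard-core measure of the
   current family is at most [(1 - d) p] costs nothing when [v] is rejected, and
   divides the partition function by a constant when [v] is selected; hence
   only [O(p N)] vertices are selected while the ground set shrinks from [N] to
   [N / 2] points.  With [p N = q^(1/3)], such a vertex exists as long as
   [N >= 10^6 q]: otherwise a hard-core random set [A] would contain almost as
   many triples as a [p]-random set, and a weighted second moment computation
   (over collinear triples if many lines are rich, over coplanar quadruples if
   not) shows that a positive proportion of the points is blocked by [A].
   After [O(log q)] rounds there are at most [(C q / m)^m] general position sets
   of size [m >= q^(1/3) log^2 q], and a union bound gives the upper bounds.
   The lower bounds come from the moment curve and from deleting one point of
   each coplanar quadruple of a sparse random set. *)
From HB Require Import structures.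
From mathcomp Require Import all_boot all_order all_algebra all_field.
From mathcomp Require Import ring lra zify.
Require Import Defs.

Set Implicit Arguments.
Unset Strict Implicit.
Unset Printing Implicit Defensive.

Import Order.TTheory GRing.Theory Num.Theory.

Local Open Scope ring_scope.

(** * Hard-core partition functions *)

Section HardCore.
Variables (V : finType) (R : realFieldType).
Implicit Types (J : {set {set V}}) (C A D U : {set V}) (v : V) (x lam : R).

(** The scale [p N = q^(1/3)] is forced: the [(p N)^3 = q] triples of a random set span planes with
    about [N / q] points of the ground set each, just enough to block a constant share of it. The
    ground set is arbitrary, so its lines and planes need not have typical sizes; hence the weights
    by inverse line or plane size, and the separate treatment of rich lines, which would unbalance
    those weights. The contradiction is a double count of blocked pairs (vertex, random set): almost
    full occupation of every vertex allows a share of at most [d], while the second moment yields a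
    share that does not shrink with [d]. Containers and fingerprints are never written down. A power
    [Z^a] of the hard-core partition function serves as potential, and the union bound over sets of
    size [m] is read off from a partition function at a second activity [x]. The exponent [a] must
    be of order [log q] for [(1 + x (1 - d)^a)^N] to cost only [exp x]; each of the [O(log q)]
    rounds then costs [exp (O(q^(1/3) a))], and this is the origin of [log^2 q]. *)

Definition down_closed J := forall A D, D \subset A -> A \in J -> D \in J.
(** The hard-core measure gives [A] in [J] the probability [lam ^+ #|A| / partfun lam J]. A vertex
    [v] is then occupied with probability [lam * partfun lam (link v J) / partfun lam J], so
    occupation is controlled through the link. *)
Definition link v J := [set A : {set V} | (v \notin A) && (v |: A \in J)].
Definition deletion v J := [set A in J | v \notin A].
Definition partfun x J := \sum_(A in J) x ^+ #|A|.

Lemma partfun_ge0 x J : 0 <= x -> 0 <= partfun x J.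
Proof. by move=> x0; apply: sumr_ge0 => A _; apply: exprn_ge0. Qed.

Lemma partfun_ge1 x J : 0 <= x -> set0 \in J -> 1 <= partfun x J.
Proof.
move=> x0 J0; rewrite /partfun (bigD1 set0) //= cards0 expr0 lerDl.
by apply: sumr_ge0 => A _; apply: exprn_ge0.
Qed.

Lemma partfun_set0 x : partfun x set0 = 0.
Proof. by rewrite /partfun big_set0. Qed.

Lemma sum_link x v J :
  \sum_(A in J | v \in A) x ^+ #|A| = x * partfun x (link v J).
Proof.
rewrite /partfun mulr_sumr.
rewrite (reindex_onto (fun A => v |: A) (fun A => A :\ v)) /=; last first.
  by move=> A /andP[_ vA]; rewrite setD1K.
have E A : ((v |: A \in J) && (v \in v |: A)) && ((v |: A) :\ v == A)
   = (A \in link v J).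
  rewrite [in RHS]inE setU11 andbT andbC; congr (_ && _).
  apply/eqP/idP => [<-|vA]; first by rewrite !inE eqxx.
  by rewrite setU1K.
rewrite (eq_bigl _ _ E); apply: eq_bigr => A.
by rewrite inE => /andP[vA _]; rewrite cardsU1 vA exprS.
Qed.

Lemma partfun_split x v J :
  partfun x J = partfun x (deletion v J) + x * partfun x (link v J).
Proof.
rewrite -sum_link /partfun (bigID (fun A => v \in A)) /= addrC; congr (_ + _).
by apply: eq_bigl => A; rewrite inE.
Qed.

Lemma down_closed_link v J : down_closed J -> down_closed (link v J).
Proof.
move=> dJ A D DA; rewrite !inE => /andP[vA vAJ]; apply/andP; split.
  by apply: contra vA; apply: (subsetP DA).
by apply: dJ vAJ; apply: setUS.
Qed.

Lemma down_closed_deletion v J : down_closed J -> down_closed (deletion v J).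
Proof.
move=> dJ A D DA; rewrite !inE => /andP[AJ vA]; apply/andP; split.
  exact: dJ AJ.
by apply: contra vA; apply: (subsetP DA).
Qed.

Definition family_on (good : pred {set V}) C J :=
  down_closed J /\ (forall A, A \in J -> A \subset C /\ good A).

Lemma family_on_link good v C J : family_on good C J ->
  (forall A D, D \subset A -> good A -> good D) ->
  family_on good (C :\ v) (link v J).
Proof.
move=> [dJ JC] gh; split=> [|A]; first exact: down_closed_link.
rewrite inE => /andP[vA /JC [vAC gA]]; split.
  by rewrite subsetD1 vA andbT; apply: subset_trans vAC; apply: subsetUr.
by apply: gh gA; apply: subsetUr.
Qed.

Lemma family_on_deletion good v C J : family_on good C J ->
  family_on good (C :\ v) (deletion v J).
Proof.
move=> [dJ JC]; split=> [|A]; first exact: down_closed_deletion.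
by rewrite inE => /andP[/JC[sAC gA] vA]; split => //; rewrite subsetD1 sAC.
Qed.

Lemma set0_in_family J : down_closed J -> J != set0 -> set0 \in J.
Proof. by move=> dJ /set0Pn[A AJ]; apply: dJ AJ; apply: sub0set. Qed.

(* The fingerprint/container algorithm, run on partition functions: branching
   on a vertex [v] of small occupation either deletes [v], or puts [v] in the
   fingerprint, which shrinks the hard-core partition function by [1 - d]. *)
Lemma partfun_container (good : pred {set V}) lam x d B (a n1 n2 : nat) :
  (forall A D, D \subset A -> good A -> good D) ->
  0 <= lam -> 0 <= x -> 0 <= B -> d <= 1 ->
  (forall C J, (n1 < #|C| <= n2)%N -> family_on good C J -> set0 \in J ->
     exists2 v, v \in C & partfun lam (link v J) <= (1 - d) * partfun lam J) ->
  (forall C J, (#|C| <= n1)%N -> family_on good C J -> partfun x J <= B) ->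
  forall C J, (#|C| <= n2)%N -> family_on good C J ->
    partfun x J <= B * partfun lam J ^+ a * (1 + x * (1 - d) ^+ a) ^+ #|C|.
Proof.
move=> gh lam0 x0 B0 d1 step base C J.
have dd : 0 <= 1 - d by rewrite subr_ge0.
have e1 : 1 <= 1 + x * (1 - d) ^+ a by rewrite lerDl mulr_ge0 // exprn_ge0.
have e0 := le_trans ler01 e1.
move En : #|C| => n; elim: n C J En => [|n IHn] C J En Cn2 fJ.
  have [->|/(set0_in_family (proj1 fJ)) J0] := eqVneq J set0.
    rewrite partfun_set0 mulr_ge0 ?exprn_ge0 // mulr_ge0 // exprn_ge0 //.
    by rewrite partfun_set0.
  rewrite expr0 mulr1; apply: le_trans (base C J _ fJ) _; first by rewrite En.
  by rewrite ler_peMr // exprn_ege1 // partfun_ge1.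
have [->|/(set0_in_family (proj1 fJ)) J0] := eqVneq J set0.
  rewrite {1}partfun_set0 mulr_ge0 ?exprn_ge0 // mulr_ge0 // exprn_ge0 //.
  by rewrite partfun_set0.
have Z1 := partfun_ge1 lam0 J0; have Z0 := le_trans ler01 Z1.
have [n1C|Cn1] := ltnP n1 n.+1; last first.
  apply: le_trans (base C J _ fJ) _; first by rewrite En.
  rewrite -mulrA ler_peMr // -[leLHS]mulr1 ler_pM ?ler01 ?exprn_ege1 //.
have [v vC Lv] := step C J ltac:(by rewrite En n1C Cn2) fJ J0.
have cC : #|C :\ v| = n by move: (cardsD1 v C); rewrite vC En add1n => -[].
have H2 := IHn _ _ cC (ltnW Cn2) (family_on_deletion v fJ).
have H1 := IHn _ _ cC (ltnW Cn2) (family_on_link v fJ gh).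
(* The potential [partfun lam J ^+ a] does not grow under deletion and loses a factor [(1 - d) ^+ a]
   in the link. The two branches add up to one factor [1 + x * (1 - d) ^+ a] per vertex of [C]. *)
rewrite (partfun_split x v J) exprS.
have G1 : partfun x (deletion v J) <= B * partfun lam J ^+ a * (1 + x * (1 - d) ^+ a) ^+ n.
  apply: le_trans H2 _; apply: ler_wpM2r; first exact: exprn_ge0.
  apply: ler_wpM2l => //; apply: lerXn2r; rewrite ?nnegrE ?partfun_ge0 //.
  by rewrite (partfun_split lam v J) lerDl mulr_ge0 // partfun_ge0.
have G2 : partfun x (link v J) <= B * ((1 - d) ^+ a * partfun lam J ^+ a) * (1 + x * (1 - d) ^+ a) ^+ n.
  apply: le_trans H1 _; apply: ler_wpM2r; first exact: exprn_ge0.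
  apply: ler_wpM2l => //; rewrite -exprMn; apply: lerXn2r; rewrite ?nnegrE ?partfun_ge0 //.
  by rewrite mulr_ge0.
apply: le_trans (lerD G1 (ler_wpM2l x0 G2)) _.
by rewrite le_eqVlt; apply/orP; left; apply/eqP; ring.
Qed.

Definition weight_sup lam J D := \sum_(A in J | D \subset A) lam ^+ #|A|.

(** Removing [v] in [D] from a set containing [D] stays in [J] and divides the weight by [lam]; so,
    given the rest of [D], [v] is present with probability at most [lam / (1 + lam)]. In this sense
    the hard-core measure lies below a random set of that density. *)
Lemma weight_sup_le lam J D : 0 <= lam -> down_closed J ->
  weight_sup lam J D <= (lam / (1 + lam)) ^+ #|D| * partfun lam J.
Proof.
move=> lam0 dJ; have l1 : 0 < 1 + lam by lra.
move En : #|D| => n; elim: n D En => [|n IHn] D En.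
  move/eqP: En; rewrite cards_eq0 => /eqP ->; rewrite expr0 mul1r /weight_sup.
  by rewrite (eq_bigl (mem J)) // => A; rewrite sub0set andbT.
have /card_gt0P[v vD] : (0 < #|D|)%N by rewrite En.
have cD : #|D :\ v| = n by move: (cardsD1 v D); rewrite vD En add1n => -[].
have := IHn _ cD; set W := weight_sup _ _ _ => HW.
suff H : weight_sup lam J D <= lam / (1 + lam) * W.
  apply: le_trans H _; rewrite exprS -[leRHS]mulrA; apply: ler_wpM2l HW.
  by rewrite divr_ge0 // ltW.
have -> : W = weight_sup lam J D + \sum_(A in J | (D :\ v \subset A) && (v \notin A)) lam ^+ #|A|.
  rewrite /W /weight_sup (bigID (fun A => v \in A)) /=; congr (_ + _).
    apply: eq_bigl => A; rewrite -andbA; congr (_ && _).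
    by rewrite -[in RHS](setD1K vD) subUset sub1set andbC.
  by apply: eq_bigl => A; rewrite -andbA.
set b := \sum_(A in J | _) _.
have ab : weight_sup lam J D <= lam * b.
  rewrite /weight_sup (reindex_onto (fun A => v |: A) (fun A => A :\ v)) /=; last first.
    by move=> A /andP[_ DA]; rewrite setD1K // (subsetP DA).
  rewrite /b mulr_sumr.
  rewrite [leRHS](bigID (fun A => v |: A \in J)) /=.
  apply: ler_wpDr; first by apply: sumr_ge0 => A _; rewrite mulr_ge0 ?exprn_ge0.
  have E A : ((v |: A \in J) && (D \subset v |: A)) && ((v |: A) :\ v == A)
    = ((A \in J) && ((D :\ v \subset A) && (v \notin A))) && (v |: A \in J).
    have -> : ((v |: A) :\ v == A) = (v \notin A).
      apply/eqP/idP => [<-|vA]; first by rewrite !inE eqxx.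
      by rewrite setU1K.
    rewrite subDset.
    case vAJ : (v |: A \in J); rewrite ?andbF //= !andbT.
    by rewrite (dJ _ _ (subsetUr [set v] A) vAJ).
  rewrite (eq_bigl _ _ E); apply: ler_sum => A /andP[/andP[_ /andP[_ vA]] _].
  by rewrite cardsU1 vA exprS.
rewrite mulrDr -lerBlDl.
have -> : weight_sup lam J D - lam / (1 + lam) * weight_sup lam J D = weight_sup lam J D / (1 + lam).
  by field; rewrite gt_eqF.
by rewrite mulrAC ler_pM2r // invr_gt0.
Qed.

(** The sets that can receive [v] pair up with their extensions by [v], whence the factor [1 + lam];
    what remains are the sets that block [v]. *)
Lemma partfun_blocked lam v J : down_closed J ->
  partfun lam J = (1 + lam) * partfun lam (link v J)
    + \sum_(A in J | (v \notin A) && (v |: A \notin J)) lam ^+ #|A|.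
Proof.
move=> dJ; rewrite (partfun_split lam v) mulrDl mul1r -addrAC; congr (_ + _).
rewrite /partfun (bigID (fun A => v |: A \in J)) /=; congr (_ + _).
  apply: eq_bigl => A; rewrite !inE -andbA.
  by apply/and3P/andP => [[_ -> ->]//|[vA vAJ]]; split=> //; apply: dJ vAJ; apply: subsetUr.
by apply: eq_bigl => A; rewrite !inE andbA.
Qed.

End HardCore.

(** * Weighted second moment and blocked vertices *)

Section Blocking.
Variables (V I : finType) (R : realFieldType).
Variables (J : {set {set V}}) (lam : R) (P : pred I) (D : I -> {set V}) (k : nat).
Hypothesis lam0 : 0 <= lam.
Hypothesis dJ : down_closed J.
Hypothesis cardD : forall i, P i -> #|D i| = k.
Implicit Types (A U : {set V}) (v : V) (i j : I).
Let p := lam / (1 + lam).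
Let Z := partfun lam J.

(** The square is expanded over pairs [i], [j], and [weight_sup_le] bounds the weight of containing
    both by a power of [p] that depends on [D i :&: D j]. Relaxing [U = D i :&: D j] to
    [U \subset D j] and summing over all subsets [U] of [D i] costs the factor [2 ^+ k]. *)
Lemma second_moment (w : I -> R) (G : R) :
  (forall i, 0 <= w i) ->
  (forall U, (#|U| <= k)%N -> p ^+ (k - #|U|) * (\sum_(i | P i && (U \subset D i)) w i) <= G) ->
  \sum_(A in J) lam ^+ #|A| * (\sum_(i | P i && (D i \subset A)) w i) ^+ 2 <=
  Z * (p ^+ k * (2 ^+ k * G)) * \sum_(i | P i) w i.
Proof.
move=> w0 HG.
have p0 : 0 <= p by rewrite divr_ge0 // addr_ge0.
have Z0 : 0 <= Z by apply: partfun_ge0.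
have -> : \sum_(A in J) lam ^+ #|A| * (\sum_(i | P i && (D i \subset A)) w i) ^+ 2
  = \sum_(i | P i) \sum_(j | P j) w i * w j * weight_sup lam J (D i :|: D j).
  under eq_bigr => A _.
    rewrite expr2 big_distrlr /= mulr_sumr big_mkcondr /=.
    over.
  rewrite exchange_big /=; apply: eq_bigr => i Pi.
  under eq_bigr => A _.
    have -> : (if D i \subset A then lam ^+ #|A| * \sum_(j | P j && (D j \subset A)) w i * w j else 0)
      = \sum_(j | P j) (if (D i :|: D j \subset A) then w i * w j * lam ^+ #|A| else 0).
      rewrite mulr_sumr big_mkcondr /=; case: ifP => DiA; last first.
        by rewrite big1 // => j _; rewrite subUset DiA.
      apply: eq_bigr => j _; rewrite subUset DiA /=; case: ifP => // _.
      by rewrite mulrC.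
    over.
  rewrite exchange_big /=; apply: eq_bigr => j Pj.
  by rewrite /weight_sup mulr_sumr -big_mkcondr.
rewrite mulr_sumr; apply: ler_sum => i Pi.
apply: le_trans (_ : w i * (Z * \sum_(j | P j) w j * p ^+ #|D i :|: D j|) <= _).
  rewrite mulr_sumr mulr_sumr; apply: ler_sum => j Pj.
  rewrite -mulrA; apply: ler_wpM2l => //.
  rewrite mulrCA; apply: ler_wpM2l => //.
  by rewrite mulrC; apply: weight_sup_le.
rewrite mulrC; apply: ler_wpM2r => //; apply: ler_wpM2l => //.
apply: le_trans (_ : \sum_(U in powerset (D i)) p ^+ (2 * k - #|U|) *
   (\sum_(j | P j && (U \subset D j)) w j) <= _).
  under [leRHS]eq_bigr => U _ do rewrite mulr_sumr big_mkcondr /=.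
  rewrite exchange_big /=; apply: ler_sum => j Pj.
  rewrite (bigD1 (D i :&: D j)) ?inE ?subsetIl //= subsetIr.
  have -> : #|D i :|: D j| = (2 * k - #|D i :&: D j|)%N.
    by rewrite cardsU !cardD // mul2n addnn.
  rewrite mulrC; apply: ler_wpDr => //; apply: sumr_ge0 => U _.
  by case: ifP => // _; rewrite mulr_ge0 // exprn_ge0.
apply: le_trans (_ : \sum_(U in powerset (D i)) p ^+ k * G <= _).
  apply: ler_sum => U; rewrite inE => /subset_leq_card; rewrite cardD // => Uk.
  have -> : (2 * k - #|U| = k + (k - #|U|))%N by lia.
  rewrite exprD -mulrA; apply: ler_wpM2l; [exact: exprn_ge0 | exact: HG].
by rewrite sumr_const card_powerset cardD // -[leLHS]mulr_natl natrX mulrCA.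
Qed.

Variables (C : {set V}) (w : V -> I -> R) (G e : R).
Hypothesis J0 : set0 \in J.
Hypothesis w0 : forall v i, 0 <= w v i.
Hypothesis w1 : forall i, P i -> \sum_v w v i <= 1.
Hypothesis G0 : 0 < G.
Hypothesis wB : forall v i, P i -> w v i != 0 -> v \in C /\
  (forall A, A \in J -> D i \subset A -> (v \notin A) && (v |: A \notin J)).
Hypothesis HG : forall v U, (#|U| <= k)%N ->
  p ^+ (k - #|U|) * (\sum_(i | P i && (U \subset D i)) w v i) <= G.
Let T := \sum_v \sum_(i | P i) w v i.
Hypothesis He : \sum_(i | P i) (p ^+ k * Z - weight_sup lam J (D i)) <= e * Z.
Hypothesis eT : 2 * e <= p ^+ k * T.

(** By [wB], the weight that [v] receives from the tuples inside [A] vanishes unless [A] blocks [v].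
    Its first moment is bounded below through [He] and its second moment above, so it cannot sit on
    few blocked pairs. *)
Lemma blocking : p ^+ k * T * Z <= 2 ^+ k.+2 * G *
  \sum_(v in C) \sum_(A in J | (v \notin A) && (v |: A \notin J)) lam ^+ #|A|.
Proof.
have p0 : 0 <= p by rewrite divr_ge0 // addr_ge0.
have Z0 : 0 <= Z by apply: partfun_ge0.
set B := \sum_(v in C) _.
pose X v A := \sum_(i | P i && (D i \subset A)) w v i.
pose S1 := \sum_v \sum_(A in J) lam ^+ #|A| * X v A.
pose S2 := \sum_v \sum_(A in J) lam ^+ #|A| * X v A ^+ 2.
have S2le : S2 <= Z * (p ^+ k * (2 ^+ k * G)) * T.
  rewrite /T mulr_sumr; apply: ler_sum => v _; apply: second_moment => //.
  exact: HG.
have S1E : S1 = \sum_(i | P i) (\sum_v w v i) * weight_sup lam J (D i).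
  rewrite /S1.
  under eq_bigr => v _.
    under eq_bigr => A _ do rewrite /X mulr_sumr big_mkcondr /=.
    rewrite exchange_big /=; over.
  rewrite exchange_big /=; apply: eq_bigr => i Pi; rewrite mulr_suml.
  apply: eq_bigr => v _; rewrite /weight_sup mulr_sumr -big_mkcondr /=.
  by apply: eq_bigr => A _; rewrite mulrC.
(* By [w1], weighting the tuples loses no more than their total shortage [e * Z], and [eT] makes
   this at most half of the main term. *)
have S1ge : p ^+ k * T * Z <= 2 * S1.
  have : p ^+ k * T * Z - e * Z <= S1.
    apply: le_trans (lerB (lexx _) He) _.
    rewrite S1E /T exchange_big /= mulrAC mulr_sumr -sumrB.
    apply: ler_sum => i Pi.
    have dif : 0 <= p ^+ k * Z - weight_sup lam J (D i).
      by rewrite subr_ge0 -(cardD Pi); apply: weight_sup_le.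
    have := ler_wpM2r dif (w1 Pi); set s := \sum_v _ => Hs.
    lra.
  have : 2 * e * Z <= p ^+ k * T * Z by apply: ler_wpM2r.
  lra.
pose t := 2 ^+ k.+1 * G.
have t0 : 0 < t by rewrite mulr_gt0 // exprn_gt0.
(* AM-GM on the blocked pairs: [2 X <= X ^ 2 / t + t]; elsewhere [X = 0] *)
have key : 2 * S1 <= t^-1 * S2 + t * B.
  rewrite /S1 /S2 /B !mulr_sumr [X in _ <= _ + X]big_mkcond -big_split /=.
  apply: ler_sum => v _.
  have -> : (if v \in C then t * \sum_(A in J | (v \notin A) && (v |: A \notin J)) lam ^+ #|A| else 0)
    = \sum_(A in J) (if (v \in C) && ((v \notin A) && (v |: A \notin J)) then t * lam ^+ #|A| else 0).
    rewrite mulr_sumr; case: ifP => vC; last by rewrite big1.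
    by rewrite big_mkcondr.
  rewrite !mulr_sumr -big_split /=; apply: ler_sum => A AJ.
  have l0 : 0 <= lam ^+ #|A| by apply: exprn_ge0.
  have [->|X0] := eqVneq (X v A) 0.
    rewrite !(mulr0, expr2) add0r; case: ifP => // _; rewrite mulr_ge0 // ltW //.
  have [i /andP[/andP[Pi DiA] wi]] : exists i, (P i && (D i \subset A)) && (w v i != 0).
    apply/existsP; apply: contraNT X0; rewrite negb_exists => /forallP H.
    rewrite /X big1 // => i Hi; apply/eqP; move: (H i); rewrite Hi /=.
    by rewrite negbK.
  have [vC /(_ A AJ DiA) ->] := wB Pi wi; rewrite vC /=.
  have -> : 2 * (lam ^+ #|A| * X v A) = lam ^+ #|A| * (2 * X v A) by ring.
  have -> : t^-1 * (lam ^+ #|A| * X v A ^+ 2) + t * lam ^+ #|A| =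
     lam ^+ #|A| * (t^-1 * X v A ^+ 2 + t) by ring.
  apply: ler_wpM2l => //.
  rewrite -subr_ge0.
  have -> : t^-1 * X v A ^+ 2 + t - 2 * X v A = t^-1 * (X v A - t) ^+ 2.
    by field; rewrite gt_eqF.
  by rewrite mulr_ge0 ?sqr_ge0 // invr_ge0 ltW.
have : t^-1 * S2 <= p ^+ k * T * Z / 2.
  rewrite mulrC ler_pdivrMr //; apply: le_trans S2le _.
  rewrite /t exprS le_eqVlt; apply/orP; left; apply/eqP; by field; rewrite ?gt_eqF ?exprn_gt0.
have -> : 2 ^+ k.+2 * G * B = 2 * (t * B) by rewrite /t !exprS; ring.
lra.
Qed.

End Blocking.

(** * Families in which every vertex is almost fully occupied *)

Section Occupied.
Variables (V : finType) (R : realFieldType).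
Variables (J : {set {set V}}) (C : {set V}) (lam d : R).
Hypothesis lam0 : 0 < lam.
Hypothesis dJ : down_closed J.
Hypothesis JC : forall A, A \in J -> A \subset C.
Hypothesis J0 : set0 \in J.
Hypothesis occ : forall v, v \in C ->
  (1 - d) * partfun lam J < partfun lam (link v J).
Implicit Types (A U : {set V}) (v : V).
Let p := lam / (1 + lam).
Let Z := partfun lam J.
Let N : R := #|C|%:R.

Lemma occupied_blocked_le :
  \sum_(v in C) \sum_(A in J | (v \notin A) && (v |: A \notin J)) lam ^+ #|A|
   <= d * N * Z.
Proof.
have -> : d * N * Z = \sum_(v in C) d * Z.
  by rewrite sumr_const -[RHS]mulr_natl /N; ring.
apply: ler_sum => v vC; have := partfun_blocked lam v dJ; rewrite -/Z.
have := occ vC; rewrite -/Z.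
set b := \sum_(A in J | _) _; set L := partfun _ _.
have L0 : 0 <= L by apply: partfun_ge0; apply: ltW.
move=> H1 H2; have : 0 <= lam * L by rewrite mulr_ge0 // ltW.
nra.
Qed.

Lemma occupied_mean_ge :
  (1 - d) * p * N * Z <= \sum_(A in J) lam ^+ #|A| * #|A|%:R.
Proof.
have -> : \sum_(A in J) lam ^+ #|A| * #|A|%:R
   = \sum_(v in C) lam * partfun lam (link v J).
  under [RHS]eq_bigr => v _ do rewrite -sum_link.
  under [RHS]eq_bigr => v _ do rewrite big_mkcondr /=.
  rewrite exchange_big /=; apply: eq_bigr => A AJ.
  rewrite -big_mkcondr /=.
  rewrite (eq_bigl (mem A)) => [|v]; last first.
    by apply/andP/idP => [[]//|vA]; split=> //; apply: (subsetP (JC AJ)).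
  by rewrite sumr_const mulr_natr.
have -> : (1 - d) * p * N * Z = \sum_(v in C) p * ((1 - d) * Z).
  by rewrite sumr_const -[RHS]mulr_natl /N; ring.
apply: ler_sum => v vC; have := occ vC; rewrite -/Z.
set L := partfun _ _ => H.
have L0 : 0 <= L by apply: partfun_ge0; apply: ltW.
have pl : p <= lam by rewrite ler_pdivrMr ?addr_gt0 //; move: lam0; nra.
have p0 : 0 <= p by rewrite divr_ge0 ?addr_ge0 // ltW.
apply: le_trans (ler_wpM2r L0 pl); apply: ler_wpM2l => //; exact: ltW.
Qed.

Section Tuples.
Variables (I : finType) (P : pred I) (D : I -> {set V}) (k : nat).
Hypothesis cardD : forall i, P i -> #|D i| = k.
Hypothesis countD : forall A, A \subset C ->
  #|[set i | P i && (D i \subset A)]| = (#|A| ^_ k)%N.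
Hypothesis PC : forall i, P i -> D i \subset C.
Let m := (1 - 2 * d) * (p * N).
Hypothesis m0 : 0 <= m.
Hypothesis tangent : forall r : nat,
  k%:R * m ^+ k.-1 * (r%:R - (k.-1)%:R) - (k.-1)%:R * m ^+ k <= (r ^_ k)%:R :> R.
Hypothesis k0 : (0 < k)%N.
Hypothesis dN : (k.-1)%:R <= d * (p * N).

(* Jensen's inequality for falling factorials, through the tangent at [m]. *)
Lemma occupied_moment_ge : m ^+ k * Z <= \sum_(i | P i) weight_sup lam J (D i).
Proof.
have -> : \sum_(i | P i) weight_sup lam J (D i)
   = \sum_(A in J) lam ^+ #|A| * (#|A| ^_ k)%:R.
  under eq_bigr => i _ do rewrite /weight_sup big_mkcondr /=.
  rewrite exchange_big /=; apply: eq_bigr => A AJ.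
  rewrite -big_mkcondr /= sumr_const -(countD (JC AJ)) mulr_natr.
  by congr (_ *+ _); apply: eq_card => i; rewrite !inE.
apply: le_trans (_ : \sum_(A in J) lam ^+ #|A| *
   (k%:R * m ^+ k.-1 * (#|A|%:R - (k.-1)%:R) - (k.-1)%:R * m ^+ k) <= _); last first.
  by apply: ler_sum => A _; apply: ler_wpM2l => //; apply/exprn_ge0/ltW.
have -> : \sum_(A in J) lam ^+ #|A| *
   (k%:R * m ^+ k.-1 * (#|A|%:R - (k.-1)%:R) - (k.-1)%:R * m ^+ k) =
   k%:R * m ^+ k.-1 * (\sum_(A in J) lam ^+ #|A| * #|A|%:R) -
   (k%:R * m ^+ k.-1 * (k.-1)%:R + (k.-1)%:R * m ^+ k) * Z.
  rewrite mulr_sumr /Z /partfun mulr_sumr -sumrB; apply: eq_bigr => A _; ring.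
have H := occupied_mean_ge.
have Z0 : 0 <= Z by apply: partfun_ge0; apply: ltW.
have K0 : 0 <= k%:R * m ^+ k.-1 by rewrite mulr_ge0 // exprn_ge0.
have := ler_wpM2l K0 H; set S := \sum_(A in J) _ => H1.
(* The tangent is evaluated at [#|A| - (k - 1)]. This shift is paid by [dN], so [m] carries
   [1 - 2 * d] although the mean size only loses [1 - d]. *)
have H2 : m * Z <= ((1 - d) * p * N - (k.-1)%:R) * Z.
  apply: ler_wpM2r => //; rewrite lerBrDr.
    have -> : (1 - d) * p * N = m + d * (p * N) by rewrite /m; ring.
    by rewrite lerD2l.
have := ler_wpM2l K0 H2.
have -> : k%:R * m ^+ k.-1 * (m * Z) = (1 + k.-1%:R) * m ^+ k * Z.
  rewrite -(prednK k0) /= exprS mulrS; ring.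
lra.
Qed.

Variables (w : V -> I -> R) (c tau : R).
Hypothesis w0 : forall v i, 0 <= w v i.
Hypothesis w1 : forall i, P i -> \sum_v w v i <= 1.
Hypothesis c0 : 0 < c.
Hypothesis N0 : 0 < N.
Hypothesis wB : forall v i, P i -> w v i != 0 -> v \in C /\
  (forall A, A \in J -> D i \subset A -> (v \notin A) && (v |: A \notin J)).
Hypothesis HG : forall v U, (#|U| <= k)%N ->
  \sum_(i | P i && (U \subset D i)) w v i <= c * p ^+ #|U| * N ^+ k.-1.
Hypothesis Htau : tau * N ^+ k <= \sum_v \sum_(i | P i) w v i.
Hypothesis tau_ge : 2 * (1 - (1 - 2 * d) ^+ k) <= tau.

(** Almost full occupation leaves a blocked mass of at most [d * N * Z], while [blocking] produces a
    multiple of [N * Z] fixed by [tau] and [c]. For absolute constants [tau] and [c], a small [d]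
    violates the inequality. *)
Lemma occupied_blocking : tau <= 2 ^+ k.+2 * c * d.
Proof.
have p0 : 0 < p by rewrite divr_gt0 ?addr_gt0.
have Z0 : 0 < Z by apply: lt_le_trans ltr01 (partfun_ge1 (ltW lam0) J0).
pose G := c * p ^+ k * N ^+ k.-1.
have G0 : 0 < G by rewrite !mulr_gt0 ?exprn_gt0.
(* The shortage against a [p]-random set: at most [N ^+ k] tuples lie in [C], and at least [m ^+ k]
   are expected in [A]. *)
pose e := (p * N) ^+ k - m ^+ k.
have He : \sum_(i | P i) (p ^+ k * Z - weight_sup lam J (D i)) <= e * Z.
  rewrite sumrB; have M := occupied_moment_ge.
  rewrite /e mulrBl; apply: lerB => //.
  rewrite sumr_const -[leLHS]mulr_natl [(p * N) ^+ k]exprMn.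
  have -> : p ^+ k * N ^+ k * Z = N ^+ k * (p ^+ k * Z) by ring.
  apply: ler_wpM2r; first by rewrite mulr_ge0 ?exprn_ge0 // ltW.
  have -> : #|P| = (#|C| ^_ k)%N.
    rewrite -(countD (subxx C)); apply: eq_card => i; rewrite !inE.
    by rewrite unfold_in; case Pi : (P i) => //=; rewrite PC.
  rewrite /N -natrX ler_nat.
  by elim: k => [|n IH] //; rewrite ffactnSr expnSr leq_mul // leq_subr.
have HG' v U : (#|U| <= k)%N ->
  p ^+ (k - #|U|) * (\sum_(i | P i && (U \subset D i)) w v i) <= G.
  move=> Uk; apply: le_trans (ler_wpM2l _ (HG v Uk)) _.
    by rewrite exprn_ge0 // ltW.
  have pk : p ^+ k = p ^+ (k - #|U|) * p ^+ #|U| by rewrite -exprD subnK.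
  rewrite /G pk.
  by rewrite le_eqVlt; apply/orP; left; apply/eqP; ring.
pose T := \sum_v \sum_(i | P i) w v i; have Ht : tau * N ^+ k <= T := Htau.
have Tp : p ^+ k * (tau * N ^+ k) <= p ^+ k * T.
  by apply: ler_wpM2l => //; rewrite exprn_ge0 // ltW.
have pNk : 0 < (p * N) ^+ k by rewrite exprn_gt0 // mulr_gt0.
have eT : 2 * e <= p ^+ k * T.
  apply: le_trans Tp; rewrite /e /m [((1 - 2 * d) * (p * N)) ^+ k]exprMn.
  have -> : p ^+ k * (tau * N ^+ k) = tau * (p * N) ^+ k by rewrite [(p * N) ^+ k]exprMn; ring.
  have -> : 2 * ((p * N) ^+ k - (1 - 2 * d) ^+ k * (p * N) ^+ k) =
     2 * (1 - (1 - 2 * d) ^+ k) * (p * N) ^+ k by ring.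
  by apply: ler_wpM2r => //; apply: ltW.
have B := blocking (ltW lam0) dJ cardD w0 w1 G0 wB HG' He eT.
have B2 := le_trans B (ler_wpM2l _ occupied_blocked_le).
have {B2} : p ^+ k * T * Z <= 2 ^+ k.+2 * G * (d * N * Z).
  by apply: B2; rewrite mulr_ge0 ?exprn_ge0 // ltW.
rewrite (_ : _ * (d * N * Z) = 2 ^+ k.+2 * G * (d * N) * Z); last by ring.
rewrite ler_pM2r // => B3.
have := le_trans Tp B3.
have -> : p ^+ k * (tau * N ^+ k) = tau * (p * N) ^+ k by rewrite [(p * N) ^+ k]exprMn; ring.
have -> : 2 ^+ k.+2 * G * (d * N) = (2 ^+ k.+2 * c * d) * (p * N) ^+ k.
  have Nk : N ^+ k = N ^+ k.-1 * N by rewrite -exprSr prednK.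
  by rewrite /G [(p * N) ^+ k]exprMn Nk; ring.
by rewrite ler_pM2r.
Qed.

End Tuples.
End Occupied.

(** * Points of small occupation in a geometry of rank four *)

(** Dependence of triples and quadruples as in a matroid of rank four, tuples with repeated points
    being dependent. Besides symmetry and exchange, the blocking argument needs only an upper bound
    on lines, a lower bound on planes and the number of points. *)
Record rank4_geometry (V : finType) (q : nat) (col : V -> V -> V -> bool)
    (cop : V -> V -> V -> V -> bool) : Prop := Rank4Geometry {
  col_refl : forall x y, col x x y;
  colC12 : forall x y z, col x y z = col y x z;
  colC23 : forall x y z, col x y z = col x z y;
  copC12 : forall x y z u, cop x y z u = cop y x z u;
  copC23 : forall x y z u, cop x y z u = cop x z y u;
  copC34 : forall x y z u, cop x y z u = cop x y u z;
  col_cop : forall x y z u, col x y z -> cop x y z u;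
  col_exchange : forall x y z u, x != y -> y != z -> col x y z ->
    col x y u = col y z u;
  cop_exchange : forall x y z v u, ~~ col x y z -> ~~ col x y v ->
    cop x y z v -> cop x y z u = cop x y v u;
  card_line : forall x y, x != y -> (#|[set u | col x y u]| <= q)%N;
  card_plane : forall x y z, ~~ col x y z ->
    (q ^ 2 <= #|[set u | cop x y z u]|)%N;
  card_space : #|V| = (q ^ 3)%N
}.

Definition independent (V : finType) (col : V -> V -> V -> bool)
    (cop : V -> V -> V -> V -> bool) (A : {set V}) : bool :=
  [forall x in A, forall y in A, forall z in A,
     uniq [:: x; y; z] ==> ~~ col x y z] &&
  [forall x in A, forall y in A, forall z in A, forall u in A,
     uniq [:: x; y; z; u] ==> ~~ cop x y z u].

Lemma independentP (V : finType) (col : V -> V -> V -> bool)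
    (cop : V -> V -> V -> V -> bool) (A : {set V}) :
  reflect ((forall x y z, x \in A -> y \in A -> z \in A ->
              uniq [:: x; y; z] -> ~~ col x y z) /\
           (forall x y z u, x \in A -> y \in A -> z \in A -> u \in A ->
              uniq [:: x; y; z; u] -> ~~ cop x y z u))
    (independent col cop A).
Proof.
apply: (iffP andP) => [[H3 H4]|[H3 H4]]; split.
- move=> x y z xA yA zA U.
  move/forall_inP: H3 => /(_ x xA) /forall_inP /(_ y yA) /forall_inP /(_ z zA).
  by rewrite U.
- move=> x y z u xA yA zA uA U.
  move/forall_inP: H4 => /(_ x xA) /forall_inP /(_ y yA) /forall_inP /(_ z zA) /forall_inP /(_ u uA).
  by rewrite U.
- apply/forall_inP => x xA; apply/forall_inP => y yA; apply/forall_inP => z zA.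
  by apply/implyP; apply: H3.
- apply/forall_inP => x xA; apply/forall_inP => y yA; apply/forall_inP => z zA.
  by apply/forall_inP => u uA; apply/implyP; apply: H4.
Qed.

Lemma sum_le_of_card (R : realFieldType) (T : finType) (P : pred T)
    (f : T -> R) (m : nat) (c : R) :
  0 <= c -> (forall z, P z -> f z <= c / m%:R) -> (#|[set z | P z]| <= m)%N ->
  \sum_(z | P z) f z <= c.
Proof.
move=> c0 Hf; case: m Hf => [|m] Hf Hm.
  rewrite big1 // => z Pz; have : z \in [set z | P z] by rewrite inE.
  by move: Hm; rewrite leqn0 cards_eq0 => /eqP ->; rewrite inE.
apply: le_trans (_ : \sum_(z | P z) c / m.+1%:R <= _); first exact: ler_sum.
rewrite sumr_const -[leLHS]mulr_natr -mulrA ler_piMr // mulrC ler_pdivrMr // mul1r ler_nat.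
by apply: leq_trans Hm; rewrite subset_leq_card //; apply/subsetP => z; rewrite inE.
Qed.

Section Core.
Variables (V : finType) (q : nat) (col : V -> V -> V -> bool)
    (cop : V -> V -> V -> V -> bool).
Hypothesis geo : rank4_geometry q col cop.
Variable (R : realFieldType) (C : {set V}).
Implicit Types (x y z u v : V) (A U : {set V}).

Definition nline x y := #|[set u in C | col x y u]|.
Definition nplane x y z := #|[set u in C | cop x y z u]|.
Definition noff x y z := #|[set u in C | cop x y z u && ~~ col x y u]|.

Lemma nlineC x y : nline x y = nline y x.
Proof. by apply: eq_card => u; rewrite !inE (colC12 geo). Qed.

Lemma noffC x y z : noff x y z = noff y x z.
Proof. by apply: eq_card => u; rewrite !inE (colC12 geo) (copC12 geo). Qed.

Lemma nplaneE x y z : nplane x y z = (noff x y z + nline x y)%N.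
Proof.
rewrite /nplane -(cardsID [set u | col x y u]) addnC; congr (_ + _)%N.
  by apply: eq_card => u; rewrite !inE andbC -andbA.
apply: eq_card => u; rewrite !inE -andbA; congr (_ && _).
rewrite andbC; case cxy : (col x y u) => //=.
by rewrite (copC34 geo) (col_cop geo).
Qed.

Lemma noncol_neq x y z : ~~ col x y z -> [/\ x != y, y != z & x != z].
Proof.
move=> H; split; apply: contraNneq H => E.
- by rewrite E (col_refl geo).
- by rewrite E (colC12 geo) (colC23 geo) (col_refl geo).
- by rewrite E (colC23 geo) (col_refl geo).
Qed.

Lemma noff_eq x y z v : ~~ col x y z -> ~~ col x y v -> cop x y z v ->
  noff x y z = noff x y v.
Proof.
move=> H1 H2 H3; apply: eq_card => u; rewrite !inE.
by rewrite (cop_exchange geo u H1 H2 H3).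
Qed.

(** All these [z] span with [x y] the plane of [u], hence share the same [noff], which is also the
    number of such points of [C]. *)
Lemma sum_inv_noff x y u : ~~ col x y u ->
  \sum_(z in C | ~~ col x y z && cop x y z u) (noff x y z)%:R^-1 <= 1 :> R.
Proof.
move=> Hu; apply: (@sum_le_of_card _ _ _ _ (noff x y u)) => //.
  by move=> z /and3P[zC Hz Hzu]; rewrite (noff_eq Hz Hu Hzu) div1r.
apply: eq_leq; apply: eq_card => z; rewrite !inE; congr (_ && _).
by rewrite andbC (copC34 geo).
Qed.

(** Each plane through [x y] that meets [C] off this line contributes exactly 1. Such planes are
    disjoint off the line and have at least [q ^ 2 - q] points there, so there are at most
    [q ^ 3 / (q ^ 2 - q)] of them. *)
Lemma planes_through_line x y : x != y -> (1 < q)%N ->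
  \sum_(z in C | ~~ col x y z) (noff x y z)%:R^-1 <= 2 * q%:R :> R.
Proof.
move=> xy q1; set S := \sum_(z in C | _) _.
have S0 : 0 <= S by apply: sumr_ge0 => z _; rewrite invr_ge0.
have HS : (q%:R ^+ 2 - q%:R) * S <= q%:R ^+ 3.
  rewrite mulr_sumr.
  apply: le_trans (_ : \sum_(z in C | ~~ col x y z)
     \sum_(u | ~~ col x y u && cop x y z u) (noff x y z)%:R^-1 <= _).
    apply: ler_sum => z /andP[zC Hz].
    rewrite sumr_const -[leRHS]mulr_natl; apply: ler_wpM2r; first by rewrite invr_ge0.
    rewrite lerBlDr -natrX -natrD ler_nat.
    apply: leq_trans (card_plane geo Hz) _.
    apply: leq_trans (leq_add (leqnn _) (card_line geo xy)).
    rewrite -(cardsID [set u | col x y u]) addnC; apply: leq_add.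
      by apply: subset_leq_card; apply/subsetP => u; rewrite !inE => /andP[H1 H2]; rewrite unfold_in H1.
    by apply: subset_leq_card; apply/subsetP => u; rewrite !inE => /andP[].
  rewrite (exchange_big_dep (fun u => ~~ col x y u)) /=; last by move=> z u _ /andP[].
  apply: le_trans (_ : \sum_(u | ~~ col x y u) 1 <= _).
    apply: ler_sum => u Hu.
    rewrite (eq_bigl (fun z => (z \in C) && (~~ col x y z && cop x y z u))).
      exact: sum_inv_noff.
    by move=> z; rewrite Hu -andbA.
  rewrite sumr_const -natrX ler_nat -(card_space geo).
  exact: max_card.
have qr : 2 <= q%:R :> R by rewrite ler_nat.
have : q%:R ^+ 2 <= 2 * (q%:R ^+ 2 - q%:R) :> R by rewrite expr2; nra.
move=> H; have H2 := ler_wpM2r S0 H.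
have q0 : 0 < q%:R ^+ 2 :> R by rewrite exprn_gt0 //; lra.
rewrite -(ler_pM2l q0); apply: le_trans H2 _.
move: HS; rewrite exprS; lra.
Qed.

End Core.

Lemma ler_sum_predU (R : realFieldType) (T : finType) (P Q S : pred T) (f : T -> R) :
  (forall i, 0 <= f i) -> (forall i, S i -> P i || Q i) ->
  \sum_(i | S i) f i <= \sum_(i | P i) f i + \sum_(i | Q i) f i.
Proof.
move=> f0 H; rewrite big_mkcond [X in _ <= X + _]big_mkcond.
rewrite [X in _ <= _ + X]big_mkcond -big_split /=.
apply: ler_sum => i _; have := H i; have := f0 i.
case: (S i); case: (P i); case: (Q i) => //= f0i h; rewrite ?addr0 ?add0r ?lerDl ?addr_ge0 //.
by have := h isT.
Qed.

Lemma ler_sum_pred (R : realFieldType) (T : finType) (P Q : pred T) (f : T -> R) :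
  (forall i, 0 <= f i) -> (forall i, P i -> Q i) ->
  \sum_(i | P i) f i <= \sum_(i | Q i) f i.
Proof.
move=> f0 H; rewrite big_mkcond [leRHS]big_mkcond.
by apply: ler_sum => i _; have := H i; have := f0 i; case: (P i); case: (Q i) => //= _ /(_ isT).
Qed.

Lemma sum_pair_fst (R : realFieldType) (T S : finType) (a : T) (f : T * S -> R) :
  \sum_(i | i.1 == a) f i = \sum_y f (a, y).
Proof.
transitivity (\sum_(x | x == a) \sum_y f (x, y)); last by rewrite big_pred1_eq.
by rewrite pair_big_dep; apply: eq_big => [[x y]|[x y]] //=; rewrite andbT.
Qed.

Lemma sum_pair_snd (R : realFieldType) (T S : finType) (a : S) (f : T * S -> R) :
  \sum_(i | i.2 == a) f i = \sum_x f (x, a).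
Proof.
transitivity (\sum_x \sum_(y | y == a) f (x, y)); last first.
  by apply: eq_bigr => x _; rewrite big_pred1_eq.
by rewrite pair_big_dep; apply: eq_big => [[x y]|[x y]].
Qed.

Lemma sum_pair (R : realFieldType) (T S : finType) (f : T * S -> R) :
  \sum_i f i = \sum_x \sum_y f (x, y).
Proof. by rewrite pair_bigA; apply: eq_bigr => -[]. Qed.

Lemma card_distinct_pairs (T : finType) (A : {set T}) :
  #|[set i : T * T | [&& i.1 \in A, i.2 \in A & i.1 != i.2]]| = (#|A| ^_ 2)%N.
Proof.
rewrite -sum1_card (eq_bigl (fun i : T * T => (i.1 \in A) && (i.2 \in A :\ i.1))); last first.
  by move=> i; rewrite !inE eq_sym [X in _ && X]andbC.
rewrite -(pair_big_dep (fun x => x \in A) (fun x y => y \in A :\ x) (fun _ _ => 1%N)) /=.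
rewrite (eq_bigr (fun=> #|A|.-1)) => [|x xA]; last by rewrite sum1_card (cardsD1 x A) xA.
by rewrite sum_nat_const ffactnS ffactn1.
Qed.

Lemma card_distinct_triples (T : finType) (A : {set T}) :
  #|[set i : T * T * T | [&& i.1.1 \in A, i.1.2 \in A, i.2 \in A &
       uniq [:: i.1.1; i.1.2; i.2]]]| = (#|A| ^_ 3)%N.
Proof.
rewrite -sum1_card.
rewrite (eq_bigl (fun i : T * T * T => (i.1 \in [set i : T * T | [&& i.1 \in A, i.2 \in A & i.1 != i.2]])
   && (i.2 \in A :\ i.1.1 :\ i.1.2))); last first.
  move=> [[x y] z]; rewrite !inE /= !inE negb_or [z == y]eq_sym [z == x]eq_sym.
  by case: (x \in A); case: (y \in A); case: (z \in A); case: (x == y); case: (x == z); case: (y == z).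
rewrite -(pair_big_dep (fun i : T * T => i \in _) (fun i z => z \in A :\ i.1 :\ i.2) (fun _ _ => 1%N)) /=.
rewrite (eq_bigr (fun=> #|A|.-2)) => [|i]; last first.
  rewrite inE => /and3P[xA yA xy]; rewrite sum1_card.
  by rewrite (cardsD1 i.1 A) xA (cardsD1 i.2 (A :\ i.1)) !inE eq_sym xy yA.
rewrite sum_nat_const card_distinct_pairs.
by rewrite [RHS]ffactnSr subn2.
Qed.

Lemma sum_mem (R : realFieldType) (T : finType) (A : {set T}) :
  \sum_x (x \in A)%:R = #|A|%:R :> R.
Proof.
rewrite -sum1_card natr_sum [RHS]big_mkcond.
by apply: eq_bigr => x _; case: (x \in A).
Qed.

(** * Blocking by collinear triples and coplanar quadruples *)

Section Rare.
Variables (V : finType) (q : nat) (col : V -> V -> V -> bool)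
    (cop : V -> V -> V -> V -> bool).
Hypothesis geo : rank4_geometry q col cop.
Variable (R : realFieldType) (J : {set {set V}}) (C : {set V}) (lam d s : R).
Hypothesis lam0 : 0 < lam.
Hypothesis dJ : down_closed J.
Hypothesis JC : forall A, A \in J -> A \subset C /\ independent col cop A.
Hypothesis J0 : set0 \in J.
Hypothesis occ : forall v, v \in C ->
  (1 - d) * partfun lam J < partfun lam (link v J).
Variables p N : R.
Hypothesis pE : p = lam / (1 + lam).
Hypothesis NE : N = #|C|%:R.
Hypothesis d0 : 0 < d.
Hypothesis d1 : d * (500 * 500) <= 1.
Hypothesis s3 : s ^+ 3 = q%:R.
Hypothesis ds : 2 <= d * s.
Hypothesis NK : 1000 * 1000 * q%:R <= N.
Hypothesis sp : s <= p * N.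
Implicit Types (x y z u v : V) (A U : {set V}).

Lemma s_large : 500 * 1000 <= s.
Proof. by move: ds d0 d1; nra. Qed.

Let s0 : 0 < s. Proof. by have := s_large; lra. Qed.
Let q0 : 0 < q%:R :> R. Proof. by rewrite -s3 exprn_gt0. Qed.
Let N0 : 0 < N. Proof. by move: NK q0; lra. Qed.

Local Notation nline := (nline col C).
Local Notation noff := (noff col cop C).
Local Notation nplane := (nplane cop C).

(* [N / s ^ 2 = N q^(-2/3)] is the number of points on a line from which blocking
   by collinear triples alone suffices. *)
Definition heavy x y := N / s ^+ 2 <= (nline x y)%:R.

Lemma heavyC x y : heavy x y = heavy y x.
Proof. by rewrite /heavy (nlineC geo). Qed.

(** Each heavy pair spreads a weight of at most 1 evenly over the other points of [C] on its line,
    all of which it blocks. *)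
Definition wline v (i : V * V) : R :=
  if [&& i.1 \in C, i.2 \in C, i.1 != i.2, heavy i.1 i.2, v \in C, v != i.1, v != i.2
      & col i.1 i.2 v] then (nline i.1 i.2)%:R^-1 else 0.

Lemma wline_ge0 v i : 0 <= wline v i.
Proof. by rewrite /wline; case: ifP => // _; rewrite invr_ge0. Qed.

Lemma wlineC v x y : wline v (x, y) = wline v (y, x).
Proof.
rewrite /wline /= heavyC (nlineC geo) (colC12 geo) eq_sym.
by rewrite andbCA; do 3 congr (if _ then _ else _); rewrite [(v != x) && _]andbCA.
Qed.

Lemma wline_row v x : \sum_y wline v (x, y) <= (x \in C)%:R.
Proof.
case xC : (x \in C); last by rewrite big1 // => y _; rewrite /wline /= xC.
rewrite /wline -big_mkcond /=.
apply: (@sum_le_of_card _ _ _ _ (nline x v)) => // [y|].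
  rewrite xC /= => /and5P[yC xy _ vC /and3P[vx vy cxy]].
  rewrite div1r.
  have -> // : nline x y = nline x v.
  apply: eq_card => u; rewrite !inE; congr (_ && _).
  by rewrite (colC12 geo) (@col_exchange _ _ _ _ geo y x v u) // 1?eq_sym // (colC12 geo).
apply: subset_leq_card; apply/subsetP => y; rewrite !inE.
by rewrite xC /= (colC23 geo) => /and5P[-> _ _ _ /and3P[_ _ ->]].
Qed.

Lemma independent_mem3 A x y z : A \in J -> uniq [:: x; y; z] -> col x y z ->
  x \in A -> y \in A -> z \in A -> False.
Proof.
move=> /JC[_ /independentP[H _]] U c xA yA zA.
by have := H _ _ _ xA yA zA U; rewrite c.
Qed.

(** More heavy pairs would feed [occupied_blocking] with [k = 2], [c = 4] and [tau = 1/100], giving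
    [1/100 <= 64 * d] against [d <= 1/250000]. *)
Lemma few_heavy : (\sum_(i : V * V | [&& i.1 \in C, i.2 \in C, i.1 != i.2 & heavy i.1 i.2]) 1) * 50 <= N ^+ 2.
Proof.
rewrite leNgt; apply/negP => Hh; have sl := s_large.
have pN0 : 0 < p * N by apply: lt_le_trans sp.
have := @occupied_blocking V R J C lam d lam0 dJ (fun A AJ => proj1 (JC AJ)) J0 occ
  (V * V)%type (fun i => [&& i.1 \in C, i.2 \in C & i.1 != i.2])
  (fun i => [set i.1; i.2]) 2.
rewrite -pE -NE.
have cD : forall i : V * V, [&& i.1 \in C, i.2 \in C & i.1 != i.2] -> #|[set i.1; i.2]| = 2.
  by move=> i /and3P[_ _ H]; rewrite cards2 H.
move=> /(_ cD).
have cnt : forall A, A \subset C ->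
  #|[set i : V * V | [&& i.1 \in C, i.2 \in C & i.1 != i.2] && ([set i.1; i.2] \subset A)]| = (#|A| ^_ 2)%N.
  move=> A AsC; rewrite -card_distinct_pairs; apply: eq_card => i.
  rewrite !inE subUset !sub1set.
  case A1 : (i.1 \in A); case A2 : (i.2 \in A); rewrite ?andbF //=.
  by rewrite (subsetP AsC _ A1) (subsetP AsC _ A2) !andbT.
move=> /(_ cnt).
have PC : forall i : V * V, [&& i.1 \in C, i.2 \in C & i.1 != i.2] -> [set i.1; i.2] \subset C.
  by move=> i /and3P[H1 H2 _]; rewrite subUset !sub1set H1.
move=> /(_ PC).
have m0 : 0 <= (1 - 2 * d) * (p * N) by rewrite mulr_ge0 ?ltW //; move: d1 d0; lra.
move=> /(_ m0).
have tg : forall r : nat, 2 * ((1 - 2 * d) * (p * N)) ^+ 1 * (r%:R - 1) - 1 * ((1 - 2 * d) * (p * N)) ^+ 2 <= (r ^_ 2)%:R :> R.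
  move: ((1 - 2 * d) * (p * N)) m0 => m m0 r; rewrite ffactnS ffactn1 natrM expr1 expr2.
  case: r => [|r] /=; first by nra.
  rewrite -natr1; have := ler0n R r; have := sqr_ge0 (r%:R - m); rewrite expr2; lra.
move=> /(_ tg isT).
have dN : 1 <= d * (p * N).
  by apply: le_trans (ler_wpM2l (ltW d0) sp); move: ds; lra.
move=> /(_ dN wline 4 (1/100) wline_ge0).
have w1 : forall i : V * V, [&& i.1 \in C, i.2 \in C & i.1 != i.2] -> \sum_v wline v i <= 1.
  move=> [x y] _; rewrite /wline -big_mkcond /=.
  apply: (@sum_le_of_card _ _ _ _ (nline x y)) => //.
    by move=> v _; rewrite div1r.
  apply: subset_leq_card; apply/subsetP => v; rewrite !inE.
  by move=> /and5P[_ _ _ _ /and4P[-> _ _ ->]].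
move=> /(_ w1 ltac:(by []) N0).
have wB : forall v (i : V * V), [&& i.1 \in C, i.2 \in C & i.1 != i.2] -> wline v i != 0 ->
   v \in C /\ (forall A, A \in J -> [set i.1; i.2] \subset A -> (v \notin A) && (v |: A \notin J)).
  move=> v [x y] _; rewrite /wline /=; case: ifP => [|_]; last by rewrite eqxx.
  move=> /and5P[xC yC xy _ /and4P[vC vx vy cxy]] _; split=> // A AJ.
  rewrite subUset !sub1set => /andP[xA yA].
  have vAJ : v |: A \notin J.
    apply/negP => H; apply: (independent_mem3 H _ cxy).
    - by rewrite /= !inE negb_or xy eq_sym vx eq_sym vy.
    - by rewrite inE xA orbT.
    - by rewrite inE yA orbT.
    - by rewrite setU11.
  rewrite vAJ andbT; apply: contra vAJ => vA.
  by have -> : v |: A = A by apply/setUidPr; rewrite sub1set.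
move=> /(_ wB).
have HG : forall v U, (#|U| <= 2)%N ->
  \sum_(i : V * V | [&& i.1 \in C, i.2 \in C & i.1 != i.2] && (U \subset [set i.1; i.2])) wline v i
   <= 4 * p ^+ #|U| * N ^+ 1.
  move=> v U U2; have wg := wline_ge0 v.
  apply: le_trans (_ : \sum_(i | U \subset [set i.1; i.2]) wline v i <= _).
    by apply: ler_sum_pred => // i /andP[].
  rewrite expr1.
  move: U2; rewrite leq_eqVlt ltnS leq_eqVlt ltnS leqn0 => /or3P[].
  (* Heaviness and [s <= p * N] give [1 / nline <= s ^+ 2 / N <= p ^+ 2 * N]; the four ordered pairs
     of elements of [U] are the origin of [c = 4]. *)
  - move=> /eqP U2; rewrite U2.
    apply: le_trans (_ : \sum_(i : V * V | (i.1 \in U) && (i.2 \in U)) s ^+ 2 / N <= _).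
      rewrite big_mkcond [leRHS]big_mkcond; apply: ler_sum => -[x y] _ /=.
      have g0 : 0 <= s ^+ 2 / N by rewrite divr_ge0 ?exprn_ge0 // ltW.
      case: ifP => [Us|_]; last by case: ifP.
      have UE : U == [set x; y].
        by rewrite eqEcard Us U2 cards2; case: (x == y).
      rewrite (eqP UE) !inE !eqxx orbT /=.
      rewrite /wline /=; case: ifP => [|_ //].
      move=> /and5P[_ _ _ hv _].
      rewrite -[s ^+ 2 / N]invrK; rewrite lef_pV2 ?posrE ?invr_gt0 ?divr_gt0 ?exprn_gt0 //.
        by rewrite invf_div.
      by apply: lt_le_trans hv; rewrite divr_gt0 ?exprn_gt0.
    rewrite -(pair_big_dep (mem U) (fun _ => mem U) (fun _ _ => s ^+ 2 / N)) /=.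
    rewrite !sumr_const U2 -mulrnA -[leLHS]mulr_natl.
    have : s ^+ 2 <= (p * N) ^+ 2 by rewrite lerXn2r // nnegrE ltW.
    move=> H; rewrite -[leRHS]mulrA; apply: ler_pM => //; first by rewrite divr_ge0 ?exprn_ge0 // ltW.
    by rewrite ler_pdivrMr // -mulrA -expr2 -exprMn.
  - move=> /cards1P[a ->]; rewrite cards1 expr1.
    apply: le_trans (_ : \sum_(i | i.1 == a) wline v i + \sum_(i | i.2 == a) wline v i <= _).
      apply: ler_sum_predU => // -[x y] /=; rewrite sub1set !inE.
      by rewrite eq_sym [a == y]eq_sym.
    rewrite sum_pair_fst sum_pair_snd.
    under [X in _ + X]eq_bigr => x _ do rewrite wlineC.
    have := wline_row v a; case: (a \in C) => /= H; move: sp sl; rewrite -mulrA; lra.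
  - rewrite cards_eq0 => /eqP ->; rewrite cards0 expr0 mulr1.
    apply: le_trans (_ : \sum_i wline v i <= _).
      by apply: ler_sum_pred.
    rewrite sum_pair; apply: le_trans (_ : \sum_x (x \in C)%:R <= _).
      by apply: ler_sum => x _; apply: wline_row.
    rewrite sum_mem -NE; move: N0; lra.
move=> /(_ HG).
(* A heavy line has at least 4 points of [C], so discarding [x] and [y] keeps half of the weight of
   the pair. *)
have Ht : 1 / 100 * N ^+ 2 <= \sum_v \sum_(i : V * V | [&& i.1 \in C, i.2 \in C & i.1 != i.2]) wline v i.
  rewrite exchange_big /=.
  apply: le_trans (_ : \sum_(i : V * V | [&& i.1 \in C, i.2 \in C, i.1 != i.2 & heavy i.1 i.2]) 1 / 2 <= _).
    rewrite -mulr_suml; move: Hh; lra.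
  rewrite [leRHS](bigID (fun i => heavy i.1 i.2)) /=.
  apply: ler_wpDr; first by apply: sumr_ge0 => i _; apply: sumr_ge0 => v _; apply: wline_ge0.
  rewrite [leRHS](eq_bigl (fun i => [&& i.1 \in C, i.2 \in C, i.1 != i.2 & heavy i.1 i.2])); last first.
    by move=> i; rewrite -!andbA.
  apply: ler_sum => -[x y] /= /and4P[xC yC xy hv].
  rewrite /wline -big_mkcond /= xC yC xy hv /= sumr_const.
  set n1 := #|_|.
  have : (nline x y <= n1 + 2)%N.
    apply: leq_trans (_ : (#|[set v in C | [&& v != x, v != y & col x y v]] :|: [set x; y]| <= _)%N).
      apply: subset_leq_card; apply/subsetP => v; rewrite !inE => /andP[-> ->].
      by case: (v == x); case: (v == y).
    apply: leq_trans (leq_of_leqif (leq_card_setU _ _)) _.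
    rewrite leq_add ?cards2 //; last by case: (x != y).
    by apply: subset_leq_card; apply/subsetP => v; rewrite !inE unfold_in.
  move=> Hn1.
  have nl : 4 <= (nline x y)%:R :> R.
    apply: le_trans hv; rewrite ler_pdivlMr ?exprn_gt0 //.
    apply: le_trans NK; rewrite -s3; move: sl; rewrite !exprS expr0; nra.
  rewrite -[leRHS]mulr_natr ler_pdivlMl; last by lra.
  have : (nline x y)%:R <= n1%:R + 2 :> R by rewrite -natrD ler_nat.
  lra.
move=> /(_ Ht).
have tg2 : 2 * (1 - (1 - 2 * d) ^+ 2) <= 1 / 100 :> R.
  by rewrite expr2; move: d0 d1; nra.
move=> /(_ tg2); rewrite !exprS expr0; move: d0 d1; lra.
Qed.

(** The threshold leaves at least 100 points of the line besides a given one, the gain exploited in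
    [degen_dense]. *)
Definition dense x y := (101 <= nline x y)%N.
(* At least one side of each triangle is a [base]: for such a side [x y], few
   points of the plane lie on the other two sides. *)
Definition base x y z := dense x y || (~~ dense x z && ~~ dense y z).
(** A plane through [x y] typically has about [N / q] points of [C]; the factor 40 limits the third
    points in thinner planes to [N / 20], see [sum_thin]. *)
Definition thick x y z := N / (40 * q%:R) <= (noff x y z)%:R.
Definition usable x y z := [&& x \in C, y \in C, z \in C, ~~ col x y z,
  ~~ heavy x y, base x y z & thick x y z].
(* Dividing by the number of points of the plane off the line [x y] balances all
   the degrees without any regularity assumption on [C]. *)
Definition wplane v (i : V * V * V) : R :=
  if usable i.1.1 i.1.2 i.2 && [&& v \in C, ~~ col i.1.1 i.1.2 v,
     ~~ col i.1.1 i.2 v, ~~ col i.1.2 i.2 v & cop i.1.1 i.1.2 i.2 v]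
  then (noff i.1.1 i.1.2 i.2)%:R^-1 else 0.

Lemma wplane_ge0 v i : 0 <= wplane v i.
Proof. by rewrite /wplane; case: ifP => // _; rewrite invr_ge0. Qed.

Lemma denseC x y : dense x y = dense y x.
Proof. by rewrite /dense (nlineC geo). Qed.

Lemma usableC x y z : usable x y z = usable y x z.
Proof.
rewrite /usable /base /thick heavyC denseC (noffC geo) (colC12 geo).
rewrite [~~ dense x z && _]andbC.
by case: (x \in C); case: (y \in C).
Qed.

Lemma wplaneC v x y z : wplane v (x, y, z) = wplane v (y, x, z).
Proof.
rewrite /wplane /= usableC (noffC geo) (colC12 geo) (copC12 geo).
by congr (if _ && (_ && (_ && _)) then _ else _); rewrite andbCA.
Qed.

Lemma thick_gt0 x y z : thick x y z -> 0 < (noff x y z)%:R :> R.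
Proof. by apply: lt_le_trans; rewrite divr_gt0 // mulr_gt0. Qed.

(** Since [x y] is not heavy, its line has fewer than [N / s ^+ 2 = s * (N / q)] points of [C], at
    most [40 * s] times [noff] by thickness. So the whole plane exceeds its part off the line by a
    factor at most [41 * s]. *)
Lemma usable_noff_inv x y z : usable x y z ->
  (noff x y z)%:R^-1 <= 41 * s / (nplane x y z)%:R.
Proof.
move=> /and4P[xC yC zC /and4P[Hc Hh _ Ht]].
have n0 := thick_gt0 Ht.
have pl0 : 0 < (nplane x y z)%:R :> R.
  by rewrite (nplaneE geo) natrD ltr_wpDr.
rewrite ler_pdivlMr // mulrC ler_pdivrMr //.
rewrite (nplaneE geo) natrD.
move: Hh; rewrite /heavy -ltNge => Hh.
have : N / s ^+ 2 <= 40 * s * (noff x y z)%:R.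
  move: Ht; rewrite /thick ler_pdivrMr ?mulr_gt0 // => Ht.
  rewrite ler_pdivrMr ?exprn_gt0 //; apply: le_trans Ht _.
  rewrite -s3 le_eqVlt; apply/orP; left; apply/eqP; ring.
have : (noff x y z)%:R <= s * (noff x y z)%:R.
  by rewrite ler_peMl ?ltW //; have := s_large; lra.
lra.
Qed.

Lemma usable_noff_inv2 x y z : usable x y z ->
  (noff x y z)%:R^-1 <= 40 * (s ^+ 3 / N).
Proof.
move=> /and4P[xC yC zC /and4P[Hc Hh _ Ht]].
rewrite -[leRHS]invrK lef_pV2 ?posrE ?thick_gt0 //; last first.
  by rewrite invr_gt0 mulr_gt0 // divr_gt0 ?exprn_gt0.
by rewrite invfM invf_div mulrC s3 -mulrA -invfM [q%:R * _]mulrC.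
Qed.

Lemma wplane_sum3 v x y : \sum_z wplane v (x, y, z) <= ((x \in C) && (y \in C))%:R.
Proof.
case xC : (x \in C); last by rewrite big1 // => z _; rewrite /wplane /usable /= xC.
case yC : (y \in C); last by rewrite big1 // => z _; rewrite /wplane /usable /= yC andbF.
rewrite /= /wplane /=.
have [Hv|Hv] := boolP (col x y v).
  by rewrite big1 // => z _; rewrite !andbF.
apply: le_trans (sum_inv_noff geo R C Hv); rewrite -big_mkcond /=.
apply: ler_sum_pred => [z|z]; first by rewrite invr_ge0.
by case/andP => /and4P[_ _ -> /andP[-> _]] /and4P[_ _ _ ->].
Qed.

(** Fixing [x], [z] and [v] fixes the plane but not the line [x y], so [y] has up to [nplane]
    positions. The loss of [s] is affordable: pairs may have degree of order
    [(p * N) ^+ 2 >= s ^+ 2]. *)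
Lemma wplane_sum2 v x z : \sum_y wplane v (x, y, z) <= 41 * s * (x \in C)%:R.
Proof.
case xC : (x \in C); last first.
  by rewrite mulr0 big1 // => y _; rewrite /wplane /usable /= xC.
rewrite mulr1 /wplane -big_mkcond /=.
have c0 : 0 <= 41 * s by rewrite mulr_ge0 // ltW.
apply: (@sum_le_of_card _ _ _ _ (nplane x z v)) => // [y|].
  case/andP => Q /and5P[vC xyv xzv yzv cp].
  have -> : nplane x z v = nplane x y z.
    have /and4P[_ _ _ /andP[xyz _]] := Q.
    apply: eq_card => u; rewrite !inE; congr (_ && _).
    rewrite [RHS](copC23 geo).
    by rewrite (cop_exchange geo u (_ : ~~ col x z y) xzv) // 1?(colC23 geo) // (copC23 geo).
  exact: usable_noff_inv.
apply: subset_leq_card; apply/subsetP => y; rewrite !inE.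
case/andP => /and3P[_ -> _] /and5P[_ _ _ _].
by rewrite (copC23 geo) (copC34 geo).
Qed.

Lemma wplane_sum1 v y z : \sum_x wplane v (x, y, z) <= 41 * s * (y \in C)%:R.
Proof.
by under eq_bigr => x _ do rewrite wplaneC; apply: wplane_sum2.
Qed.

Lemma wplane_degree v U : (#|U| <= 3)%N ->
  \sum_(i : V * V * V | U \subset [set i.1.1; i.1.2; i.2]) wplane v i
    <= 1080 * p ^+ #|U| * N ^+ 2.
Proof.
move=> U3; have wg := wplane_ge0 v; have sl := s_large.
have pN0 : 0 < p * N by apply: lt_le_trans sp.
have in_U i a : U \subset [set i.1.1; i.1.2; i.2] -> a \in U ->
    (a == i.1.1) || (a == i.1.2) || (a == i.2).
  by move=> /subsetP /(_ a) H /H; rewrite !inE.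
move: U3; rewrite leq_eqVlt ltnS leq_eqVlt ltnS leq_eqVlt ltnS leqn0.
case/or4P.
(* The critical case: 27 ordered triples of elements of [U], each of weight at most [40 * (s ^+ 3 /
   N) <= 40 * p ^+ 3 * N ^+ 2], give [1080 = 27 * 40]. Smaller [U] leave slack. *)
- move=> /eqP U3; rewrite U3.
  apply: le_trans (_ : \sum_(i : V * V * V | [&& i.1.1 \in U, i.1.2 \in U & i.2 \in U]) 40 * (s ^+ 3 / N) <= _).
    rewrite big_mkcond [leRHS]big_mkcond; apply: ler_sum => -[[x y] z] _ /=.
    have g0 : 0 <= 40 * (s ^+ 3 / N) by rewrite mulr_ge0 // divr_ge0 ?exprn_ge0 // ltW.
    case: ifP => [Us|_]; last by case: ifP.
    have UE : U == [set x; y; z].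
      rewrite eqEcard Us U3; apply: leq_trans (leq_of_leqif (leq_card_setU _ _)) _.
      by rewrite cards2 cards1; case: (x == y).
    rewrite (eqP UE) !inE !eqxx !orbT /=.
    rewrite /wplane /=; case: ifP => [/andP[Q _]|_ //].
    exact: usable_noff_inv2.
  rewrite (eq_bigl (fun i : V * V * V => ((i.1.1 \in U) && (i.1.2 \in U)) && (i.2 \in U))); last first.
    by move=> i; rewrite andbA.
  rewrite -(pair_big_dep (fun j : V * V => (j.1 \in U) && (j.2 \in U)) (fun _ => mem U) (fun _ _ => 40 * (s ^+ 3 / N))) /=.
  rewrite -(pair_big_dep (mem U) (fun _ => mem U) (fun _ _ => \sum_(j in U) 40 * (s ^+ 3 / N))) /=.
  rewrite !sumr_const U3 -!mulrnA -[leLHS]mulr_natl.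
  have : s ^+ 3 <= (p * N) ^+ 3 by rewrite lerXn2r // nnegrE ltW.
  move=> H.
  have H2 : s ^+ 3 / N <= p ^+ 3 * N ^+ 2.
    by rewrite ler_pdivrMr // -mulrA -exprSr -exprMn.
  have -> : (3 * (3 * 3))%N = 27 by [].
  rewrite -[leRHS]mulrA; move: H2; lra.
- move=> /eqP U2; rewrite U2.
  have U2' : (#|U| * #|U|)%N = 4 by rewrite U2.
  apply: le_trans (_ : (\sum_(i : V * V * V | (i.1.1 \in U) && (i.1.2 \in U)) wplane v i +
     \sum_(i : V * V * V | (i.1.1 \in U) && (i.2 \in U)) wplane v i) +
     \sum_(i : V * V * V | (i.1.2 \in U) && (i.2 \in U)) wplane v i <= _).
    rewrite -[leRHS]addrA.
    apply: le_trans (ler_sum_predU (P := fun i : V * V * V => (i.1.1 \in U) && (i.1.2 \in U))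
      (Q := fun i : V * V * V => ((i.1.1 \in U) && (i.2 \in U)) || ((i.1.2 \in U) && (i.2 \in U))) wg _) _.
      move=> [[x y] z] /= Us.
      (* If at most one of the three coordinates lies in [U], then [U] has at most one element. *)
      case xU : (x \in U); case yU : (y \in U); case zU : (z \in U) => //=.
      + suff : (#|U| <= 1)%N by rewrite U2.
        apply: leq_trans (subset_leq_card (_ : U \subset [set x])) _; last by rewrite cards1.
        apply/subsetP => a aU; rewrite inE; move: (in_U (x, y, z) _ Us aU) => /= /orP[/orP[//|/eqP E]|/eqP E].
          by rewrite -E aU in yU.
        by rewrite -E aU in zU.
      + suff : (#|U| <= 1)%N by rewrite U2.
        apply: leq_trans (subset_leq_card (_ : U \subset [set y])) _; last by rewrite !cards1.
        apply/subsetP => a aU; rewrite inE; move: (in_U (x, y, z) _ Us aU) => /= /orP[/orP[/eqP E|//]|/eqP E].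
          by rewrite -E aU in xU.
        by rewrite -E aU in zU.
      + suff : (#|U| <= 1)%N by rewrite U2.
        apply: leq_trans (subset_leq_card (_ : U \subset [set z])) _; last by rewrite !cards1.
        apply/subsetP => a aU; rewrite inE; move: (in_U (x, y, z) _ Us aU) => /= /orP[/orP[/eqP E|/eqP E]|//].
          by rewrite -E aU in xU.
        by rewrite -E aU in yU.
      + suff : (#|U| <= 1)%N by rewrite U2.
        apply: leq_trans (subset_leq_card (_ : U \subset set0)) _; last by rewrite cards0.
        apply/subsetP => a aU; move: (in_U (x, y, z) _ Us aU) => /= /orP[/orP[/eqP E|/eqP E]|/eqP E].
        * by rewrite -E aU in xU.
        * by rewrite -E aU in yU.
        * by rewrite -E aU in zU.
    by rewrite lerD2l; apply: ler_sum_predU.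
  have B1 : \sum_(i : V * V * V | (i.1.1 \in U) && (i.1.2 \in U)) wplane v i <= 4.
    rewrite (eq_bigl (fun i : V * V * V => ((i.1.1 \in U) && (i.1.2 \in U)) && true)); last first.
      by move=> i; rewrite andbT.
    rewrite (eq_bigr (fun i : V * V * V => wplane v (i.1, i.2))); last by move=> -[].
    rewrite -(pair_big_dep (fun j : V * V => (j.1 \in U) && (j.2 \in U)) (fun _ _ => true) (fun j z => wplane v (j, z))) /=.
    apply: le_trans (_ : \sum_(j : V * V | (j.1 \in U) && (j.2 \in U)) 1 <= _).
      apply: ler_sum => -[x y] _; apply: le_trans (wplane_sum3 v x y) _.
      by case: (_ && _).
    rewrite -(pair_big_dep (mem U) (fun _ => mem U) (fun _ _ => 1)) /=.
    by rewrite !sumr_const -mulrnA U2'.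
  have B2 : \sum_(i : V * V * V | (i.1.1 \in U) && (i.2 \in U)) wplane v i <= 164 * s.
    rewrite big_mkcond sum_pair sum_pair /=.
    under eq_bigr => x _ do rewrite exchange_big /=.
    apply: le_trans (_ : \sum_(x in U) \sum_(z in U) 41 * s <= _).
      rewrite [leRHS]big_mkcond; apply: ler_sum => x _.
      case xU : (x \in U); last by rewrite big1 // => z _; rewrite big1.
      rewrite [leRHS]big_mkcond; apply: ler_sum => z _ /=.
      case: (z \in U); last by rewrite big1.
      apply: le_trans (wplane_sum2 v x z) _.
      by case: (x \in C); rewrite ?mulr1 ?mulr0 // mulr_ge0 // ltW.
    rewrite !sumr_const -mulrnA U2' -[leLHS]mulr_natl; move: s0; lra.
  have B3 : \sum_(i : V * V * V | (i.1.2 \in U) && (i.2 \in U)) wplane v i <= 164 * s.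
    rewrite big_mkcond sum_pair sum_pair /= exchange_big /=.
    under eq_bigr => x _ do rewrite exchange_big /=.
    apply: le_trans (_ : \sum_(x in U) \sum_(z in U) 41 * s <= _).
      rewrite [leRHS]big_mkcond; apply: ler_sum => x _.
      case xU : (x \in U); last by rewrite big1 // => z _; rewrite big1.
      rewrite [leRHS]big_mkcond; apply: ler_sum => z _ /=.
      case: (z \in U); last by rewrite big1.
      apply: le_trans (wplane_sum1 v x z) _.
      by case: (x \in C); rewrite ?mulr1 ?mulr0 // mulr_ge0 // ltW.
    rewrite !sumr_const -mulrnA U2' -[leLHS]mulr_natl; move: s0; lra.
  have s2 : s ^+ 2 <= (p * N) ^+ 2 by rewrite lerXn2r // nnegrE ltW.
  rewrite -[leRHS]mulrA -exprMn.
  have s2' : 1000 * s <= s ^+ 2 by rewrite expr2 ler_wpM2r ?ltW //; move: sl; lra.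
  move: B1 B2 B3 sl s2 s2'; lra.
- move=> /cards1P[a ->]; rewrite cards1 expr1.
  have pNN : 1080 * p * N ^+ 2 = 1080 * (p * N) * N by rewrite expr2; ring.
  have sN : s * N <= p * N * N by rewrite ler_wpM2r // ltW.
  have oneN : 1000 * N <= s * N by rewrite ler_wpM2r // ?ltW //; move: sl; lra.
  apply: le_trans (_ : (\sum_(i : V * V * V | i.1.1 == a) wplane v i +
     \sum_(i : V * V * V | i.1.2 == a) wplane v i) +
     \sum_(i : V * V * V | i.2 == a) wplane v i <= _).
    rewrite -[leRHS]addrA.
    apply: le_trans (ler_sum_predU (P := fun i : V * V * V => i.1.1 == a)
      (Q := fun i : V * V * V => (i.1.2 == a) || (i.2 == a)) wg _) _.
      move=> i; rewrite sub1set !inE -orbA.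
      by rewrite eq_sym [a == i.1.2]eq_sym [a == i.2]eq_sym.
    by rewrite lerD2l; apply: ler_sum_predU.
  have cS : \sum_x (x \in C)%:R = N by rewrite sum_mem.
  have B1 : \sum_(i : V * V * V | i.1.1 == a) wplane v i <= N.
    rewrite (eq_bigl (fun i : V * V * V => (i.1.1 == a) && true)); last first.
      by move=> i; rewrite andbT.
    rewrite (eq_bigr (fun i : V * V * V => wplane v (i.1, i.2))); last by move=> -[].
    rewrite -(pair_big_dep (fun j : V * V => (j.1 == a)) (fun _ _ => true) (fun j z => wplane v (j, z))) /=.
    rewrite (sum_pair_fst a (fun j => \sum_z wplane v (j, z))) -cS; apply: ler_sum => y _.
    apply: le_trans (wplane_sum3 v a y) _; by case: (a \in C).
  have B2 : \sum_(i : V * V * V | i.1.2 == a) wplane v i <= N.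
    rewrite (eq_bigl (fun i : V * V * V => (i.1.2 == a) && true)); last first.
      by move=> i; rewrite andbT.
    rewrite (eq_bigr (fun i : V * V * V => wplane v (i.1, i.2))); last by move=> -[].
    rewrite -(pair_big_dep (fun j : V * V => (j.2 == a)) (fun _ _ => true) (fun j z => wplane v (j, z))) /=.
    rewrite (sum_pair_snd a (fun j => \sum_z wplane v (j, z))) -cS; apply: ler_sum => y _.
    apply: le_trans (wplane_sum3 v y a) _; by case: (a \in C); rewrite ?andbT ?andbF.
  have B3 : \sum_(i : V * V * V | i.2 == a) wplane v i <= 41 * s * N.
    rewrite sum_pair_snd sum_pair -cS mulr_sumr; apply: ler_sum => x _.
    exact: wplane_sum2.
  rewrite pNN; move: B1 B2 B3 sN oneN N0; lra.
- rewrite cards_eq0 => /eqP ->; rewrite cards0 expr0 mulr1.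
  apply: le_trans (_ : \sum_i wplane v i <= _); first exact: ler_sum_pred.
  rewrite sum_pair sum_pair.
  apply: le_trans (_ : \sum_x \sum_y (x \in C)%:R * (y \in C)%:R <= _).
    apply: ler_sum => x _; apply: ler_sum => y _.
    apply: le_trans (wplane_sum3 v x y) _.
    by rewrite -natrM mulnb.
  rewrite -big_distrlr /= !sum_mem -NE -expr2.
  have : 0 <= N ^+ 2 by rewrite exprn_ge0 // ltW.
  lra.
Qed.

Lemma col_line_eq x y x1 x2 u : x != y -> x1 != x2 -> col x y x1 -> col x y x2 ->
  col x1 x2 u = col x y u.
Proof.
move=> xy x12 c1 c2.
have [E|x1y] := eqVneq x1 y.
  have E1 w : col x1 x w = col x y w by rewrite E (colC12 geo).
  rewrite -E1 (colC12 geo x1 x).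
  rewrite (@col_exchange _ _ _ _ geo x x1 x2 u) //; first by rewrite E.
  by rewrite (colC12 geo) E1.
have E1 w : col y x1 w = col x y w.
  by rewrite [RHS](@col_exchange _ _ _ _ geo x y x1 w) // eq_sym.
rewrite -E1 (@col_exchange _ _ _ _ geo y x1 x2 u) ?E1 //.
by rewrite eq_sym.
Qed.

(* Moving [y] to another point [y'] of the line [x y] keeps the plane, while [x]
   is the only common point of the lines [y y'] and [z v]: summing over [y']
   gains the number of points of the line. *)
Definition degen x y z y' v : R :=
  if [&& x \in C, y \in C, z \in C, y' \in C & v \in C] &&
     [&& ~~ col x y z, y' != y, col x y y', v != z, col x z v & ~~ col x y v]
  then (noff x y z)%:R^-1 else 0.

Lemma degen_ge0 x y z y' v : 0 <= degen x y z y' v.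
Proof. by rewrite /degen; case: ifP => // _; rewrite invr_ge0. Qed.

(** For admissible [y'] the weight does not depend on [y'], and a dense line offers at least 100
    choices. *)
Lemma degen_dense x y z : x \in C -> y \in C -> z \in C -> ~~ col x y z -> dense x y ->
  100 * (\sum_(v in C | [&& v != z, col x z v & ~~ col x y v]) (noff x y z)%:R^-1)
   <= \sum_y' \sum_v degen x y z y' v.
Proof.
move=> xC yC zC xyz xyd.
set T := \sum_(v in C | _) _.
have T0 : 0 <= T by apply: sumr_ge0 => v _; rewrite invr_ge0.
apply: le_trans (_ : \sum_(y' in C | (y' != y) && col x y y') T <= _).
  rewrite sumr_const -[leRHS]mulr_natl; apply: ler_wpM2r => //.
  rewrite ler_nat.
  have : (nline x y <= #|[set y' in C | (y' != y) && col x y y']| + 1)%N.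
    apply: leq_trans (_ : (#|[set y' in C | (y' != y) && col x y y'] :|: [set y]| <= _)%N).
      apply: subset_leq_card; apply/subsetP => v; rewrite !inE => /andP[-> ->].
      by case: (v == y).
    by apply: leq_trans (leq_of_leqif (leq_card_setU _ _)) _; rewrite cards1.
  have -> : #|[set y' in C | (y' != y) && col x y y']| = #|[pred y' in C | (y' != y) && col x y y']|.
    by apply: eq_card => v; rewrite !inE.
  by move=> H; have := leq_trans xyd H; rewrite addn1 ltnS.
rewrite big_mkcond; apply: ler_sum => y' _.
case: ifP => [/and3P[y'C y'y cy']|_]; last by apply: sumr_ge0 => v _; apply: degen_ge0.
rewrite /T big_mkcond; apply: ler_sum => v _.
case: ifP => [/and4P[vC vz cv nv]|_]; last exact: degen_ge0.
by rewrite /degen xC yC zC y'C vC xyz y'y cy' vz cv nv.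
Qed.

(** With [y], [y'], [z] fixed, the line [x y] is [y y'] and the plane is that of [y y' z]. So [v]
    has at most [noff y y' z] positions, each of weight [1 / noff], and [v] determines [x] as the
    intersection of the lines [y y'] and [z v]. *)
Lemma degen_sum y z y' : \sum_v \sum_x degen x y z y' v <= ((y \in C) && (z \in C))%:R * (y' \in C)%:R.
Proof.
have Z (r : R) : 0 <= r -> (forall v x, degen x y z y' v = 0) ->
    \sum_v \sum_x degen x y z y' v <= r.
  by move=> r0 H; rewrite big1 // => v _; rewrite big1.
case yC : (y \in C); last by apply: Z => [|v x]; rewrite ?mul0r // /degen yC andbF.
case zC : (z \in C); last by apply: Z => [|v x]; rewrite ?mul0r // /degen zC !andbF.
case y'C : (y' \in C); last by apply: Z => [|v x]; rewrite ?mulr0 // /degen y'C !andbF.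
rewrite mulr1 /=; have {}Z := Z 1 ler01.
have [yy|yy] := eqVneq y' y.
  by apply: Z => v x; rewrite /degen yy eqxx /= !andbF.
have main x : ~~ col x y z -> col x y y' ->
    (forall u, col x y u = col y y' u) /\ (forall u, cop x y z u = cop y y' z u).
  move=> xyz cy'.
  have [xy yz xz] := noncol_neq geo xyz.
  have L u : col x y u = col y y' u.
    by apply: (@col_exchange _ _ _ _ geo) => //; rewrite eq_sym.
  split=> // u.
  have H1 : cop x y z u = cop y z x u by rewrite (copC12 geo) (copC23 geo).
  have H2 : cop y y' z u = cop y z y' u by rewrite (copC23 geo).
  rewrite H1 H2; apply: (cop_exchange geo).
  - by rewrite (colC23 geo) (colC12 geo).
  - by rewrite (colC23 geo) -L.
  - by rewrite (copC23 geo) (copC12 geo) (copC34 geo) (col_cop geo).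
have [c|c] := boolP (col y y' z).
  apply: Z => v x; rewrite /degen; case: ifP => // /andP[_ /and4P[xyz _ cy' _]].
  by have [L _] := main _ xyz cy'; rewrite L c in xyz.
have noffE x : ~~ col x y z -> col x y y' -> noff x y z = noff y y' z.
  move=> xyz cy'; have [L P] := main _ xyz cy'.
  by apply: eq_card => u; rewrite !inE L P.
apply: le_trans (_ : \sum_(v | [&& v \in C, ~~ col y y' v & cop y y' z v])
    \sum_x degen x y z y' v <= _).
  rewrite [leRHS]big_mkcond; apply: ler_sum => v _; case: ifP => // H.
  rewrite big1 // => x _; rewrite /degen; case: ifP => //.
  case/andP => /and5P[_ _ _ _ vC] /and5P[xyz _ cy' _ /andP[cv nv]].
  have [L P] := main _ xyz cy'; move: H; rewrite vC -L nv -P /=.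
  by rewrite (copC23 geo) (copC34 geo) (col_cop geo).
apply: (@sum_le_of_card _ _ _ _ (noff y y' z)) => // [v /and3P[vC nv cv]|]; last first.
  apply: subset_leq_card; apply/subsetP => v; rewrite !inE.
  by case/and3P => -> -> ->.
rewrite div1r /degen -big_mkcond /=.
apply: (@sum_le_of_card _ _ _ _ 1%N) => [|x|].
- by rewrite invr_ge0.
- case/andP => _ /and4P[xyz _ cy' _]; by rewrite divr1 (noffE x).
(* Two such points would make the lines [y y'] and [z v] coincide and put [z] on [y y']. *)
apply/card_le1_eqP => x1 x2; rewrite !inE.
case/andP => _ /and5P[n1 _ cy1 vz /andP[cv1 nv1]].
case/andP => _ /and5P[n2 _ cy2 _ /andP[cv2 nv2]].
have [L1 _] := main _ n1 cy1; have [L2 _] := main _ n2 cy2.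
apply/eqP; apply: contraT => x12.
have ny : y != y' by rewrite eq_sym.
have y1 : col y y' x1 by rewrite -L1 (colC23 geo) (col_refl geo).
have y2 : col y y' x2 by rewrite -L2 (colC23 geo) (col_refl geo).
have zv : z != v by rewrite eq_sym.
have z1 : col z v x1 by rewrite (colC23 geo) (colC12 geo).
have z2 : col z v x2 by rewrite (colC23 geo) (colC12 geo).
have := col_line_eq z ny x12 y2 y1.
rewrite (col_line_eq z zv x12 z2 z1) (negbTE c).
by rewrite (colC23 geo) (col_refl geo).
Qed.

Lemma degen_total : \sum_x \sum_y \sum_z \sum_y' \sum_v degen x y z y' v <= N ^+ 3.
Proof.
rewrite exchange_big /=.
under eq_bigr => y _.
  rewrite exchange_big /=.
  under eq_bigr => z _.
    rewrite exchange_big /=.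
    under eq_bigr => y' _ do rewrite exchange_big /=.
    over.
  over.
apply: le_trans (_ : \sum_y \sum_z \sum_y' ((y \in C) && (z \in C))%:R * (y' \in C)%:R <= _).
  by do 3 (apply: ler_sum => ? _); apply: degen_sum.
under eq_bigr => y _.
  under eq_bigr => z _ do rewrite -mulr_sumr sum_mem -NE -mulnb natrM -mulrA.
  rewrite -mulr_sumr -mulr_suml sum_mem -NE.
  over.
by rewrite -mulr_suml sum_mem -NE !exprS expr0 mulr1.
Qed.

Lemma sum_constC (c : R) : \sum_(x in C) c = N * c.
Proof. by rewrite sumr_const -[LHS]mulr_natl NE. Qed.

Lemma sum_noncol : N ^+ 3 - (q%:R + 1) * N ^+ 2 <=
  \sum_(x in C) \sum_(y in C) \sum_(z in C) (~~ col x y z)%:R.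
Proof.
apply: le_trans (_ : \sum_(x in C) \sum_(y in C) ((N - q%:R) - N * (x == y)%:R) <= _); last first.
  apply: ler_sum => x xC; apply: ler_sum => y yC.
  have [->|xy] := eqVneq x y.
    rewrite mulr1; apply: le_trans (_ : 0 <= _); first by move: q0; lra.
    by apply: sumr_ge0.
  rewrite mulr0 subr0 lerBlDr NE -(cardsID [set z | col x y z] C).
  rewrite addnC natrD; apply: lerD.
    rewrite -natr_sum ler_nat -sum1_card [leqLHS]big_mkcond [leqRHS]big_mkcond.
    apply: leq_sum => z _; rewrite !inE.
    by case: (z \in C); case: (col x y z).
  rewrite ler_nat; apply: leq_trans (card_line geo xy).
  by apply: subset_leq_card; apply: subsetIr.
rewrite le_eqVlt; apply/orP; left; apply/eqP.
under [RHS]eq_bigr => x xC.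
  rewrite sumrB sum_constC -mulr_sumr.
  have -> : \sum_(y in C) (x == y)%:R = 1 :> R.
    rewrite (bigD1 x) //= eqxx big1 ?addr0 // => y /andP[_ /negbTE H].
    by rewrite eq_sym H.
  over.
rewrite sum_constC !exprS expr0; ring.
Qed.

(** Either some side of the triangle is dense, hence a base, or no side is dense and all three are
    bases; the three rotations have equal sums. *)
Lemma sum_base : \sum_(x in C) \sum_(y in C) \sum_(z in C) (~~ col x y z)%:R <=
  3 * \sum_(x in C) \sum_(y in C) \sum_(z in C) (~~ col x y z && base x y z)%:R :> R.
Proof.
set S := \sum_(x in C) \sum_(y in C) \sum_(z in C) (~~ col x y z && base x y z)%:R.
pose b x y z : R := (~~ col x y z && base x y z)%:R.
have S1 : S = \sum_(x in C) \sum_(y in C) \sum_(z in C) b y z x.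
  by rewrite exchange_big /=; apply: eq_bigr => y _; rewrite exchange_big.
have S2 : S = \sum_(x in C) \sum_(y in C) \sum_(z in C) b z x y.
  rewrite [RHS](eq_bigr (fun x => \sum_(z in C) \sum_(y in C) b z x y)); last first.
    by move=> x _; rewrite exchange_big.
  by rewrite [RHS]exchange_big.
have -> : 3 * S = S + S + S by ring.
rewrite {2}S1 {2}S2 -!big_split /=; apply: ler_sum => x _.
rewrite -!big_split /=; apply: ler_sum => y _.
rewrite -!big_split /=; apply: ler_sum => z _.
rewrite /b /base (denseC y x) (denseC z x) (denseC z y).
have -> : col y z x = col x y z by rewrite (colC23 geo) (colC12 geo).
have -> : col z x y = col x y z by rewrite (colC12 geo) (colC23 geo).
rewrite -!natrD ler_nat.
by case: (col x y z); case: (dense x y); case: (dense x z); case: (dense y z).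
Qed.

(** Every thin [z] adds more than [40 * q / N] to a sum bounded by [2 * q] in
    [planes_through_line]. *)
Lemma sum_thin x y : x != y ->
  \sum_(z in C) (~~ col x y z && ~~ thick x y z)%:R <= N / 20.
Proof.
move=> xy.
have q1 : (1 < q)%N.
  rewrite -(ltr_nat R) -s3; have : 1 < s by move: s_large; lra.
  by move=> s1; rewrite exprn_egt1.
have H := planes_through_line geo R C xy q1.
have c0 : 0 < N / (40 * q%:R) by rewrite divr_gt0 // mulr_gt0.
have := ler_wpM2l (ltW c0) H.
have -> : N / (40 * q%:R) * (2 * q%:R) = N / 20 by field; rewrite gt_eqF.
apply: le_trans; rewrite mulr_sumr [leRHS]big_mkcondr /=; apply: ler_sum => z zC.
have [xyz|xyz] /= := boolP (col x y z); first by [].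
rewrite /thick -ltNge; case: ltP => [Hlt|_]; last by rewrite mulr_ge0 ?invr_ge0 // ltW.
(* The point [z] itself is counted, so the inverse is not the default value 0. *)
have n0 : 0 < (noff x y z)%:R :> R.
  rewrite ltr0n; apply/card_gt0P; exists z; rewrite inE zC xyz andbT.
  have E : cop x y z z = cop z z x y.
    by rewrite (copC23 geo) (copC12 geo) (copC34 geo) (copC23 geo).
  by rewrite E (col_cop geo) // (col_refl geo).
by rewrite -[leLHS]/(1 : R) ler_pdivlMr // mul1r ltW.
Qed.

(** A third of almost all triples have [x y] as base; heavy pairs remove [1/50] and thin planes
    [1/20] of [N ^+ 3]. *)
Lemma usable_many :
  26 / 100 * N ^+ 3 <= \sum_(x in C) \sum_(y in C) \sum_(z in C) (usable x y z)%:R.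
Proof.
have H1 := sum_noncol; have H2 := sum_base.
have H3 := few_heavy.
apply: le_trans (_ : \sum_(x in C) \sum_(y in C) \sum_(z in C)
  ((~~ col x y z && base x y z)%:R - ((x != y) && heavy x y)%:R - ((x != y) && (~~ col x y z && ~~ thick x y z))%:R) <= _); last first.
  apply: ler_sum => x xC; apply: ler_sum => y yC; apply: ler_sum => z zC.
  rewrite /usable xC yC zC /=.
  have [xyz|xyz] := boolP (col x y z).
    rewrite /= !lerBlDr add0r; exact: addr_ge0.
  have [-> _ _] := noncol_neq geo xyz; rewrite /= !lerBlDr -!natrD ler_nat.
  by case: (heavy x y); case: (base x y z); case: (thick x y z).
have Nn := sum_constC.
have E3 : \sum_(x in C) \sum_(y in C) \sum_(z in C) ((x != y) && heavy x y)%:R <= N * (N ^+ 2 / 50).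
  under eq_bigr => x _ do under eq_bigr => y _ do rewrite Nn.
  under eq_bigr => x _ do rewrite -mulr_sumr.
  rewrite -mulr_sumr ler_pM2l // ler_pdivlMr //; apply: le_trans H3.
  rewrite ler_pM2r //.
  rewrite (pair_big_dep (mem C) (fun _ => mem C) (fun x y => ((x != y) && heavy x y)%:R)) /=.
  rewrite [leLHS]big_mkcond [leRHS]big_mkcond; apply: ler_sum => -[x y] _ /=.
  by case: (x \in C); case: (y \in C); case: (x != y); case: (heavy x y).
have E4 : \sum_(x in C) \sum_(y in C) \sum_(z in C) ((x != y) && (~~ col x y z && ~~ thick x y z))%:R <= N * (N * (N / 20)).
  rewrite -(Nn (N * (N / 20))); apply: ler_sum => x xC.
  rewrite -(Nn (N / 20)); apply: ler_sum => y yC.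
  have [xy|xy] := eqVneq x y; last exact: sum_thin.
  by rewrite big1 // divr_ge0 // ltW.
under eq_bigr => x _ do under eq_bigr => y _ do rewrite !sumrB.
under eq_bigr => x _ do rewrite !sumrB.
rewrite !sumrB.
have H4 : (q%:R + 1) * N ^+ 2 <= N ^+ 3 / 1000.
  rewrite [N ^+ 3]exprS mulrAC; apply: ler_wpM2r; first by rewrite exprn_ge0 // ltW.
  have : 1 <= q%:R :> R by rewrite ler1n -(ltr0n R).
  move: NK; lra.
have E3' : N * (N ^+ 2 / 50) = N ^+ 3 / 50 by rewrite !exprS expr0; field.
have E4' : N * (N * (N / 20)) = N ^+ 3 / 20 by rewrite !exprS expr0; field.
have N3 : 0 <= N ^+ 3 by rewrite exprn_ge0 // ltW.
move: H1 H2 E3 E4; rewrite E3' E4'; lra.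
Qed.

Definition ndegen x y z := #|[set v in C | ~~ col x y v && col x z v]|.

(** If [x y] is dense, [degen_dense] gains the factor 100; otherwise [x z] is not dense and carries
    at most 100 points. With [1 / noff <= t] and [t <= 40 / 10^6] the total is [101 * t + 1/100],
    and this is where [N >= 10^6 * q] is spent. *)
Lemma ndegen_total :
  \sum_(x in C) \sum_(y in C) \sum_(z in C) (usable x y z)%:R * ((ndegen x y z)%:R / (noff x y z)%:R)
   <= 15 / 1000 * N ^+ 3.
Proof.
pose t : R := 40 * (s ^+ 3 / N).
have t0 : 0 <= t by rewrite mulr_ge0 // divr_ge0 ?exprn_ge0 // ltW.
have tK : t <= 40 / (1000 * 1000).
  rewrite /t s3 ler_pM2l // ler_pdivrMr //; move: NK; lra.
have Nn := sum_constC.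
apply: le_trans (_ : \sum_(x in C) \sum_(y in C) \sum_(z in C)
   (101 * t + 1 / 100 * \sum_y' \sum_v degen x y z y' v) <= _).
  apply: ler_sum => x xC; apply: ler_sum => y yC; apply: ler_sum => z zC.
  have D0 : 0 <= \sum_y' \sum_v degen x y z y' v.
    by apply: sumr_ge0 => y' _; apply: sumr_ge0 => v _; apply: degen_ge0.
  have [Q|_] := boolP (usable x y z); last by rewrite mul0r; move: D0 t0; lra.
  rewrite -[true%:R]/(1 : R) [leLHS]mul1r.
  have Hinv : (noff x y z)%:R^-1 <= t := usable_noff_inv2 Q.
  have i0 : 0 <= (noff x y z)%:R^-1 :> R by rewrite invr_ge0.
  have /and4P[_ _ _ /and4P[xyz _ bs _]] := Q.
  have [dxy|dxy] := boolP (dense x y).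
    have HD := degen_dense xC yC zC xyz dxy.
    set T := \sum_(v in C | _) _ in HD.
    (* [degen] excludes [v = z], which costs one more term of size at most [t]. *)
    have : (ndegen x y z)%:R / (noff x y z)%:R <= t + T.
      have : (ndegen x y z <= #|[set v in C | [&& v != z, col x z v & ~~ col x y v]]| + 1)%N.
        apply: leq_trans (_ : (#|[set v in C | [&& v != z, col x z v & ~~ col x y v]] :|: [set z]| <= _)%N).
          apply: subset_leq_card; apply/subsetP => v; rewrite !inE => /and3P[-> -> ->].
          by case: (v == z).
        by apply: leq_trans (leq_of_leqif (leq_card_setU _ _)) _; rewrite cards1.
      rewrite -(ler_nat R) natrD => /(ler_wpM2r i0) H; apply: le_trans H _.
      rewrite mulrDl mul1r addrC; apply: lerD => //.
      rewrite /T sumr_const -[leRHS]mulr_natl; apply: ler_wpM2r => //; rewrite ler_nat.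
      by apply: subset_leq_card; apply/subsetP => v; rewrite !inE unfold_in.
    move: HD t0; lra.
  have : (ndegen x y z)%:R <= 100 :> R.
    move: bs; rewrite /base (negbTE dxy) /= => /andP[dxz _].
    rewrite ler_nat -ltnS; apply: leq_trans (_ : (nline x z < _)%N); last first.
      by rewrite ltnNge; apply: dxz.
    rewrite ltnS; apply: subset_leq_card; apply/subsetP => v; rewrite !inE.
    by case/and3P => -> _ ->.
  move=> /(ler_wpM2r i0); move: Hinv D0 t0; lra.
under eq_bigr => x _ do under eq_bigr => y _ do rewrite big_split /= Nn -mulr_sumr.
under eq_bigr => x _ do rewrite big_split /= Nn -mulr_sumr.
rewrite big_split /= Nn -mulr_sumr.
have : \sum_(x in C) \sum_(y in C) \sum_(z in C) \sum_y' \sum_v degen x y z y' v <= N ^+ 3.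
  apply: le_trans degen_total.
  have dg x y z : 0 <= \sum_y' \sum_v degen x y z y' v.
    by apply: sumr_ge0 => y' _; apply: sumr_ge0 => v _; apply: degen_ge0.
  have dg2 x y : 0 <= \sum_z \sum_y' \sum_v degen x y z y' v by apply: sumr_ge0.
  apply: le_trans (_ : \sum_(x in C) \sum_y \sum_z \sum_y' \sum_v degen x y z y' v <= _).
    apply: ler_sum => x _.
    apply: le_trans (_ : \sum_(y in C) \sum_z \sum_y' \sum_v degen x y z y' v <= _).
      by apply: ler_sum => y _; apply: ler_sum_pred.
    exact: ler_sum_pred.
  apply: ler_sum_pred => // x; exact: sumr_ge0.
have N3 : 0 <= N ^+ 3 by rewrite exprn_ge0 // ltW.
have : N * (N * (N * (101 * t))) = 101 * t * N ^+ 3 by rewrite !exprS expr0; ring.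
have := ler_wpM2r N3 tK.
lra.
Qed.

(** Of the points of [C] in the plane and off [x y], only those on the sides [x z] and [y z] receive
    no weight. *)
Lemma wplane_mass x y z : (usable x y z)%:R * (1 - (ndegen x y z)%:R / (noff x y z)%:R
   - (ndegen y x z)%:R / (noff y x z)%:R) <= \sum_v wplane v (x, y, z).
Proof.
have [Q|Q] := boolP (usable x y z); last first.
  by rewrite mul0r; apply: sumr_ge0 => v _; apply: wplane_ge0.
rewrite mul1r /wplane -big_mkcond /= Q /= (noffC geo C y x) sumr_const -[leRHS]mulr_natl.
have /and4P[_ _ _ /and4P[xyz _ bs Ht]] := Q.
have n0 := thick_gt0 Ht.
rewrite ler_pdivlMr // !mulrBl !divfK ?gt_eqF // mul1r !lerBlDr -!natrD ler_nat.
set A := #|_|.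
apply: leq_trans (_ : (#|[set v in C | [&& ~~ col x y v, ~~ col x z v, ~~ col y z v & cop x y z v]]
   :|: [set v in C | ~~ col y x v && col y z v] :|: [set v in C | ~~ col x y v && col x z v]| <= _)%N).
  apply: subset_leq_card; apply/subsetP => v; rewrite !inE (colC12 geo y x).
  by case/and3P => -> -> ->; case: (col x z v); case: (col y z v).
apply: leq_trans (leq_of_leqif (leq_card_setU _ _)) _; rewrite leq_add2r.
apply: leq_trans (leq_of_leqif (leq_card_setU _ _)) _; rewrite leq_add2r.
by apply: subset_leq_card; apply/subsetP => v; rewrite !inE unfold_in.
Qed.

Lemma wplane_total : 1 / 5 * N ^+ 3 <= \sum_(i : V * V * V) \sum_v wplane v i.
Proof.
apply: le_trans (_ : \sum_(x in C) \sum_(y in C) \sum_(z in C) \sum_v wplane v (x, y, z) <= _); last first.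
  rewrite sum_pair sum_pair.
  have wg x y z : 0 <= \sum_v wplane v (x, y, z).
    by apply: sumr_ge0 => v _; apply: wplane_ge0.
  apply: le_trans (_ : \sum_(x in C) \sum_y \sum_z \sum_v wplane v (x, y, z) <= _).
    apply: ler_sum => x _.
    apply: le_trans (_ : \sum_(y in C) \sum_z \sum_v wplane v (x, y, z) <= _).
      by apply: ler_sum => y _; apply: ler_sum_pred.
    by apply: ler_sum_pred => // y; apply: sumr_ge0.
  by apply: ler_sum_pred => // x; do 2 (apply: sumr_ge0 => ? _).
apply: le_trans (_ : \sum_(x in C) \sum_(y in C) \sum_(z in C) (usable x y z)%:R * (1 - (ndegen x y z)%:R / (noff x y z)%:R
   - (ndegen y x z)%:R / (noff y x z)%:R) <= _); last first.
  by do 3 (apply: ler_sum => ? _); apply: wplane_mass.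
under eq_bigr => x _ do under eq_bigr => y _ do under eq_bigr => z _ do rewrite !mulrBr mulr1.
under eq_bigr => x _ do under eq_bigr => y _ do rewrite !sumrB.
under eq_bigr => x _ do rewrite !sumrB.
rewrite !sumrB.
have H1 := usable_many; have H2 := ndegen_total.
have : \sum_(x in C) \sum_(y in C) \sum_(z in C) (usable x y z)%:R * ((ndegen y x z)%:R / (noff y x z)%:R)
   <= 15 / 1000 * N ^+ 3.
  apply: le_trans H2; rewrite exchange_big /= le_eqVlt; apply/orP; left; apply/eqP.
  by do 3 (apply: eq_bigr => ? _); rewrite usableC.
have N3 : 0 <= N ^+ 3 by rewrite exprn_ge0 // ltW.
move: H1 H2; lra.
Qed.

(** Here [occupied_blocking] with [k = 3], [c = 1080] and [tau = 1/5] gives [1/5 <= 32 * 1080 * d],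
    which [d <= 1 / (500 * 500)] refutes; this fixes the size of [d]. *)
Lemma rare_contradiction : False.
Proof.
have sl := s_large.
have pN0 : 0 < p * N by apply: lt_le_trans sp.
pose P := fun i : V * V * V => [&& i.1.1 \in C, i.1.2 \in C, i.2 \in C & uniq [:: i.1.1; i.1.2; i.2]].
have := @occupied_blocking V R J C lam d lam0 dJ (fun A AJ => proj1 (JC AJ)) J0 occ
  (V * V * V)%type P (fun i => [set i.1.1; i.1.2; i.2]) 3.
rewrite -pE -NE.
have cD : forall i, P i -> #|[set i.1.1; i.1.2; i.2]| = 3.
  move=> [[x y] z] /and4P[_ _ _]; rewrite /= !inE negb_or => /andP[/andP[xy xz] /andP[yz _]].
  by rewrite setUC cardsU1 !inE cards2 xy negb_or eq_sym xz eq_sym yz.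
move=> /(_ cD).
have cnt : forall A, A \subset C ->
  #|[set i | P i && ([set i.1.1; i.1.2; i.2] \subset A)]| = (#|A| ^_ 3)%N.
  move=> A AsC; rewrite -card_distinct_triples; apply: eq_card => i.
  rewrite !inE /P !subUset !sub1set.
  case A1 : (i.1.1 \in A); case A2 : (i.1.2 \in A); case A3 : (i.2 \in A); rewrite ?andbF //=.
  by rewrite (subsetP AsC _ A1) (subsetP AsC _ A2) (subsetP AsC _ A3) !andbT.
move=> /(_ cnt).
have PC : forall i, P i -> [set i.1.1; i.1.2; i.2] \subset C.
  by move=> i /and4P[H1 H2 H3 _]; rewrite !subUset !sub1set H1 H2.
move=> /(_ PC).
have m0 : 0 <= (1 - 2 * d) * (p * N) by rewrite mulr_ge0 ?ltW //; move: d1 d0; lra.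
move=> /(_ m0).
(* With [t = r - 2], the falling factorial is at least [t ^+ 3], and [t ^+ 3 - 3 * m ^+ 2 * t + 2 *
   m ^+ 3 = (t - m) ^+ 2 * (t + 2 * m)]. The last factor is nonnegative even at [r = 0] because
   [m >= 1]. *)
have tg : forall r : nat, 3 * ((1 - 2 * d) * (p * N)) ^+ 2 * (r%:R - 2) - 2 * ((1 - 2 * d) * (p * N)) ^+ 3 <= (r ^_ 3)%:R :> R.
  have m1 : 1 <= (1 - 2 * d) * (p * N).
    have : 1 / 2 * s <= (1 - 2 * d) * (p * N).
      by apply: ler_pM; [lra | exact: ltW | move: d1 d0; lra | exact: sp].
    move: sl; lra.
  move: ((1 - 2 * d) * (p * N)) m0 m1 => m m0 m1 r.
  have -> : (r ^_ 3)%:R = r%:R * (r%:R - 1) * (r%:R - 2) :> R.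
    case: r => [|[|[|r]]]; rewrite ?ffactnS ?ffactn0 /=; try by rewrite ?mul0r ?mulr0 ?subrr ?mulr0 ?mul0r.
    by rewrite !natrM -!natr1; ring.
  have rr : 0 <= (r%:R - 2) * (3 * r%:R - 4) :> R.
    case: r => [|[|r]]; [lra|lra|].
    by rewrite -!natr1; have := ler0n R r; nra.
  have H1 : 0 <= (r%:R - 2 - m) ^+ 2 * (r%:R - 2 + 2 * m).
    rewrite mulr_ge0 ?sqr_ge0 //; have := ler0n R r; move: m1; lra.
  move: rr H1; rewrite !exprS expr0; lra.
move=> /(_ tg isT).
have dN : 2 <= d * (p * N).
  by apply: le_trans (ler_wpM2l (ltW d0) sp); move: ds; lra.
move=> /(_ dN wplane 1080 (1/5) wplane_ge0).
have w1 : forall i, P i -> \sum_v wplane v i <= 1.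
  move=> [[x y] z] _; rewrite /wplane -big_mkcond /=.
  apply: (@sum_le_of_card _ _ _ _ (noff x y z)) => //.
    by move=> v _; rewrite div1r.
  apply: subset_leq_card; apply/subsetP => v; rewrite !inE.
  by case/andP => _ /and5P[-> -> _ _ ->].
move=> /(_ w1 ltac:(by []) N0).
have wB : forall v i, P i -> wplane v i != 0 ->
   v \in C /\ (forall A, A \in J -> [set i.1.1; i.1.2; i.2] \subset A -> (v \notin A) && (v |: A \notin J)).
  move=> v [[x y] z] /and4P[_ _ _ U]; rewrite /wplane /=; case: ifP => [|_]; last by rewrite eqxx.
  case/andP => _ /and5P[vC xv xzv yzv cp] _; split=> // A AJ.
  rewrite !subUset !sub1set -andbA => /and3P[xA yA zA].
  have vAJ : v |: A \notin J.
    apply/negP => /JC[_ /independentP[_ H]].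
    have /H : x \in v |: A by rewrite inE xA orbT.
    move=> /(_ y z v); rewrite !inE eqxx yA zA !orbT cp => /(_ isT isT isT).
    move: U; rewrite /= !inE !negb_or => /andP[/andP[-> ->] /andP[-> _]].
    have [_ -> ->] := noncol_neq geo xv; have [_ -> _] := noncol_neq geo xzv.
    by move/(_ isT).
  rewrite vAJ andbT; apply: contra vAJ => vA.
  by have -> : v |: A = A by apply/setUidPr; rewrite sub1set.
move=> /(_ wB).
have HG : forall v U, (#|U| <= 3)%N ->
  \sum_(i | P i && (U \subset [set i.1.1; i.1.2; i.2])) wplane v i <= 1080 * p ^+ #|U| * N ^+ 2.
  move=> v U U3.
  apply: le_trans (_ : \sum_(i | U \subset [set i.1.1; i.1.2; i.2]) wplane v i <= _).
    by apply: ler_sum_pred => [i|i /andP[]//]; apply: wplane_ge0.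
  exact: wplane_degree.
move=> /(_ HG).
have Ht : 1 / 5 * N ^+ 3 <= \sum_v \sum_(i | P i) wplane v i.
  rewrite exchange_big /= [leRHS]big_mkcond /=; apply: le_trans wplane_total _.
  apply: ler_sum => -[[x y] z] _; case: ifP => // H.
  rewrite big1 // => v _; rewrite /wplane; case: ifP => // /andP[/and5P[xC yC zC xyz _] _].
  move: H; rewrite /P /= xC yC zC !inE negb_or.
  by have [-> -> ->] := noncol_neq geo xyz.
move=> /(_ Ht).
have tg2 : 2 * (1 - (1 - 2 * d) ^+ 3) <= 1 / 5 :> R.
  have : (1 - 2 * d) ^+ 3 >= 1 - 6 * d.
    rewrite !exprS expr0; move: d0 d1; nra.
  move: d0 d1; lra.
move=> /(_ tg2); rewrite !exprS expr0; move: d0 d1; lra.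
Qed.

End Rare.

(** * The affine space of dimension three over a finite field *)

Section AffineSpace.
Variable F : finFieldType.
Implicit Types (x y z u v w : 'rV[F]_3).

(* Homogenization turns affine dependence into linear dependence; [hat] is locked
   so that [mxE] does not open it. *)
Fact hat_key : unit. Proof. exact: tt. Qed.
Definition hat x : 'rV[F]_(1 + 3) := locked_with hat_key (row_mx (1%:M : 'rV[F]_1) x).

Lemma hatE x : hat x = row_mx (1%:M : 'rV[F]_1) x.
Proof. by rewrite /hat unlock. Qed.
Definition collinear x y z := (\dim <<[:: hat x; hat y; hat z]>> <= 2)%N.
Definition coplanar x y z u := (\dim <<[:: hat x; hat y; hat z; hat u]>> <= 3)%N.

Lemma hat_inj : injective hat.
Proof. by apply: (can_inj (g := @rsubmx F 1 1 3)) => x; rewrite hatE; apply: row_mxKr. Qed.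

Lemma hatD x y z a : hat (x + a *: (y - z)) = hat x + a *: (hat y - hat z).
Proof.
rewrite !hatE opp_row_mx add_row_mx subrr scale_row_mx scaler0 add_row_mx.
by rewrite addr0.
Qed.

Lemma hatl x : hat x 0 (lshift 3 (0 : 'I_1)) = 1.
Proof. by rewrite hatE (row_mxEl (1%:M : 'rV[F]_1) x) mxE eqxx. Qed.

Lemma hat_neq0 x : hat x != 0.
Proof.
apply/eqP => /matrixP /(_ 0 (lshift 3 (0 : 'I_1))).
by rewrite hatl mxE => /eqP; rewrite oner_eq0.
Qed.

Lemma span_consE (t : 'rV[F]_(1 + 3)) X : t \in <<X>>%VS -> <<t :: X>>%VS = <<X>>%VS.
Proof. by move=> tX; rewrite span_cons; apply/addv_idPr; rewrite -memvE. Qed.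

Lemma dim_span_pair x y : x != y -> \dim <<[:: hat x; hat y]>> = 2.
Proof.
move=> xy; apply/eqP; rewrite -[_ == _]/(free [:: hat x; hat y]).
rewrite free_cons seq1_free hat_neq0 andbT span_seq1.
apply: contra xy => /vlineP[a E]; apply/eqP/hat_inj.
have := E => /matrixP /(_ 0 (lshift 3 (0 : 'I_1))).
by rewrite hatl mxE hatl mulr1 => a1; rewrite E -a1 scale1r.
Qed.

Lemma collinearC12 x y z : collinear x y z = collinear y x z.
Proof.
by rewrite /collinear; congr (\dim _ <= _)%N; apply: eq_span => u; rewrite !inE orbCA.
Qed.

Lemma collinearC23 x y z : collinear x y z = collinear x z y.
Proof.
rewrite /collinear; congr (\dim _ <= _)%N; apply: eq_span => u; rewrite !inE.
by congr (_ || _); rewrite orbC.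
Qed.

Lemma coplanarC12 x y z u : coplanar x y z u = coplanar y x z u.
Proof.
by rewrite /coplanar; congr (\dim _ <= _)%N; apply: eq_span => w; rewrite !inE orbCA.
Qed.

Lemma coplanarC23 x y z u : coplanar x y z u = coplanar x z y u.
Proof.
rewrite /coplanar; congr (\dim _ <= _)%N; apply: eq_span => w; rewrite !inE.
by congr (_ || _); rewrite orbCA.
Qed.

Lemma coplanarC34 x y z u : coplanar x y z u = coplanar x y u z.
Proof.
rewrite /coplanar; congr (\dim _ <= _)%N; apply: eq_span => w; rewrite !inE.
by congr (_ || (_ || _)); rewrite orbC.
Qed.

Lemma collinear_refl x y : collinear x x y.
Proof.
rewrite /collinear span_consE; last by rewrite memv_span // inE eqxx.
exact: dim_span.
Qed.

Lemma span_last3 x y z : <<[:: hat x; hat y; hat z]>>%VS = (<[hat z]> + <<[:: hat x; hat y]>>)%VS.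
Proof.
by rewrite -span_cons; apply: eq_span => u; rewrite !inE [RHS]orbC orbA.
Qed.

Lemma span_last4 x y z u : <<[:: hat x; hat y; hat z; hat u]>>%VS =
  (<[hat u]> + <<[:: hat x; hat y; hat z]>>)%VS.
Proof.
by rewrite -span_cons; apply: eq_span => w; rewrite !inE [RHS]orbC !orbA.
Qed.

Lemma dim_addv1 (v : 'rV[F]_(1 + 3)) (U : {vspace 'rV[F]_(1 + 3)}) : (\dim (<[v]> + U) <= (\dim U).+1)%N.
Proof.
apply: leq_trans (leq_of_leqif (dimv_add_leqif _ _)) _; rewrite dim_vline.
by case: (v != 0); rewrite ?add1n ?add0n.
Qed.

Lemma collinear_coplanar x y z u : collinear x y z -> coplanar x y z u.
Proof.
move=> c; rewrite /coplanar span_last4; apply: leq_trans (dim_addv1 _ _) _.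
exact: c.
Qed.

Lemma collinear_exchange x y z u : x != y -> y != z -> collinear x y z ->
  collinear x y u = collinear y z u.
Proof.
move=> xy yz c; rewrite /collinear !span_last3.
have E : <<[:: hat x; hat y]>>%VS = <<[:: hat x; hat y; hat z]>>%VS.
  apply/eqP; rewrite eqEdim dim_span_pair //; apply/andP; split=> //.
  by apply: sub_span => w; rewrite !inE => /orP[->|->]; rewrite ?orbT.
rewrite E; congr (\dim (_ + _) <= _)%N.
apply/esym/eqP; rewrite eqEdim dim_span_pair //; apply/andP; split=> //.
by apply: sub_span => w; rewrite !inE => ->; rewrite orbT.
Qed.

Lemma coplanar_exchange x y z v u : ~~ collinear x y z -> ~~ collinear x y v ->
  coplanar x y z v -> coplanar x y z u = coplanar x y v u.
Proof.
rewrite /collinear -!ltnNge => H1 H2 H3; rewrite /coplanar !span_last4.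
have E : <<[:: hat x; hat y; hat z]>>%VS = <<[:: hat x; hat y; hat z; hat v]>>%VS.
  apply/eqP; rewrite eqEdim (leq_trans H3 H1) andbT.
  by apply: sub_span => w; rewrite !inE => /or3P[->|->|->]; rewrite ?orbT.
rewrite E; congr (\dim (_ + _) <= _)%N.
apply/esym/eqP; rewrite eqEdim (leq_trans H3 H2) andbT.
by apply: sub_span => w; rewrite !inE => /or3P[->|->|->]; rewrite ?orbT.
Qed.

(** Comparing the leading coordinates, all equal to 1, gives [a + b + c = 1]: a linear relation
    between lifted points is an affine one. *)
Lemma hat_comb3 x y z v a b c : hat v = a *: hat x + b *: hat y + c *: hat z ->
  v = x + b *: (y - x) + c *: (z - x).
Proof.
move=> E; have := E => /matrixP /(_ 0 (lshift 3 (0 : 'I_1))).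
rewrite !mxE !hatl !mulr1 => Eabc; apply: hat_inj; rewrite !hatD E.
have -> : a = 1 - b - c by rewrite Eabc; ring.
by apply/matrixP => i j; rewrite !mxE; ring.
Qed.

Lemma collinear_param x y u : x != y -> collinear x y u ->
  exists b, u = x + b *: (y - x).
Proof.
move=> xy c.
have : hat u \in <<[:: hat x; hat y]>>%VS.
  have -> : <<[:: hat x; hat y]>>%VS = <<[:: hat x; hat y; hat u]>>%VS.
    apply/eqP; rewrite eqEdim dim_span_pair //; apply/andP; split=> //.
    by apply: sub_span => w; rewrite !inE => /orP[->|->]; rewrite ?orbT.
  by rewrite memv_span // !inE eqxx !orbT.
rewrite span_cons span_seq1 => /memv_addP[_ /vlineP[a ->] [_ /vlineP[b ->] E]].
exists b; rewrite (@hat_comb3 x y x u a b 0); first by rewrite subrr scaler0 addr0.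
by rewrite scale0r addr0.
Qed.

Lemma collinear_on x y b : collinear x y (x + b *: (y - x)).
Proof.
rewrite /collinear span_last3.
suff /addv_idPr -> : (<[hat (x + b *: (y - x))]> <= <<[:: hat x; hat y]>>)%VS by apply: dim_span.
rewrite -memvE hatD rpredD ?rpredZ ?rpredB //; by rewrite memv_span // !inE eqxx ?orbT.
Qed.

Lemma coplanar_param x y z u : ~~ collinear x y z -> coplanar x y z u ->
  exists b c, u = x + b *: (y - x) + c *: (z - x).
Proof.
rewrite /collinear -ltnNge => xyz c.
have : hat u \in <<[:: hat x; hat y; hat z]>>%VS.
  have -> : <<[:: hat x; hat y; hat z]>>%VS = <<[:: hat x; hat y; hat z; hat u]>>%VS.
    apply/eqP; rewrite eqEdim (leq_trans c xyz) andbT.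
    by apply: sub_span => w; rewrite !inE => /or3P[->|->|->]; rewrite ?orbT.
  by rewrite memv_span // !inE eqxx !orbT.
rewrite !span_cons span_nil addv0.
move=> /memv_addP[_ /vlineP[a ->] [w /memv_addP[_ /vlineP[b ->] [_ /vlineP[e ->] ->]] E]].
exists b, e; apply: (@hat_comb3 x y z u a b e).
by rewrite E addrA.
Qed.

Lemma coplanar_on x y z b c : coplanar x y z (x + b *: (y - x) + c *: (z - x)).
Proof.
rewrite /coplanar span_last4.
set v := _ + c *: _.
suff /addv_idPr -> : (<[hat v]> <= <<[:: hat x; hat y; hat z]>>)%VS by apply: dim_span.
have X : hat x \in <<[:: hat x; hat y; hat z]>>%VS by rewrite memv_span // !inE eqxx.
have Y : hat y \in <<[:: hat x; hat y; hat z]>>%VS by rewrite memv_span // !inE eqxx orbT.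
have Z : hat z \in <<[:: hat x; hat y; hat z]>>%VS by rewrite memv_span // !inE eqxx !orbT.
by rewrite -memvE /v !hatD !rpredD ?rpredZ ?rpredB.
Qed.

Lemma card_collinear x y : x != y -> (#|[set u | collinear x y u]| <= #|F|)%N.
Proof.
move=> xy; rewrite -cardsT.
apply: leq_trans (leq_imset_card (fun b => x + b *: (y - x)) [set: F]).
apply: subset_leq_card; apply/subsetP => u; rewrite inE => /(collinear_param xy)[b ->].
by apply/imsetP; exists b.
Qed.

Lemma card_coplanar_le x y z : ~~ collinear x y z ->
  (#|[set u | coplanar x y z u]| <= #|F| ^ 2)%N.
Proof.
move=> xyz.
have -> : (#|F| ^ 2)%N = #|[set: F * F]| by rewrite cardsT card_prod expnS expn1.
apply: leq_trans (leq_imset_card (fun b => x + b.1 *: (y - x) + b.2 *: (z - x)) [set: F * F]).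
apply: subset_leq_card; apply/subsetP => u; rewrite inE => /(coplanar_param xyz)[b [c ->]].
by apply/imsetP; exists (b, c).
Qed.

Lemma card_coplanar_ge x y z : ~~ collinear x y z ->
  (#|F| ^ 2 <= #|[set u | coplanar x y z u]|)%N.
Proof.
move=> xyz.
have -> : (#|F| ^ 2)%N = #|[set: F * F]| by rewrite cardsT card_prod expnS expn1.
pose f (b : F * F) := x + b.1 *: (y - x) + b.2 *: (z - x).
have fi : injective f.
  move=> [b c] [b' c']; rewrite /f /= => E.
  have E2 : (b - b') *: (y - x) + (c - c') *: (z - x) = 0.
    move/eqP: E; rewrite -subr_eq0 => /eqP <-.
    by apply/matrixP => i j; rewrite !mxE; ring.
  have cc : c = c'.
    apply/eqP; rewrite -subr_eq0; apply: contraR xyz => cc.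
    have -> : z = x + (- (b - b') / (c - c')) *: (y - x); last exact: collinear_on.
    apply/matrixP => i j; have /matrixP /(_ i j) := E2; rewrite !mxE => H.
    apply: (mulfI cc).
    transitivity ((c - c') * x i j - (b - b') * (y i j - x i j)); last by field.
    by apply/eqP; rewrite -subr_eq0; apply/eqP; rewrite -[RHS]H; ring.
  move: E2; rewrite cc subrr scale0r addr0 => /eqP; rewrite scaler_eq0 subr_eq0.
  case/orP => [/eqP -> //|]; rewrite subr_eq0 => /eqP yx.
  by move: xyz; rewrite yx collinear_refl.
rewrite -(card_imset [set: F * F] fi).
apply: subset_leq_card; apply/subsetP => _ /imsetP[b _ ->]; rewrite inE.
exact: coplanar_on.
Qed.

Lemma affine_rank4_geometry : rank4_geometry #|F| collinear coplanar.
Proof.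
split.
- exact: collinear_refl.
- exact: collinearC12.
- exact: collinearC23.
- exact: coplanarC12.
- exact: coplanarC23.
- exact: coplanarC34.
- exact: collinear_coplanar.
- exact: collinear_exchange.
- exact: coplanar_exchange.
- exact: card_collinear.
- exact: card_coplanar_ge.
- by rewrite card_mx mul1n.
Qed.

End AffineSpace.

(** * Affine planes, general position and the moment curve *)

Section Planes.
Variable F : finFieldType.
Implicit Types (x y z u v w : 'rV[F]_3) (S : {set 'rV[F]_3}).

(** The square matrix with these four lifted points as rows is singular; a kernel vector is an
    affine functional vanishing at the points. *)
Lemma coplanar_functional x y z u : coplanar x y z u ->
  exists2 f : 'cV[F]_(1 + 3), f != 0 & forall v, v \in [:: x; y; z; u] -> hat v *m f = 0.
Proof.
move=> c; pose X := [:: hat x; hat y; hat z; hat u].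
pose A : 'M[F]_(1 + 3) := \matrix_(i < 1 + 3) nth 0 X i.
have : \det A^T == 0.
  rewrite det_tr; apply: contraTT c => dA.
  have uA : A \in unitmx by rewrite unitmxE unitfE.
  rewrite /coplanar -ltnNge.
  have -> : <<[:: hat x; hat y; hat z; hat u]>>%VS = fullv; last by rewrite dimvf.
  apply/eqP; rewrite eqEsubv subvf /=; apply/subvP => v _.
  rewrite -[v](mulmxKV uA) mulmx_sum_row; apply: rpred_sum => i _; apply: rpredZ.
  by rewrite rowK memv_span // mem_nth.
move/det0P => [f f0 fA]; exists f^T.
  by apply: contra f0 => /eqP /(congr1 trmx); rewrite trmxK trmx0 => ->.
have Af : A *m f^T = 0 by rewrite -[A]trmxK -trmx_mul fA trmx0.
have H (i : 'I_(1 + 3)) : nth 0 X i *m f^T = 0.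
  by rewrite -[nth 0 X i](rowK (fun i : 'I_(1 + 3) => nth 0 X i)) -row_mul Af row0.
move=> v; rewrite !inE => /or4P[] /eqP ->.
- exact: (H (Ordinal (isT : 0 < 1 + 3)%N)).
- exact: (H (Ordinal (isT : 1 < 1 + 3)%N)).
- exact: (H (Ordinal (isT : 2 < 1 + 3)%N)).
- exact: (H (Ordinal (isT : 3 < 1 + 3)%N)).
Qed.

Lemma hat_mul (f : 'cV[F]_(1 + 3)) v : hat v *m f = usubmx f + v *m dsubmx f.
Proof. by rewrite hatE -{1}[f]vsubmxK mul_row_col mul1mx. Qed.

(** The plane is the zero set of the functional [f]. Its linear part is nonzero, since otherwise
    vanishing at [x] would kill the constant term as well; rank-nullity then gives dimension 2. *)
Lemma coplanar_affine_plane x y z u : coplanar x y z u ->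
  exists2 P, affine_plane P & [set x; y; z; u] \subset P.
Proof.
case/coplanar_functional => f f0 Hf.
pose a := dsubmx f.
have a0 : a != 0.
  apply: contra f0 => /eqP a0; rewrite -[f]vsubmxK.
  have : hat x *m f = 0 by apply: Hf; rewrite inE eqxx.
  rewrite hat_mul -/a a0 mulmx0 addr0 => ->; by rewrite col_mx0.
pose g : 'Hom('rV[F]_3, 'rV[F]_1) := linfun (mulmxr a).
have gE v : g v = v *m a by rewrite lfunE.
exists [set v | v - x \in lker g].
  exists x, (lker g); split=> //.
  have := limg_ker_dim g fullv; rewrite capfv dimvf.
  have : (\dim (limg g) <= 1)%N.
    by apply: leq_trans (dimvS (subvf _)) _; rewrite dimvf.
  have : (0 < \dim (limg g))%N.
    rewrite lt0n dimv_eq0; apply: contra a0 => /eqP g0.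
    apply/eqP/matrixP => i j.
    have : g (delta_mx 0 i) \in limg g by rewrite memv_img // memvf.
    rewrite g0 memv0 gE -rowE => /eqP /matrixP /(_ 0 j).
    by rewrite !mxE.
  have -> : dim 'rV[F]_3 = 3 by [].
  move: (\dim (lker g)) (\dim (limg g)) => m n; lia.
have Hx : usubmx f + x *m a = 0 by rewrite -hat_mul; apply: Hf; rewrite inE eqxx.
apply/subsetP => v Hv; rewrite inE memv_ker gE mulmxBl.
have : hat v *m f = 0.
  by apply: Hf; move: Hv; rewrite !inE -!orbA.
rewrite hat_mul -/a => Hv2.
by apply/eqP; rewrite -[v *m a](addKr (usubmx f)) Hv2 -[x *m a](addKr (usubmx f)) Hx subrr.
Qed.

Lemma affine_plane_coplanar (P : {set 'rV[F]_3}) x y z u : affine_plane P ->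
  x \in P -> y \in P -> z \in P -> u \in P -> coplanar x y z u.
Proof.
case=> v [W [dW ->]]; rewrite !inE => Hx Hy Hz Hu.
pose g : 'Hom('rV[F]_3, 'rV[F]_(1 + 3)) := linfun (mulmxr (row_mx (0 : 'cV[F]_3) 1%:M)).
have gE w : g w = row_mx 0 w by rewrite lfunE /= mul_mx_row mulmx0 mulmx1.
have hE w : hat w = hat v + g (w - v).
  by rewrite gE !hatE add_row_mx addr0 addrC subrK.
have HW w : w - v \in W -> hat w \in (<[hat v]> + g @: W)%VS.
  by move=> Hw; rewrite hE memv_add ?memv_line // memv_img.
rewrite /coplanar; apply: leq_trans (_ : \dim (<[hat v]> + g @: W) <= _)%N.
  apply: dimvS; apply/span_subvP => w; rewrite !inE.
  by case/or4P => /eqP ->; apply: HW.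
apply: leq_trans (dim_addv1 _ _) _.
by have := limg_ker_dim g W; rewrite dW => /eq_leq; apply: leq_trans; apply: leq_addl.
Qed.

(* [general_position] does not constrain sets of fewer than four points, not even
   collinear triples. *)
Lemma general_position_independent S : general_position S -> (4 <= #|S|)%N ->
  independent (@collinear F) (@coplanar F) S.
Proof.
move=> gS S4.
have H4 x y z u : x \in S -> y \in S -> z \in S -> u \in S ->
    uniq [:: x; y; z; u] -> ~~ coplanar x y z u.
  move=> xS yS zS uS U; apply/negP => /coplanar_affine_plane[P aP sP].
  have : ~~ ([set x; y; z; u] \subset P).
    apply: gS => //; first by rewrite !subUset !sub1set xS yS zS uS.
    have -> : [set x; y; z; u] = [set w in [:: x; y; z; u]].
      by apply/setP => w; rewrite !inE -!orbA.
    by rewrite cardsE; apply/card_uniqP.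
  by rewrite sP.
apply/independentP; split=> // x y z xS yS zS U; apply/negP => c.
have : (0 < #|S :\: [set w in [:: x; y; z]]|)%N.
  rewrite cardsD subn_gt0; apply: leq_ltn_trans (_ : 3 < _)%N => //.
  apply: leq_trans (subset_leq_card (subsetIr _ _)) _.
  by rewrite cardsE card_size.
case/card_gt0P => u; rewrite inE => /andP[]; rewrite inE => uxyz uS.
have := H4 x y z u xS yS zS uS; rewrite collinear_coplanar //.
rewrite -[[:: x; y; z; u]]/(rcons [:: x; y; z] u) rcons_uniq uxyz U.
by move/(_ isT).
Qed.

Lemma general_position_of_coplanar S :
  (forall x y z u, x \in S -> y \in S -> z \in S -> u \in S ->
     uniq [:: x; y; z; u] -> ~~ coplanar x y z u) -> general_position S.
Proof.
move=> H T P /subsetP TS T4 aP; apply/negP => /subsetP TP.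
have sT : size (enum T) = 4 by rewrite -cardE.
have uT := enum_uniq T.
case: (enum T) sT uT (mem_enum T) => [|x [|y [|z [|u [|? ?]]]]] //= _ U M.
have xT : x \in T by rewrite -M !inE eqxx.
have yT : y \in T by rewrite -M !inE eqxx orbT.
have zT : z \in T by rewrite -M !inE eqxx !orbT.
have uT : u \in T by rewrite -M !inE eqxx !orbT.
have := H x y z u (TS _ xT) (TS _ yT) (TS _ zT) (TS _ uT) U.
by rewrite (affine_plane_coplanar aP (TP _ xT) (TP _ yT) (TP _ zT) (TP _ uT)).
Qed.

Definition moment_point (t : F) : 'rV[F]_3 := \row_(j < 3) t ^+ j.+1.

Lemma moment_point_inj : injective moment_point.
Proof. by move=> s t /matrixP /(_ 0 0); rewrite !mxE !expr1. Qed.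

(** On the curve, an affine functional is a polynomial of degree at most 3 in the parameter, so it
    cannot have four distinct roots. *)
Lemma moment_general_position : general_position [set moment_point t | t : F].
Proof.
apply: general_position_of_coplanar => _ _ _ _ /imsetP[a _ ->] /imsetP[b _ ->]
  /imsetP[c _ ->] /imsetP[e _ ->] U.
have {}U : uniq [:: a; b; c; e].
  by rewrite -(map_inj_uniq moment_point_inj).
apply/negP => /coplanar_functional[f f0 Hf].
pose p : {poly F} := \poly_(i < 4) (f (inord i) 0).
have pE t : (hat (moment_point t) *m f) 0 0 = p.[t].
  rewrite horner_poly mxE; apply: eq_bigr => i _; rewrite inord_val mulrC; congr (_ * _).
  rewrite hatE mxE; case: splitP => j E; rewrite mxE E; first by rewrite ord1.
  by [].
have rp t : hat (moment_point t) *m f = 0 -> root p t.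
  by move=> H; rewrite /root -pE H mxE.
have p0 : p != 0.
  apply: contra f0 => /eqP p0; apply/eqP/matrixP => i j; rewrite ord1 mxE.
  have := congr1 (fun r : {poly F} => r`_i) p0.
  by rewrite coef_poly coef0 ltn_ord inord_val.
have := max_poly_roots p0 _ U; rewrite /= !rp ?Hf ?inE ?eqxx ?orbT // => /(_ isT).
by rewrite ltnNge size_poly.
Qed.

Lemma card_sum_pairs (T S : finType) (P : pred (T * S)) :
  #|[set i | P i]| = (\sum_a #|[set b | P (a, b)]|)%N.
Proof.
rewrite -sum1_card (eq_bigl (fun i => true && P (i.1, i.2))); last first.
  by move=> [a b]; rewrite inE.
rewrite -(pair_big_dep (fun _ => true) (fun a b => P (a, b)) (fun _ _ => 1%N)) /=.
by apply: eq_bigr => a _; rewrite -sum1_card; apply: eq_bigl => b; rewrite inE.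
Qed.

(** If the first three points are not collinear, the fourth has [q ^ 2] choices, giving [q ^ 11];
    collinear triples number at most [q ^ 7], and a free fourth point gives [q ^ 10]. *)
Lemma card_coplanar_quads :
  (#|[set i : ('rV[F]_3 * 'rV[F]_3) * 'rV[F]_3 * 'rV[F]_3 |
     uniq [:: i.1.1.1; i.1.1.2; i.1.2; i.2] && coplanar i.1.1.1 i.1.1.2 i.1.2 i.2]|
   <= 2 * #|F| ^ 11)%N.
Proof.
pose A := [set i : ('rV[F]_3 * 'rV[F]_3) * 'rV[F]_3 * 'rV[F]_3 |
  ~~ collinear i.1.1.1 i.1.1.2 i.1.2 && coplanar i.1.1.1 i.1.1.2 i.1.2 i.2].
pose B := [set i : ('rV[F]_3 * 'rV[F]_3) * 'rV[F]_3 * 'rV[F]_3 |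
  (i.1.1.1 != i.1.1.2) && collinear i.1.1.1 i.1.1.2 i.1.2].
apply: leq_trans (_ : #|A :|: B| <= _)%N.
  apply: subset_leq_card; apply/subsetP => -[[[x y] z] u]; rewrite !inE /= !negb_or.
  by case/andP => /andP[/and3P[-> _ _] _] ->; case: (collinear x y z).
apply: leq_trans (leq_of_leqif (leq_card_setU _ _)) _.
have q0 : (0 < #|F|)%N by apply/card_gt0P; exists 0.
have cV : #|{: 'rV[F]_3}| = (#|F| ^ 3)%N by rewrite card_mx mul1n.
rewrite mul2n -addnn; apply: leq_add.
  rewrite /A card_sum_pairs.
  apply: leq_trans (_ : \sum_(j : ('rV[F]_3 * 'rV[F]_3) * 'rV[F]_3) #|F| ^ 2 <= _)%N.
    apply: leq_sum => -[[x y] z] _ /=; have [c|c] := boolP (collinear x y z).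
      by rewrite (_ : [set u | _] = set0) ?cards0 //; apply/setP => u; rewrite !inE.
    by apply: leq_trans (card_coplanar_le c); apply: subset_leq_card; apply/subsetP => u; rewrite !inE.
  rewrite sum_nat_const /= !card_prod cV -!expnD; by rewrite leqnn.
rewrite /B card_sum_pairs.
apply: leq_trans (_ : \sum_(j : ('rV[F]_3 * 'rV[F]_3) * 'rV[F]_3 | (j.1.1 != j.1.2) && collinear j.1.1 j.1.2 j.2) #|F| ^ 3 <= _)%N.
  rewrite [leqRHS]big_mkcond; apply: leq_sum => -[[x y] z] _ /=.
  case: ifP => H; first by rewrite -cV max_card.
  by rewrite (_ : [set u | _] = set0) ?cards0 //; apply/setP => u; rewrite !inE.
rewrite sum_nat_const.
apply: leq_trans (_ : (#|F| ^ 6 * #|F|) * #|F| ^ 3 <= _)%N; last first.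
  by rewrite -expnSr -expnD leq_pexp2l.
rewrite leq_mul2r; apply/orP; right.
have := card_sum_pairs (fun j : ('rV[F]_3 * 'rV[F]_3) * 'rV[F]_3 => (j.1.1 != j.1.2) && collinear j.1.1 j.1.2 j.2).
rewrite cardsE => ->.
apply: leq_trans (_ : \sum_(j : 'rV[F]_3 * 'rV[F]_3) #|F| <= _)%N.
  apply: leq_sum => -[x y] _ /=; have [E|xy] := eqVneq x y.
    by rewrite (_ : [set u | _] = set0) ?cards0 //; apply/setP => u; rewrite !inE.
  by rewrite /=; apply: leq_trans (card_collinear xy).
by rewrite sum_nat_const card_prod cV -expnD.
Qed.

End Planes.

(** * Counting independent sets *)

From mathcomp Require Import boolp reals sequences exp.
From mathcomp Require Import all_boot all_order all_algebra archimedean.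

Lemma independent_sub (V : finType) (col : V -> V -> V -> bool) cop (A D : {set V}) :
  D \subset A -> independent col cop A -> independent col cop D.
Proof.
move=> /subsetP DA /independentP[H3 H4]; apply/independentP; split.
  by move=> x y z /DA xA /DA yA /DA zA; apply: H3.
by move=> x y z u /DA xA /DA yA /DA zA /DA uA; apply: H4.
Qed.

Lemma rare_vertex (V : finType) (q : nat) col cop (R : realFieldType)
    (J : {set {set V}}) (C : {set V}) (lam d s : R) :
  rank4_geometry q col cop -> 0 < lam -> 0 < d -> d * (500 * 500) <= 1 ->
  s ^+ 3 = q%:R -> 2 <= d * s -> 1000 * 1000 * q%:R <= #|C|%:R :> R ->
  s <= lam / (1 + lam) * #|C|%:R ->
  family_on (independent col cop) C J -> set0 \in J ->
  exists2 v, v \in C & partfun lam (link v J) <= (1 - d) * partfun lam J.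
Proof.
move=> geo lam0 d0 d1 s3 ds NK sp [dJ JC] J0.
apply/exists_inP; apply: contraT; rewrite negb_exists => /forallP H; exfalso.
apply: (rare_contradiction geo lam0 dJ JC J0 _ erefl erefl d0 d1 s3 ds NK sp).
by move=> v vC; have := H v; rewrite vC /= -ltNge.
Qed.

Lemma partfun_le_all (V : finType) (R : realFieldType) (good : pred {set V})
    (x : R) (C : {set V}) (J : {set {set V}}) :
  0 <= x -> (forall A D : {set V}, D \subset A -> good A -> good D) ->
  family_on good C J -> partfun x J <= (1 + x) ^+ #|C|.
Proof.
move=> x0 gh; move En : #|C| => n; elim: n C J En => [|n IHn] C J En fJ.
  rewrite expr0.
  have JC (A : {set V}) : A \in J -> A = set0.
    move/(proj2 fJ) => [AsC _]; apply/eqP; rewrite -subset0.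
    by move/eqP: En; rewrite cards_eq0 => /eqP <-.
  have [J0|J0] := boolP (set0 \in J).
    rewrite /partfun (bigD1 set0) //= cards0 expr0 big1 ?addr0 // => A /andP[/JC ->].
    by rewrite eqxx.
  by rewrite /partfun big1 // => A AJ; have := AJ; rewrite {1}(JC _ AJ) (negbTE J0).
have /card_gt0P[v vC] : (0 < #|C|)%N by rewrite En.
have cC : #|C :\ v| = n by move: (cardsD1 v C); rewrite vC En add1n => -[].
rewrite (partfun_split x v J) exprS mulrDl mul1r; apply: lerD.
  exact: IHn cC (family_on_deletion v fJ).
by apply: ler_wpM2l => //; exact: IHn cC (family_on_link v fJ gh).
Qed.

Lemma exprD1_le_expR (R : realType) (x : R) n : 0 <= x -> (1 + x) ^+ n <= expR (x * n%:R).
Proof.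
move=> x0; rewrite mulrC expRM_natl; apply: lerXn2r; rewrite ?nnegrE ?addr_ge0 ?expR_ge0 //.
exact: expR_ge1Dx.
Qed.

(** * Iterated halving of the ground set *)

Section Rounds.
Variables (V : finType) (q : nat) (col : V -> V -> V -> bool)
    (cop : V -> V -> V -> V -> bool).
Hypothesis geo : rank4_geometry q col cop.
Variables (R : realType) (d s x : R) (M a : nat).
Hypothesis d0 : 0 < d.
Hypothesis d1 : d * (500 * 500) <= 1.
Hypothesis s3 : s ^+ 3 = q%:R.
Hypothesis ds : 2 <= d * s.
Hypothesis HM : 1000 * 1000 * q%:R <= M%:R :> R.
Hypothesis x0 : 0 <= x.
Hypothesis Ha : (1 - d) ^+ a * #|V|%:R <= 1.

(** Each halving contributes [4 * s * a + x] to the exponent: the hard-core partition function is at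
    most [expR (4 * s)] and enters to the power [a], and [Ha] bounds the product over the vertices
    by [expR x]. Ground sets of at most [M] points get the trivial bound [(1 + x) ^+ M]. *)
Lemma partfun_rounds i (C : {set V}) (J : {set {set V}}) : (#|C| <= M * 2 ^ i)%N -> family_on (independent col cop) C J ->
  partfun x J <= expR (x * M%:R + i%:R * (4 * s * a%:R + x)).
Proof.
have gh := @independent_sub V col cop.
have s1 : 1000 <= s by move: ds d0 d1; nra.
have s0 : 0 < s by move: s1; lra.
have q0 : 0 < q%:R :> R by rewrite -s3 exprn_gt0.
have M0 : 0 < M%:R :> R by move: HM q0; lra.
elim: i C J => [|i IHi] C J HC fJ.
  rewrite mul0r addr0; apply: le_trans (partfun_le_all x0 gh fJ) _.
  apply: le_trans (exprD1_le_expR _ x0) _; rewrite ler_expR; apply: ler_wpM2l => //.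
  by rewrite ler_nat; move: HC; rewrite expn0 muln1.
pose n1 := (M * 2 ^ i)%N.
have n1M : M%:R <= n1%:R :> R by rewrite ler_nat /n1 leq_pmulr // expn_gt0.
have n10 : 0 < n1%:R :> R by apply: lt_le_trans n1M.
(* This density reaches the threshold [s] of [rare_vertex] on every ground set larger than [n1];
   [lam] below is the activity with [lam / (1 + lam) = p]. *)
pose p := s / n1%:R.
have p0 : 0 < p by rewrite divr_gt0.
have p12 : p <= 1 / 2.
  rewrite ler_pdivrMr //.
  have : s <= s ^+ 3 by rewrite exprS ler_peMr ?(ltW s0) // exprn_ege1 //; move: s1; lra.
  rewrite s3; move: HM n1M; lra.
pose lam := p / (1 - p).
have p1 : 0 < 1 - p by move: p12; lra.
have lam0 : 0 < lam by rewrite divr_gt0.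
have lamp : lam / (1 + lam) = p by rewrite /lam; field; rewrite gt_eqF //=; lra.
have lam2 : lam <= 2 * p.
  by rewrite ler_pdivrMr //; move: p0 p12; nra.
have lamn : lam * (n1 * 2)%:R <= 4 * s.
  apply: le_trans (ler_wpM2r _ lam2) _ => //.
  by rewrite natrM /p -[X in _ <= X]mulr1 le_eqVlt; apply/orP; left; apply/eqP; field; rewrite gt_eqF.
have dlt : d <= 1 by move: d1 d0; lra.
have := @partfun_container V R (independent col cop) lam x d _ a n1 (n1 * 2)
  gh (ltW lam0) x0 (expR_ge0 _) dlt _ IHi C J.
rewrite -/n1 in IHi *.
have step : forall (C0 : {set V}) (J0 : {set {set V}}), (n1 < #|C0| <= n1 * 2)%N ->
   family_on (independent col cop) C0 J0 -> set0 \in J0 ->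
   exists2 v, v \in C0 & partfun lam (link v J0) <= (1 - d) * partfun lam J0.
  move=> C0 J0 /andP[nC _] f0 J00; apply: (rare_vertex geo lam0 d0 d1 s3 ds _ _ f0 J00).
    by apply: le_trans HM (le_trans n1M _); rewrite ler_nat ltnW.
  rewrite lamp /p -mulrA ler_peMr ?(ltW s0) // mulrC ler_pdivlMr // mul1r ler_nat; exact: ltnW.
have HC2 : (#|C| <= n1 * 2)%N by rewrite /n1 -mulnA -expnSr.
move=> /(_ step HC2 fJ) H; apply: le_trans H _.
have Z4 : partfun lam J <= expR (4 * s).
  apply: le_trans (partfun_le_all (ltW lam0) gh fJ) _.
  apply: le_trans (exprD1_le_expR _ (ltW lam0)) _; rewrite ler_expR.
  apply: le_trans lamn; apply: ler_wpM2l; first exact: ltW.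
  by rewrite ler_nat.
have Za : partfun lam J ^+ a <= expR (4 * s * a%:R).
  rewrite mulrC expRM_natl; apply: lerXn2r => //; rewrite nnegrE ?expR_ge0 //.
  by apply: partfun_ge0; apply: ltW.
have e0 : 0 <= (1 - d) ^+ a by rewrite exprn_ge0 // subr_ge0.
have X : (1 + x * (1 - d) ^+ a) ^+ #|C| <= expR x.
  apply: le_trans (exprD1_le_expR _ (mulr_ge0 x0 e0)) _; rewrite ler_expR.
  rewrite -mulrA ler_piMr //; apply: le_trans Ha; apply: ler_wpM2l => //.
  by rewrite ler_nat max_card.
apply: le_trans (_ : expR (x * M%:R + i%:R * (4 * s * a%:R + x)) * expR (4 * s * a%:R) * expR x <= _).
  apply: ler_pM => //.
  - by rewrite mulr_ge0 ?expR_ge0 // exprn_ge0 // partfun_ge0 // ltW.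
  - by rewrite exprn_ge0 // addr_ge0 // mulr_ge0.
  - by apply: ler_wpM2l => //; apply: expR_ge0.
rewrite -!expRD ler_expR -natr1; lra.
Qed.

Lemma independent_partfun_le i : (#|V| <= M * 2 ^ i)%N ->
  partfun x [set A : {set V} | independent col cop A] <= expR (x * M%:R + i%:R * (4 * s * a%:R + x)).
Proof.
move=> Vi; apply: (@partfun_rounds i [set: V]); first by rewrite cardsT.
split=> [A D DA|A]; rewrite !inE; first exact: independent_sub DA.
by move=> iA; split=> //; apply: subsetT.
Qed.

End Rounds.

(** * Random subsets *)

Section RandomSubset.
Variables (R : realType) (T : finType).
Implicit Types (p : R) (A B D X : {set T}) (E G : pred {set T}).

Definition subset_weight p A : R := (\prod_(x in A) p) * (\prod_(x in ~: A) (1 - p)).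

Lemma subset_weight_prod p A :
  subset_weight p A = \prod_x (if x \in A then p else 1 - p).
Proof.
rewrite /subset_weight [RHS](bigID (mem A)) /=; congr (_ * _).
  by apply: eq_big => [x|x ->]; rewrite ?andbT.
by apply: eq_big => x; rewrite inE // => /negbTE ->.
Qed.

Lemma subset_weight_ge0 p A : 0 <= p <= 1 -> 0 <= subset_weight p A.
Proof.
move=> /andP[p0 p1]; rewrite subset_weight_prod; apply: prodr_ge0 => x _.
by case: ifP; rewrite ?subr_ge0.
Qed.

Lemma prob_superset p D : \sum_(A : {set T} | D \subset A) subset_weight p A = p ^+ #|D|.
Proof.
have -> : p ^+ #|D| = \prod_x (p + (if x \in D then 0 else 1 - p)).
  rewrite (bigID (mem D)) /= [X in _ * X]big1 ?mulr1 => [|x /negbTE ->]; last by rewrite addrC subrK.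
  rewrite (eq_bigr (fun=> p)) ?prodr_const // => x ->; exact: addr0.
rewrite bigA_distr [RHS](bigID (fun A : {set T} => D \subset A)) /= [X in _ = _ + X]big1 ?addr0.
  apply: eq_bigr => A DA; rewrite subset_weight_prod; apply: eq_bigr => x _.
  case: ifP => // xA; case: ifP => // xD.
  by rewrite (subsetP DA _ xD) in xA.
move=> A /subsetPn[x xD xA]; rewrite (bigD1 x) //= (negbTE xA) xD mul0r //.
Qed.

Lemma prob_total p : \sum_A subset_weight p A = 1.
Proof.
rewrite -(expr0 p) -(cards0 T) -prob_superset; apply: eq_bigl => A.
by rewrite sub0set.
Qed.

Lemma prob_mono p E G : 0 <= p <= 1 -> (forall A, E A -> G A) ->
  prob_random_subset p E <= prob_random_subset p G.
Proof. by move=> p01 EG; apply: ler_sum_pred => // A; apply: subset_weight_ge0. Qed.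

Lemma prob_le1 p E : 0 <= p <= 1 -> prob_random_subset p E <= 1.
Proof.
by move=> p01; rewrite -(prob_total p); apply: ler_sum_pred => // A; apply: subset_weight_ge0.
Qed.

Lemma prob_compl p E : 1 - prob_random_subset p [pred A | ~~ E A] = prob_random_subset p E.
Proof.
rewrite -(prob_total p) (bigID E) /= addrK.
by [].
Qed.

Lemma prob_union p E G : 0 <= p <= 1 ->
  prob_random_subset p [pred A | E A || G A] <= prob_random_subset p E + prob_random_subset p G.
Proof. by move=> p01; apply: ler_sum_predU => // A; apply: subset_weight_ge0. Qed.

Lemma prob_markov p E (f : {set T} -> R) t : 0 <= p <= 1 -> 0 < t ->
  (forall A, 0 <= f A) -> (forall A, E A -> t <= f A) ->
  prob_random_subset p E <= (\sum_A subset_weight p A * f A) / t.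
Proof.
move=> p01 t0 f0 Ef; rewrite ler_pdivlMr // mulr_suml big_mkcond.
apply: ler_sum => A _; have w0 := subset_weight_ge0 A p01; case: ifP => H.
  by apply: ler_wpM2l => //; apply: Ef.
exact: mulr_ge0.
Qed.

(* Sprinkling: a [p']-random set is the union of a [p]-random set and an
   independent [r]-random set, where [p' = p + (1 - p) r]. *)
Lemma prob_increasing p p' E : 0 <= p -> p <= p' -> p' <= 1 ->
  (forall A B, A \subset B -> E A -> E B) ->
  prob_random_subset p E <= prob_random_subset p' E.
Proof.
move=> p0 pp' p'1 incE.
have [p1|p1] := eqVneq p 1.
  by have -> : p' = p by apply/eqP; rewrite eq_le pp' p1 p'1.
have p1' : 0 < 1 - p by rewrite subr_gt0 lt_neqAle p1 (le_trans pp').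
pose r := (p' - p) / (1 - p).
have r0 : 0 <= r by rewrite divr_ge0 ?subr_ge0 // -subr_ge0 ltW.
have r1 : 0 <= 1 - r.
  rewrite subr_ge0 ler_pdivrMr // mul1r; lra.
have p'E : p' = p + (1 - p) * r by rewrite /r; field; rewrite gt_eqF.
(* [K A B] is the conditional probability that adding an [r]-random set to [A] produces [B]; it
   vanishes unless [A] lies in [B]. *)
pose K A B : R := \prod_x (if x \in B then (if x \in A then 1 else r) else (if x \in A then 0 else 1 - r)).
have K0 A B : 0 <= K A B.
  by apply: prodr_ge0 => x _; case: ifP => _; case: ifP.
have K1 A : \sum_B K A B = 1.
  rewrite /K -(bigA_distr _ _ (fun x => if x \in A then 1 else r) (fun x => if x \in A then 0 else 1 - r)).
  by rewrite big1 // => x _ /=; case: (x \in A); [rewrite addr0 | rewrite addrC subrK].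
have WK B : subset_weight p' B = \sum_A subset_weight p A * K A B.
  rewrite subset_weight_prod.
  transitivity (\prod_x ((if x \in B then p else 0) +
     (if x \in B then (1 - p) * r else (1 - p) * (1 - r)))).
    apply: eq_bigr => x _; case: ifP => _; first by rewrite p'E.
    rewrite p'E; ring.
  rewrite bigA_distr; apply: eq_bigr => A _; rewrite subset_weight_prod -big_split /=.
  apply: eq_bigr => x _; case: ifP => xA; case: ifP => xB; rewrite ?mulr1 ?mulr0 //.
rewrite /prob_random_subset.
rewrite [leRHS](eq_bigr (fun B => \sum_A subset_weight p A * K A B)); last first.
  by move=> B _; rewrite -WK.
rewrite exchange_big /= big_mkcond; apply: ler_sum => A _.
have w0 : 0 <= subset_weight p A by apply: subset_weight_ge0; rewrite p0 (le_trans pp').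
case: ifP => EA; last by apply: sumr_ge0 => B _; apply: mulr_ge0.
apply: le_trans (_ : subset_weight p A * \sum_B K A B <= _); first by rewrite K1 mulr1.
rewrite -mulr_sumr; apply: ler_wpM2l => //.
rewrite [leLHS](bigID E) /= [X in _ + X]big1 ?addr0 // => B nEB.
have : ~~ (A \subset B) by apply: contra nEB => AB; apply: incE EA.
move=> /subsetPn[x xA xB]; rewrite /K (bigD1 x) //= xA (negbTE xB) mul0r //.
Qed.

Lemma expect_count p (I : finType) (P : pred I) (D : I -> {set T}) :
  \sum_A subset_weight p A * #|[set i | P i && (D i \subset A)]|%:R
    = \sum_(i | P i) p ^+ #|D i|.
Proof.
rewrite [RHS](eq_bigr (fun i => \sum_(A : {set T} | D i \subset A) subset_weight p A)); last first.
  by move=> i _; rewrite prob_superset.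
under [RHS]eq_bigr => i _ do rewrite big_mkcond.
rewrite [RHS]exchange_big /=; apply: eq_bigr => A _.
rewrite -big_mkcondr /= sumr_const mulr_natr; congr (_ *+ _).
by apply: eq_card => i; rewrite inE.
Qed.

Lemma expect_card p X : \sum_A subset_weight p A * #|A :&: X|%:R = p * #|X|%:R.
Proof.
have H := expect_count p (mem X) (fun x => [set x]).
have E : \sum_(x in X) p ^+ #|[set x]| = p * #|X|%:R.
  by under eq_bigr => x _ do rewrite cards1; rewrite sumr_const mulr_natr.
rewrite -E -H; apply: eq_bigr => A _; congr (_ * _%:R).
by apply: eq_card => x; rewrite !inE sub1set andbC.
Qed.

Lemma expect_card2 p X : 0 <= p ->
  \sum_A subset_weight p A * #|A :&: X|%:R ^+ 2 <= (p * #|X|%:R) ^+ 2 + p * #|X|%:R.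
Proof.
move=> p0.
have := expect_count p (fun i : T * T => (i.1 \in X) && (i.2 \in X)) (fun i => [set i.1; i.2]).
have -> : \sum_A subset_weight p A * #|[set i : T * T | (i.1 \in X) && (i.2 \in X) && ([set i.1; i.2] \subset A)]|%:R
   = \sum_A subset_weight p A * #|A :&: X|%:R ^+ 2.
  apply: eq_bigr => A _; congr (_ * _); rewrite expr2 -natrM -cardsX; congr _%:R.
  apply: eq_card => -[x y]; rewrite !inE subUset !sub1set /=.
  by case: (x \in X); case: (y \in X); case: (x \in A); case: (y \in A).
move=> ->.
apply: le_trans (_ : \sum_(i : T * T | (i.1 \in X) && (i.2 \in X)) (p ^+ 2 + p * (i.1 == i.2)%:R) <= _).
  apply: ler_sum => -[x y] _ /=; rewrite cards2; case: eqVneq => [_|_] /=.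
    by rewrite mulr1 lerDr exprn_ge0.
  by rewrite mulr0 addr0.
rewrite -(pair_big_dep (mem X) (fun _ => mem X) (fun x y => p ^+ 2 + p * (x == y)%:R)) /=.
rewrite (eq_bigr (fun x => p ^+ 2 * #|X|%:R + p)) => [|x xX]; last first.
  rewrite big_split /= sumr_const mulr_natr -mulr_sumr (bigD1 x) //= eqxx big1 ?addr0 ?mulr1 //.
  by move=> y /andP[_ /negbTE H]; rewrite eq_sym H.
rewrite sumr_const -[leLHS]mulr_natr le_eqVlt; apply/orP; left; apply/eqP; ring.
Qed.

(** Leaving the window means deviating from the mean [m] by at least [m / 2], and the variance is at
    most [m] by [expect_card2]. *)
Lemma prob_chebyshev p X : 0 <= p <= 1 -> 0 < p * #|X|%:R ->
  prob_random_subset p [pred A : {set T} |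
     ~~ (p * #|X|%:R / 2 <= #|A :&: X|%:R <= 2 * (p * #|X|%:R))] <= 4 / (p * #|X|%:R).
Proof.
move=> p01; set m := p * _ => m0.
have p0 : 0 <= p by case/andP: p01.
apply: le_trans (prob_markov (f := fun A => (#|A :&: X|%:R - m) ^+ 2) (t := m ^+ 2 / 4) p01 _ _ _) _.
- by rewrite divr_gt0 // exprn_gt0.
- by move=> A; apply: sqr_ge0.
- move=> A /=; rewrite negb_and -!ltNge; set a := #|_|%:R.
  have a0 : 0 <= a by rewrite /a.
  by move=> /orP[] H; nra.
have -> : \sum_A subset_weight p A * (#|A :&: X|%:R - m) ^+ 2 =
   \sum_A subset_weight p A * #|A :&: X|%:R ^+ 2 - m ^+ 2.
  have -> : m ^+ 2 = 2 * m * (\sum_A subset_weight p A * #|A :&: X|%:R) - m ^+ 2 * \sum_A subset_weight p A.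
    by rewrite expect_card prob_total -/m; ring.
  rewrite !mulr_sumr -!sumrB; apply: eq_bigr => A _; ring.
have := expect_card2 X p0; rewrite -/m => H.
rewrite ler_pdivrMr ?divr_gt0 ?exprn_gt0 //.
have -> : 4 / m * (m ^+ 2 / 4) = m by field; rewrite gt_eqF.
lra.
Qed.

End RandomSubset.

(** * Probabilistic bounds on [alpha] for a fixed field *)

Section Alpha.
Variables (R : realType) (F : finFieldType).
Implicit Types (A B S : {set 'rV[F]_3}) (p : R) (m : nat).
Local Notation Q := (#|F|%:R : R).
Local Notation indep := (independent (@collinear F) (@coplanar F)).

Lemma leq_alpha A S : S \subset A -> general_position S -> (#|S| <= alpha A)%N.
Proof.
move=> SA gS; rewrite /alpha; apply: (leq_bigmax_cond (F := fun S : {set 'rV[F]_3} => #|S|)).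
by rewrite SA; apply/asboolP.
Qed.

Lemma alpha_leq_card A : (alpha A <= #|A|)%N.
Proof. by apply/bigmax_leqP => S /andP[SA _]; apply: subset_leq_card. Qed.

Lemma alphaS A B : A \subset B -> (alpha A <= alpha B)%N.
Proof.
move=> AB; apply/bigmax_leqP => S /andP[SA /asboolP gS].
by apply: leq_alpha => //; apply: subset_trans AB.
Qed.

Lemma alpha_witness A m : (m < alpha A)%N ->
  exists S, [/\ S \subset A, general_position S & (m < #|S|)%N].
Proof.
move=> mA; apply: contrapT => H; move: mA; rewrite ltnNge => /negP; apply.
apply/bigmax_leqP => S /andP[SA /asboolP gS]; rewrite leqNgt; apply/negP => mS.
by apply: H; exists S.
Qed.

Lemma prob_two_sided p (E1 E2 : pred {set 'rV[F]_3}) e1 e2 : 0 <= p <= 1 ->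
  1 - e1 <= prob_random_subset p E1 -> 1 - e2 <= prob_random_subset p E2 ->
  1 - (e1 + e2) <= prob_random_subset p [pred A | E1 A && E2 A].
Proof.
move=> p01 H1 H2; rewrite -prob_compl.
have := prob_union [pred A | ~~ E1 A] [pred A | ~~ E2 A] p01.
have : prob_random_subset p [pred A | ~~ (E1 A && E2 A)] <=
   prob_random_subset p [pred A | ~~ E1 A || ~~ E2 A].
  by apply: prob_mono => // A /=; rewrite negb_and.
have := prob_compl p E1; have := prob_compl p E2; move: H1 H2; lra.
Qed.

(** With [mu = p * q ^ 3], Chebyshev keeps at least [mu / 2] points. At most [2 * p ^ 4 * q ^ 11]
    coplanar quadruples are expected, so by Markov fewer than [mu / 4] occur outside probability
    [8 * p ^ 3 * q ^ 8], and deletions leave [mu / 4] points. *)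
Lemma prob_alpha_sparse p : 0 <= p <= 1 -> 0 < p ->
  1 - (4 / (p * Q ^+ 3) + 8 * (p ^+ 3 * Q ^+ 8)) <=
  prob_alpha_between F p (1 / 4 * p * Q ^+ 3) (2 * p * Q ^+ 3).
Proof.
move=> p01 p0.
have Q0 : 0 < Q by rewrite ltr0n; apply/card_gt0P; exists 0.
set mu := p * Q ^+ 3; have mu0 : 0 < mu by rewrite mulr_gt0 // exprn_gt0.
have cT : p * #|[set: 'rV[F]_3]|%:R = mu by rewrite cardsT card_mx mul1n natrX.
pose P (i : 'rV[F]_3 * 'rV[F]_3 * 'rV[F]_3 * 'rV[F]_3) :=
  uniq [:: i.1.1.1; i.1.1.2; i.1.2; i.2] && coplanar i.1.1.1 i.1.1.2 i.1.2 i.2.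
pose D (i : 'rV[F]_3 * 'rV[F]_3 * 'rV[F]_3 * 'rV[F]_3) := [set i.1.1.1; i.1.1.2; i.1.2; i.2].
pose quads A := [set i | P i && (D i \subset A)].
have cheb := @prob_chebyshev R _ p [set: 'rV[F]_3] p01; rewrite cT in cheb.
have {cheb} := cheb mu0.
have markov : prob_random_subset p [pred A | mu / 4 <= #|quads A|%:R] <= 8 * (p ^+ 3 * Q ^+ 8).
  apply: le_trans (prob_markov (f := fun A => #|quads A|%:R) (t := mu / 4) p01 _ _ _) _.
  - exact: divr_gt0.
  - by [].
  - by [].
  rewrite expect_count.
  rewrite (eq_bigr (fun=> p ^+ 4)) => [|i /andP[U _]]; last first.
    congr (_ ^+ _); have -> : D i = [set w in [:: i.1.1.1; i.1.1.2; i.1.2; i.2]].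
      by apply/setP => w; rewrite !inE -!orbA.
    by rewrite cardsE; apply/card_uniqP.
  rewrite sumr_const -[X in X / _]mulr_natr ler_pdivrMr ?divr_gt0 //.
  have : #|P|%:R <= 2 * Q ^+ 11.
    rewrite -natrX -natrM ler_nat; apply: leq_trans (card_coplanar_quads F).
    by rewrite cardsE.
  move=> /(ler_wpM2l (exprn_ge0 4 (ltW p0))) H; apply: le_trans H _.
  rewrite /mu le_eqVlt; apply/orP; left; apply/eqP; by field.
move=> cheb.
have both := prob_union [pred A : {set 'rV[F]_3} | ~~ (mu / 2 <= #|A :&: [set: 'rV[F]_3]|%:R <= 2 * mu)]
   [pred A | mu / 4 <= #|quads A|%:R] p01.
have : 1 - prob_random_subset p [pred A | ~~ (mu / 2 <= #|A :&: [set: 'rV[F]_3]|%:R <= 2 * mu)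
     || (mu / 4 <= #|quads A|%:R)] <= prob_alpha_between F p (1 / 4 * p * Q ^+ 3) (2 * p * Q ^+ 3).
  rewrite -[leRHS]prob_compl lerD2l lerN2.
  apply: prob_mono => // A /=; apply: contraR; rewrite negb_or negbK -ltNge setIT.
  move=> /andP[/andP[A1 A2] A3].
  rewrite -!mulrA -/mu; apply/andP; split; last first.
    by apply: le_trans A2; rewrite ler_nat alpha_leq_card.
  pose S := A :\: [set i.1.1.1 | i in quads A].
  have gS : general_position S.
    apply: general_position_of_coplanar => x y z u; rewrite !inE.
    move=> /andP[nx xA] /andP[_ yA] /andP[_ zA] /andP[_ uA] U.
    apply: contra nx => c; apply/imsetP; exists (x, y, z, u) => //.
    rewrite inE /P /= c andbT; apply/andP; split; first exact: U.
    by rewrite /D !subUset !sub1set xA yA zA uA.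
  apply: le_trans (_ : #|S|%:R <= _); last by rewrite ler_nat leq_alpha // subsetDl.
  have : (#|A| <= #|S| + #|quads A|)%N.
    rewrite -(cardsID [set i.1.1.1 | i in quads A] A) addnC leq_add2l.
    apply: leq_trans (subset_leq_card (subsetIr _ _)) _; exact: leq_imset_card.
  rewrite -(ler_nat R) natrD => A4.
  have half (a b c : R) : mu / 2 <= a -> c < mu / 4 -> a <= b + c -> 1 * (4^-1 * mu) <= b.
    by clear; lra.
  exact: half A1 A3 A4.
apply: le_trans.
have comb (a b c e1 e2 : R) : a <= b + c -> b <= e1 -> c <= e2 -> 1 - (e1 + e2) <= 1 - a.
  by clear; lra.
exact: comb both cheb markov.
Qed.

Lemma prob_alpha_moment p : 0 <= p <= 1 -> 0 < p ->
  1 - 4 / (p * Q) <= prob_random_subset p [pred A : {set 'rV[F]_3} | 1 / 4 * p * Q <= (alpha A)%:R].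
Proof.
move=> p01 p0.
have Q0 : 0 < Q by rewrite ltr0n; apply/card_gt0P; exists 0.
pose X := [set moment_point t | t : F].
have cX : #|X| = #|F| by rewrite card_imset //; exact: moment_point_inj.
have := @prob_chebyshev R _ p X p01; rewrite cX => /(_ (mulr_gt0 p0 Q0)) cheb.
rewrite -[leRHS]prob_compl lerD2l lerN2; apply: le_trans cheb.
apply: prob_mono => // A /=; apply: contra => /andP[A1 _].
apply: le_trans (_ : #|A :&: X|%:R <= _); last first.
  rewrite ler_nat; apply: leq_alpha; first exact: subsetIl.
  move=> T P /subset_trans TS; apply: moment_general_position.
  by apply: TS; apply: subsetIr.
have := mulr_gt0 p0 Q0; move: A1; lra.
Qed.

(** A first moment over independent sets of size [m]: [p ^+ m <= y ^+ m = expR (- m) * (expR 1 * y)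
    ^+ m], and adding the other sizes completes the partition function at [expR 1 * y]. *)
Lemma prob_alpha_gt p y m : 0 <= p <= 1 -> p <= y -> (4 <= m)%N ->
  prob_random_subset p [pred A : {set 'rV[F]_3} | m <= alpha A]%N <=
  expR (- m%:R) * partfun (expR 1 * y) [set A | indep A].
Proof.
move=> p01 py m4.
have p0 : 0 <= p by case/andP: p01.
have y0 : 0 <= y by apply: le_trans py.
pose P (D : {set 'rV[F]_3}) := indep D && (#|D| == m).
apply: le_trans (prob_markov (f := fun A => #|[set D | P D && (D \subset A)]|%:R) p01 ltr01 _ _) _ => //.
  move=> A /= mA; rewrite ler1n.
  have [|S [SA gS mS]] := @alpha_witness A m.-1; first by rewrite prednK // (leq_trans _ m4).
  have {}mS : (m <= #|S|)%N by rewrite -(prednK (leq_trans _ m4)).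
  have iS := general_position_independent gS (leq_trans m4 mS).
  have [D DS cD] : exists2 D : {set 'rV[F]_3}, D \subset S & #|D| = m.
    exists [set x in take m (enum S)].
      by apply/subsetP => x; rewrite inE => /mem_take; rewrite mem_enum.
    rewrite cardsE; have /card_uniqP -> := take_uniq m (enum_uniq S).
    by rewrite size_takel // -cardE.
  apply/card_gt0P; exists D; rewrite inE /P cD eqxx (independent_sub DS iS) /=.
  exact: subset_trans DS SA.
rewrite divr1 expect_count.
rewrite /partfun mulr_sumr big_mkcond [leRHS]big_mkcond; apply: ler_sum => D _.
rewrite inE /P; case: ifP => [/andP[-> /eqP cD]|_].
  rewrite cD exprMn -expRM_natl mulr1 mulrA -expRD addNr expR0 mul1r.
  by apply: lerXn2r.
by case: ifP => // _; rewrite mulr_ge0 ?exprn_ge0 ?expR_ge0 // mulr_ge0 ?expR_ge0.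
Qed.

End Alpha.

Lemma expR_half_le2 (R : realType) : expR (1 / 2) <= 2 :> R.
Proof.
have := expR_ge1Dx (- (1 / 2) : R); rewrite expRN.
have h0 : 0 < expR (1 / 2 : R) by apply: expR_gt0.
move: (expR _) h0 => e e0 H.
have := ler_wpM2r (ltW e0) H; rewrite mulVf ?gt_eqF //; lra.
Qed.

Lemma expR1_le4 (R : realType) : expR 1 <= 4 :> R.
Proof.
have -> : 1 = 1 / 2 + 1 / 2 :> R by lra.
rewrite expRD; have := expR_half_le2 R; have := expR_ge0 (1 / 2 : R).
move: (expR _) => e; nra.
Qed.

Lemma ceil_bounds (R : realType) (x : R) : 0 <= x ->
  exists n : nat, x < n%:R /\ n%:R <= x + 1.
Proof.
move=> x0; exists (Num.truncn x).+1; have /andP[H1 H2] := truncn_itv x0.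
by split=> //; rewrite -natr1 lerD2r.
Qed.

(** The density [y] is kept apart from [p] so that, below the threshold, the bound can be taken at
    the threshold density. With [i <= 5 * L] rounds and [a <= 4 * L / d], the cost [4 * s * a * i]
    is at most [80 * s * L ^ 2 / d], the constant in the hypothesis on [y]. *)
Lemma prob_alpha_upper (R : realType) (F : finFieldType) (p y s : R) :
  s ^+ 3 = #|F|%:R -> 0 <= p <= 1 -> p <= y -> 2 * (500 * 500) <= s ->
  1 <= ln (#|F|%:R : R) ->
  80 * (500 * 500) * s * ln (#|F|%:R : R) ^+ 2 <= y * #|F|%:R ->
  1 - (y * #|F|%:R)^-1 <= prob_random_subset p
     [pred A : {set 'rV[F]_3} | (alpha A)%:R <= 5 * (1000 * 1000) * (y * #|F|%:R)].
Proof.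
move=> s3 p01 py sl L1 yQ.
have s0 : 0 < s by apply: lt_le_trans sl; rewrite !mulr_gt0.
have q0 : (0 < #|F|)%N by apply/card_gt0P; exists 0.
have VE : #|{: 'rV[F]_3}| = (#|F| ^ 3)%N by rewrite card_mx mul1n.
have geo := affine_rank4_geometry F.
pose d : R := (500 * 500)^-1.
have d0 : 0 < d by rewrite invr_gt0 mulr_gt0.
have d1 : d * (500 * 500) <= 1 by rewrite mulVf // gt_eqF // mulr_gt0.
have ds : 2 <= d * s by rewrite mulrC ler_pdivlMr // mulr_gt0.
have [t tE] : exists t, t = y * #|F|%:R by exists (y * #|F|%:R).
rewrite -!tE in yQ *.
have [L LE] : exists L, L = ln (#|F|%:R : R) by exists (ln #|F|%:R).
rewrite -LE in L1 yQ.
have Q0 : 0 < #|F|%:R :> R by rewrite ltr0n.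
have QE : #|F|%:R = expR L by rewrite LE lnK // posrE.
have LQ : L <= #|F|%:R by rewrite LE ltW // ln_sublinear.
have p0 : 0 <= p by case/andP: p01.
have y0 : 0 <= y by apply: le_trans py.
have dd1 : d <= 1 by move: d1 d0; clear; nra.
(* [(1 - d) ^+ a <= expR (- d * a)] has to beat the number [q ^ 3 = expR (3 * L)] of points. *)
have [a [a1 a2]] : exists a : nat, 3 * L / d < a%:R /\ a%:R <= 3 * L / d + 1.
  by apply: ceil_bounds; rewrite divr_ge0 ?mulr_ge0 //; [exact: le_trans L1 | exact: ltW].
(* From [expR (1 / 2) <= 2] follows [2 ^ i >= expR (i / 2) >= q ^ 2], enough halvings to go from
   [q ^ 3] down to order [q]. *)
have [i [i1 i2]] : exists i : nat, 4 * L < i%:R /\ i%:R <= 4 * L + 1.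
  by apply: ceil_bounds; rewrite mulr_ge0 //; apply: le_trans L1.
have Ha : (1 - d) ^+ a * #|{: 'rV[F]_3}|%:R <= 1.
  have H1 : (1 - d) ^+ a <= expR (- (3 * L)).
    apply: le_trans (_ : expR (- d) ^+ a <= _).
      by apply: lerXn2r; rewrite ?nnegrE ?expR_ge0 ?subr_ge0 //; apply: expR_ge1Dx.
    rewrite -expRM_natl ler_expR mulrN lerN2.
    by move: a1; rewrite ltr_pdivrMr // => /ltW.
  have -> : #|{: 'rV[F]_3}|%:R = expR (3 * L) by rewrite VE natrX QE expRM_natl.
  apply: le_trans (ler_wpM2r (expR_ge0 _) H1) _.
  by rewrite -expRD addNr expR0.
have Hi : (#|{: 'rV[F]_3}| <= 1000 * 1000 * #|F| * 2 ^ i)%N.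
  rewrite VE (expnSr #|F| 2) mulnC -[X in (_ <= X)%N]mulnA.
  rewrite [X in (_ <= X)%N](_ : _ = 1000 * 1000 * 2 ^ i * #|F|)%N; last first.
    by rewrite [in RHS]mulnAC mulnA.
  rewrite mulnC leq_mul2r; apply/orP; right.
  apply: leq_trans (_ : 1 * 2 ^ i <= _)%N; last by rewrite leq_mul2r; apply/orP; right; rewrite muln_gt0.
  rewrite mul1n -(ler_nat R) !natrX QE.
  apply: le_trans (_ : expR (1 / 2) ^+ i <= _).
    rewrite -!expRM_natl ler_expR; move: i1; clear; lra.
  by apply: lerXn2r; rewrite ?nnegrE ?expR_ge0 //; apply: expR_half_le2.
have HM : 1000 * 1000 * #|F|%:R <= (1000 * 1000 * #|F|)%:R :> R by rewrite !natrM.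
have x0 : 0 <= expR 1 * y by rewrite mulr_ge0 ?expR_ge0.
have main := independent_partfun_le geo d0 d1 s3 ds HM x0 Ha Hi.
have sL : 1 <= s * L ^+ 2.
  have : 1 <= L ^+ 2 by rewrite exprn_ege1.
  have : 1 <= s by move: sl; clear; lra.
  by move: (L ^+ 2) => l; clear; nra.
have t1 : 1 <= t.
  apply: le_trans yQ; rewrite -mulrA; move: sL; clear; lra.
have T0 : 0 <= 5 * (1000 * 1000) * t by move: t1; clear; lra.
have /andP[m1 m2] := truncn_itv T0.
set m := (Num.truncn _).+1 in m2.
have m4 : (4 <= m)%N.
  rewrite -(ler_nat R); apply: le_trans (ltW m2); move: t1; clear; lra.
have bound := prob_alpha_gt F p01 py m4.
have := prob_compl p [pred A : {set 'rV[F]_3} | (alpha A)%:R <= 5 * (1000 * 1000) * t].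
move=> <-; rewrite lerD2l lerN2.
apply: le_trans (_ : prob_random_subset p [pred A : {set 'rV[F]_3} | (m <= alpha A)%N] <= _).
  apply: prob_mono => // A /=; rewrite -ltNge => H.
  by rewrite /m -(ltr_nat R); apply: le_lt_trans m1 H.
apply: le_trans bound _.
apply: le_trans (ler_wpM2l (expR_ge0 _) main) _.
rewrite -expRD.
apply: le_trans (_ : expR (- t) <= _); last first.
  rewrite expRN lef_pV2 ?posrE ?expR_gt0 //; last by apply: lt_le_trans t1.
  by apply: le_trans (expR_ge1Dx t); rewrite lerDr.
rewrite ler_expR.
have e4 := expR1_le4 R; have e0 : 0 <= expR 1 :> R := expR_ge0 1.
move: (expR 1) e4 e0 => e e4 e0.
have B1 : e * y * (1000 * 1000 * #|F|)%:R <= 4 * (1000 * 1000) * t.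
  rewrite !natrM tE.
  have -> : e * y * (1000 * 1000 * #|F|%:R) = e * (1000 * 1000 * (y * #|F|%:R)) by ring.
  have -> : 4 * (1000 * 1000) * (y * #|F|%:R) = 4 * (1000 * 1000 * (y * #|F|%:R)) by ring.
  by apply: ler_wpM2r => //; rewrite -tE; move: t1; clear; lra.
have a4 : a%:R <= 4 * L / d.
  apply: le_trans a2 _.
  have : 1 <= L / d by rewrite ler_pdivlMr // mul1r; apply: le_trans L1.
  by clear; lra.
have i5 : i%:R <= 5 * L by move: i2 L1; clear; lra.
have L0 : 0 <= L by move: L1; clear; lra.
have B2 : i%:R * (4 * s * a%:R) <= t.
  apply: le_trans (_ : 5 * L * (4 * s * (4 * L / d)) <= _).
    apply: ler_pM => //; first by rewrite !mulr_ge0 // ltW.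
    by apply: ler_wpM2l => //; rewrite mulr_ge0 // ltW.
  apply: le_trans yQ; rewrite /d invrK le_eqVlt; apply/orP; left; apply/eqP; ring.
have B3 : i%:R * (e * y) <= 20 * t.
  apply: le_trans (_ : 5 * L * (4 * y) <= _).
    apply: ler_pM => //; first by rewrite mulr_ge0.
    by apply: ler_wpM2r.
  rewrite tE; have := ler_wpM2l y0 LQ; clear; lra.
have comb (b1 b2 b3 r n : R) : b1 <= 4 * (1000 * 1000) * r -> b2 <= r -> b3 <= 20 * r ->
    5 * (1000 * 1000) * r < n -> 1 <= r -> - n + (b1 + (b2 + b3)) <= - r.
  by clear; lra.
by rewrite mulrDr; apply: comb B1 B2 B3 m2 t1.
Qed.

(** * Limits along the prime powers *)

From mathcomp Require Import all_classical all_reals all_analysis.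

Import numFieldNormedType.Exports.

Local Open Scope classical_set_scope.
Local Open Scope ring_scope.

#[local] Instance prime_powers_oo_filter : Filter prime_powers_oo.
Proof. exact: within_filter. Qed.

Lemma near_prime_powers_large (R : realType) (B : R) :
  \forall q \near prime_powers_oo, prime_power q /\ B <= q%:R.
Proof.
rewrite /prime_powers_oo near_withinE.
near=> q => qpp; split=> //; near: q; exact: nbhs_infty_ger.
Unshelve. all: by end_near. Qed.

Lemma cvg_prime_powers1 (R : realType) (f : nat -> R) :
  (forall e, 0 < e -> \forall q \near prime_powers_oo, 1 - e <= f q <= 1) ->
  f q @[q --> prime_powers_oo] --> (1 : R).
Proof.
move=> H; apply/cvgrPdist_le => e e0; near=> q.
have /andP[H1 H2] : 1 - e <= f q <= 1 by near: q; apply: H.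
by rewrite ger0_norm ?subr_ge0 // lerBlDr -lerBlDl.
Unshelve. all: by end_near. Qed.

Lemma prime_power_gt0 q : prime_power q -> (0 < q)%N.
Proof. by move=> [r [k [rp k0 ->]]]; rewrite expn_gt0 prime_gt0. Qed.

(** A sixth root makes all the powers integral and leaves room for the logarithm: [ln q <= 6 * u] is
    negligible against [q^(1/3) = u ^+ 2]. *)
Lemma cube_root (R : realType) (q : nat) : (0 < q)%N ->
  exists u : R, [/\ 0 < u, u ^+ 6 = q%:R, q%:R `^ (1 / 3) = u ^+ 2,
    q%:R `^ (- (2 / 3)) = u ^- 4 & q%:R `^ (- (8 / 3)) = u ^- 16 /\ ln q%:R <= 6 * u].
Proof.
move=> q0; have Q0 : 0 < q%:R :> R by rewrite ltr0n.
pose u : R := q%:R `^ (1 / 6).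
have u0 : 0 < u by apply: powR_gt0.
have uE n (z : R) : z = 1 / 6 * n%:R -> q%:R `^ z = u ^+ n.
  by move=> ->; rewrite powRrM powR_mulrn // ltW.
have u6 : u ^+ 6 = q%:R by rewrite -(uE _ 1) ?powRr1 ?ltW //; lra.
exists u; split=> //; last split.
- by apply: uE; lra.
- by rewrite powRN (uE 4) //; lra.
- by rewrite powRN (uE 16) //; lra.
- rewrite -u6 lnXn // -[leLHS]mulr_natl ler_pM2l //; exact/ltW/ln_sublinear.
Qed.

Theorem mainTheorem3 (R : realType) :
  exists C c1 c2 : R, [/\ 0 < C, 0 < c1, 0 < c2 &
  forall (F : nat -> finFieldType),
    (forall q : nat, prime_power q -> #|F q| = q) ->
  forall (p : nat -> R),
    (forall q : nat, prime_power q -> 0 <= p q <= 1) ->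
  [/\
    (* (a) *)
    (p q / (q%:R ^- 3) @[q --> prime_powers_oo] --> +oo) ->
    (p q / (q%:R `^ (- (8 / 3))) @[q --> prime_powers_oo] --> (0 : R)) ->
    prob_alpha_between (F q) (p q)
      (c1 * p q * q%:R ^+ 3) (c2 * p q * q%:R ^+ 3)
      @[q --> prime_powers_oo] --> (1 : R),
    (* (b) *)
    (\forall q \near prime_powers_oo,
       C * q%:R `^ (- (2 / 3)) * ln q%:R ^+ 2 <= p q <= 1) ->
    prob_alpha_between (F q) (p q) (c1 * p q * q%:R) (c2 * p q * q%:R)
      @[q --> prime_powers_oo] --> (1 : R)
  & (* (c) *)
    (\forall q \near prime_powers_oo,
       q%:R `^ (- (8 / 3)) / ln q%:R <= p q
         < C * q%:R `^ (- (2 / 3)) * ln q%:R ^+ 2) ->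
    prob_alpha_between (F q) (p q)
      (c1 * q%:R `^ (1 / 3) / ln q%:R)
      (c2 * q%:R `^ (1 / 3) * ln q%:R ^+ 2)
      @[q --> prime_powers_oo] --> (1 : R)]].
Proof.
(* [C] and [K] are the constants in the hypothesis and the conclusion of [prob_alpha_upper]. In (c)
   the bound [K * (y * q)] is taken at [y * q = C * u ^+ 2 * ln q ^+ 2], hence [c2 = K * C]. *)
pose C : R := 80 * (500 * 500); pose K : R := 5 * (1000 * 1000).
have C1 : 1 <= C by rewrite /C; lra.
have K2 : 2 <= K by rewrite /K; lra.
exists C, (1 / 4), (K * C); split; [lra|lra|by apply: mulr_gt0; lra|].
move=> F HF p Hp.
have KC : K <= K * C by rewrite ler_peMr //; lra.
have large (B : R) : 0 < B -> \forall q \near prime_powers_oo,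
    [/\ prime_power q, B <= ln q%:R & forall u : R, 0 < u -> u ^+ 6 = q%:R -> B <= u].
  move=> B0; have := near_prime_powers_large (Num.max (expR B) (B ^+ 6)).
  apply: filterS => q [qpp]; rewrite ge_max => /andP[H1 H2]; split=> //.
    by rewrite -[B]expRK ler_ln ?posrE ?expR_gt0 // ltr0n prime_power_gt0.
  by move=> u u0 uq; move: H2; rewrite -uq ler_pXn2r // nnegrE ltW.
split.
- move=> /cvgryPge Hinf /cvgr0Pnorm_le H0; apply: cvg_prime_powers1 => e e0.
  (* The second error term is [8 * (p * q^(8/3)) ^+ 3 <= 8 * b ^+ 3 <= 8 * b <= e / 2]. *)
  have [b [b0 b1 be]] : exists b : R, [/\ 0 < b, b <= 1 & 16 * b <= e].
    exists (Num.min 1 (e / 16)); split; rewrite ?lt_min ?ge_min ?lexx ?ltr01 ?divr_gt0 //=.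
    by apply: le_trans (_ : 16 * (e / 16) <= _); [rewrite ler_pM2l // ge_min lexx orbT | lra].
  near=> q.
  have [qpp _ _] : [/\ prime_power q, 1 <= ln (q%:R : R) & forall u : R, 0 < u -> u ^+ 6 = q%:R -> 1 <= u].
    by near: q; apply: large.
  have A1 : 8 / e <= p q / q%:R ^- 3 by near: q; apply: Hinf.
  have A2 : `|p q / q%:R `^ (- (8 / 3))| <= b by near: q; apply: H0.
  have p01 := Hp q qpp; have pge0 : 0 <= p q by case/andP: p01.
  have q0 := prime_power_gt0 qpp; have Q0 : 0 < q%:R :> R by rewrite ltr0n.
  have [u [u0 u6 _ _ [u16 _]]] := cube_root R q0.
  rewrite invrK in A1; rewrite u16 invrK ger0_norm ?mulr_ge0 ?exprn_ge0 ?(ltW u0) // in A2.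
  have pq0 : 0 < p q * q%:R ^+ 3 by apply: lt_le_trans A1; rewrite divr_gt0.
  have pgt0 : 0 < p q by rewrite -(pmulr_lgt0 _ (exprn_gt0 3 Q0)).
  have := prob_alpha_sparse (F q) p01 pgt0; rewrite HF // => B1.
  apply/andP; split; last exact: prob_le1.
  apply: le_trans (_ : _ <= prob_alpha_between (F q) (p q) (1 / 4 * p q * q%:R ^+ 3) (2 * p q * q%:R ^+ 3)) _; last first.
    apply: prob_mono => // A /= /andP[-> H] /=; apply: le_trans H _.
    by do 2 (apply: ler_wpM2r; first by rewrite ?exprn_ge0 // ltW); lra.
  apply: le_trans B1; rewrite lerD2l lerN2.
  have E1 : 4 / (p q * q%:R ^+ 3) <= e / 2.
    rewrite ler_pdivrMr //; have := ler_wpM2l (ltW e0) A1.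
    have -> : e * (8 / e) = 8 by field; rewrite gt_eqF.
    by clear; lra.
  have E2 : p q ^+ 3 * q%:R ^+ 8 <= b.
    have -> : p q ^+ 3 * q%:R ^+ 8 = (p q * u ^+ 16) ^+ 3 by rewrite -u6; ring.
    apply: le_trans (_ : p q * u ^+ 16 <= _) => //.
    by rewrite ler_iXnr ?mulr_ge0 ?exprn_ge0 ?(ltW u0) // (le_trans A2).
  move: E1 E2 be; clear; lra.
- move=> Hb; apply: cvg_prime_powers1 => e e0.
  near=> q.
  have [qpp L1 U1] : [/\ prime_power q, Num.max (500 * 1000) (5 / e) <= ln (q%:R : R) &
      forall u : R, 0 < u -> u ^+ 6 = q%:R -> Num.max (500 * 1000) (5 / e) <= u].
    by near: q; apply: large; rewrite lt_max divr_gt0 // orbT.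
  have /andP[A1 _] : C * q%:R `^ (- (2 / 3)) * ln q%:R ^+ 2 <= p q <= 1 by near: q; exact: Hb.
  have p01 := Hp q qpp.
  have q0 := prime_power_gt0 qpp; have Q0 : 0 < q%:R :> R by rewrite ltr0n.
  have [u [u0 u6 u2 u4 _]] := cube_root R q0.
  have := U1 u u0 u6; rewrite ge_max => /andP[U2 U3].
  move: L1; rewrite ge_max => /andP[L1 _]; rewrite u4 in A1.
  have l1 : 1 <= ln (q%:R : R) by move: L1; clear; lra.
  have l2 : 1 <= ln (q%:R : R) ^+ 2 by rewrite exprn_ege1.
  have uu : u <= u ^+ 2 by rewrite expr2 ler_peMr ?(ltW u0) //; move: U2; clear; lra.
  have pQ : C * u ^+ 2 * ln q%:R ^+ 2 <= p q * q%:R.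
    rewrite -[q%:R in X in _ <= X]u6.
    have -> : C * u ^+ 2 * ln q%:R ^+ 2 = C * u ^- 4 * ln q%:R ^+ 2 * u ^+ 6 by field; rewrite gt_eqF.
    by apply: ler_wpM2r => //; rewrite exprn_ge0 // ltW.
  have upQ : u <= p q * q%:R.
    apply: le_trans pQ; rewrite -mulrA -[u in leLHS]mul1r; apply: ler_pM => //; first exact: ltW.
    by rewrite -[leLHS]mulr1; apply: ler_pM => //; exact: ltW.
  have pQ0 : 0 < p q * q%:R by apply: lt_le_trans upQ.
  have pgt0 : 0 < p q by rewrite -(pmulr_lgt0 _ Q0).
  have := prob_alpha_moment (F q) p01 pgt0; rewrite HF // => B1.
  have s3 : (u ^+ 2) ^+ 3 = #|F q|%:R by rewrite HF // -exprM.
  have B2 : 1 - (p q * q%:R)^-1 <= prob_random_subset (p q)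
     [pred A : {set 'rV[F q]_3} | (alpha A)%:R <= K * (p q * q%:R)].
    have := @prob_alpha_upper R (F q) (p q) (p q) (u ^+ 2) s3 p01 (lexx _).
    rewrite HF //; apply=> //.
    by apply: le_trans uu; apply: le_trans U2; clear; lra.
  apply/andP; split; last exact: prob_le1.
  apply: le_trans (le_trans (prob_two_sided p01 B1 B2) (prob_mono p01 _)); last first.
    move=> A /= /andP[-> H] /=; apply: le_trans H _; rewrite -mulrA.
    by apply: ler_wpM2r => //; exact: ltW.
  rewrite lerD2l lerN2.
  have -> : 4 / (p q * q%:R) + (p q * q%:R)^-1 = 5 / (p q * q%:R) by move: pQ0; move: (p q * q%:R) => t t0; field; rewrite gt_eqF.
  rewrite ler_pdivrMr //; apply: le_trans (_ : e * u <= _); last by rewrite ler_pM2l.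
  by move: U3; rewrite ler_pdivrMr // mulrC.
- move=> Hc; apply: cvg_prime_powers1 => e e0.
  near=> q.
  have [qpp L1 U1] : [/\ prime_power q, Num.max (500 * 1000) (64 / e) <= ln (q%:R : R) &
      forall u : R, 0 < u -> u ^+ 6 = q%:R -> Num.max (500 * 1000) (64 / e) <= u].
    by near: q; apply: large; rewrite lt_max divr_gt0 // orbT.
  have /andP[A1 A2] : q%:R `^ (- (8 / 3)) / ln q%:R <= p q
         < C * q%:R `^ (- (2 / 3)) * ln q%:R ^+ 2 by near: q; exact: Hc.
  have p01 := Hp q qpp.
  have q0 := prime_power_gt0 qpp; have Q0 : 0 < q%:R :> R by rewrite ltr0n.
  have [u [u0 u6 u2 u4 [u16 L6]]] := cube_root R q0.
  have := U1 u u0 u6; rewrite ge_max => /andP[U2 U3].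
  move: L1; rewrite ge_max => /andP[L1 L3]; rewrite u4 in A2; rewrite u16 in A1.
  rewrite u2; move: A1 A2 L1 L3 L6.
  have [L LE] : exists L, L = ln (q%:R : R) by exists (ln q%:R).
  rewrite -LE => A1 A2 L1 L3 L6.
  have l1 : 1 <= L by move: L1; clear; lra.
  have l0 : 0 < L by apply: lt_le_trans l1.
  have l2 : 1 <= L ^+ 2 by rewrite exprn_ege1.
  have uu : u <= u ^+ 2 by rewrite expr2 ler_peMr ?(ltW u0) //; move: U2; clear; lra.
  (* The two ends of the range (c): monotonicity of [alpha] carries the lower bound up from [p'],
     where deletion still works since [p' * q^(8/3) = 1 / L], and the upper bound is taken at
     [y]. *)
  pose p' := u ^- 16 / L; pose y := C * u ^- 4 * L ^+ 2.
  have p'0 : 0 < p' by rewrite divr_gt0 // invr_gt0 exprn_gt0.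
  have p'1 : p' <= 1 by apply: le_trans A1 _; case/andP: p01.
  have p'01 : 0 <= p' <= 1 by rewrite ltW.
  have yQ : y * q%:R = C * u ^+ 2 * L ^+ 2.
    by rewrite -u6 /y; field; rewrite gt_eqF.
  have uyQ : u <= y * q%:R.
    rewrite yQ -mulrA -[u in leLHS]mul1r; apply: ler_pM => //; first exact: ltW.
    by rewrite -[leLHS]mulr1; apply: ler_pM => //; exact: ltW.
  have B1 : 1 - (24 / u + 8 / L) <= prob_random_subset (p q)
     [pred A : {set 'rV[F q]_3} | 1 / 4 * u ^+ 2 / L <= (alpha A)%:R].
    apply: le_trans (prob_increasing (ltW p'0) A1 _ _); last 2 first.
    - by case/andP: p01.
    - by move=> A B AB /= H; apply: le_trans H _; rewrite ler_nat; apply: alphaS.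
    have := prob_alpha_sparse (F q) p'01 p'0; rewrite HF // => B1.
    apply: le_trans (le_trans B1 (prob_mono p'01 _)); last first.
      move=> A /= /andP[H _]; apply: le_trans H; rewrite le_eqVlt; apply/orP; left; apply/eqP.
      by rewrite -u6 /p'; field; rewrite !gt_eqF.
    rewrite lerD2l lerN2; apply: lerD.
      (* [L <= 6 * u] turns this into the error term [24 / u]. *)
      have -> : 4 / (p' * q%:R ^+ 3) = 4 * L / u ^+ 2.
        by rewrite -u6 /p'; field; rewrite !gt_eqF.
      have -> : 24 / u = 24 * u / u ^+ 2 by field; rewrite gt_eqF.
      by rewrite ler_pM2r ?invr_gt0 ?exprn_gt0 //; move: L6; clear; lra.
    have -> : 8 * (p' ^+ 3 * q%:R ^+ 8) = 8 / L / L ^+ 2.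
      by rewrite -u6 /p'; field; rewrite !gt_eqF.
    rewrite ler_pdivrMr; last by apply: lt_le_trans l2.
    by rewrite ler_peMr // divr_ge0 // ltW.
  have s3 : (u ^+ 2) ^+ 3 = #|F q|%:R by rewrite HF // -exprM.
  have B2 : 1 - (y * q%:R)^-1 <= prob_random_subset (p q)
     [pred A : {set 'rV[F q]_3} | (alpha A)%:R <= K * (y * q%:R)].
    have := @prob_alpha_upper R (F q) (p q) y (u ^+ 2) s3 p01 (ltW A2).
    rewrite HF // -LE; apply=> //; last by rewrite yQ.
    by apply: le_trans uu; apply: le_trans U2; clear; lra.
  apply/andP; split; last exact: prob_le1.
  apply: le_trans (le_trans (prob_two_sided p01 B1 B2) (prob_mono p01 _)); last first.
    move=> A /= /andP[-> H] /=; apply: le_trans H _; rewrite yQ !mulrA; exact: lexx.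
  rewrite lerD2l lerN2.
  have E1 : 64 / u <= e by rewrite ler_pdivrMr // mulrC -ler_pdivrMr.
  have E2 : 64 / L <= e by rewrite ler_pdivrMr // mulrC -ler_pdivrMr.
  have E3 : (y * q%:R)^-1 <= u^-1 by rewrite lef_pV2 ?posrE //; apply: lt_le_trans uyQ.
  have comb (a b c : R) : 0 <= b -> 0 <= c -> 64 * b <= e -> 64 * c <= e -> a <= b ->
      24 * b + 8 * c + a <= e by clear; lra.
  by apply: comb E1 E2 E3; rewrite invr_ge0 ltW.
Unshelve. all: by end_near. Qed.
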